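(* Let $\Omega\subset\mathbb{R}^d$ be open, $T>0$, and let $(\rho,u)$ be a weak solution on $(0,T)\times\Omega$ to the isentropic compressible Euler system with pressure law $p\in C(\mathbb{R})$ such that $p(0)=0$ and external force $f$. Assume that $u\in L^3((0,T)\times\Omega;\mathbb{R}^d)$, that $\rho\in L^\infty((0,T)\times\Omega)$ satisfies $\rho(t,x)\ge c>0$ for a.e. $(t,x)$ for some constant $c>0$, and that $f\in L^{3/2}((0,T)\times\Omega;\mathbb{R}^d)$. Fix a radial kernel $\eta\in C_c^\infty(B_1;[0,1])$ with $\int\eta=1$. Then the defect distribution $D$ satisfies $$D=\lim_{\ell\to0}\big(J_1^\ell+J_2^\ell\big)$$ in the sense of distributions, where $$J_1^\ell:=\overline{\rho}\,\big(\widetilde{u}\otimes\widetilde{u}-\widetilde{u\otimes u}\big):E\widetilde{u},\qquad E\widetilde{u}:=\frac{\nabla\widetilde{u}+(\nabla\widetilde{u})^T}{2},$$ $$J_2^\ell:=\mathrm{div}(\widetilde{u})\,\big(p(\overline{\rho})-\overline{p(\rho)}\big).$$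
   Context: The isentropic compressible Euler system is $$\partial_t(\rho u)+\mathrm{div}(\rho u\otimes u)+\nabla p(\rho)=\rho f,\qquad \partial_t\rho+\mathrm{div}(\rho u)=0\qquad\text{in }(0,T)\times\Omega,$$ and weak solutions are understood in the sense of distributions on $(0,T)\times\Omega$ (no initial or boundary conditions). The defect distribution $D$ is defined by $$-D:=\partial_t\Big(\frac{\rho|u|^2}{2}+\mathcal{P}(\rho)\Big)+\mathrm{div}\Big(u\Big(\frac{\rho|u|^2}{2}+p(\rho)+\mathcal{P}(\rho)\Big)\Big)-\rho f\cdot u,$$ with internal energy $\mathcal{P}(\rho):=\rho\int_1^\rho\frac{p(r)}{r^2}\,dr$ if $\rho>0$ and $\mathcal{P}(0):=0$. Mollification is in the space variable only: $\eta_\ell(x):=\ell^{-d}\eta(x/\ell)$ and, for a function $g$ (at each fixed time), $$\overline{g}:=g*\eta_\ell,\qquad \widetilde{g}:=\frac{\overline{\rho g}}{\overline{\rho}}=\frac{(\rho g)*\eta_\ell}{\rho*\eta_\ell}.$$ If $\Omega\ne\mathbb{R}^d$, these are defined at points of distance larger than $\ell$ from $\partial\Omega$; against a given compactly supported test function the expressions make sense for all small $\ell$. *)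

(* Defs.v *)
From HB Require Import structures.
From mathcomp Require Import all_boot all_order all_algebra.
From mathcomp Require Import all_classical all_reals all_analysis.

Set Implicit Arguments.
Unset Strict Implicit.
Unset Printing Implicit Defensive.
Import Order.TTheory GRing.Theory Num.Theory.
Import numFieldNormedType.Exports.

Local Open Scope classical_set_scope.
Local Open Scope ring_scope.

(* The sigma-algebra on 'rV_n is generated by the coordinates; it coincides with
   the Borel sigma-algebra. *)
Definition rV_display : measure_display -> measure_display.
Proof. exact. Qed.

Section measurable_rV.
Context {R : realType} {n : nat}.

Let coor (i : 'I_n) (x : 'rV[R]_n) : measurableTypeR R := x ord0 i.

Let rV_set0 : g_sigma_preimage coor set0.
Proof. exact: sigma_algebra0. Qed.

Let rV_setC A : g_sigma_preimage coor A -> g_sigma_preimage coor (~` A).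
Proof. exact: sigma_algebraC. Qed.

Let rV_bigcup (F : _^nat) : (forall i, g_sigma_preimage coor (F i)) ->
  g_sigma_preimage coor (\bigcup_i (F i)).
Proof. exact: sigma_algebra_bigcup. Qed.

HB.instance Definition _ := @isMeasurable.Build
  (rV_display default_measure_display)
  'rV[R]_n (g_sigma_preimage coor) rV_set0 rV_setC rV_bigcup.

End measurable_rV.

Lemma measurable_coord (R : realType) n (i : 'I_n) :
  measurable_fun [set: 'rV[R]_n] (fun x : 'rV[R]_n => x ord0 i).
Proof.
move=> _ Y mY; rewrite setTI; apply: sub_sigma_algebra => /=.
rewrite -bigcup_seq/=; exists i => /=; first by rewrite mem_index_enum.
by exists Y => //; rewrite setTI.
Qed.

Lemma measurable_fun_rV d (T : measurableType d) (R : realType) n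
    (f : T -> 'rV[R]_n) :
  (forall i, measurable_fun setT (fun t => f t ord0 i)) ->
  measurable_fun setT f.
Proof.
move=> mf _ Y mY; rewrite setTI.
pose G := [set A : set 'rV[R]_n | measurable (f @^-1` A)].
suff : measurable `<=` G by exact.
apply: smallest_sub; first split=> [|A|F mF]; rewrite /G /=.
  - by rewrite preimage_set0; exact: measurable0.
  - by move=> mA; rewrite setTD preimage_setC; exact: measurableC.
  - by rewrite preimage_bigcup; apply: bigcup_measurable => k _; exact: mF.
rewrite -bigcup_seq => A [i _ [B mB <-]].
rewrite /G /= setTI -comp_preimage -[X in measurable X]setTI.
exact: mf.
Qed.

Section lebesgue_rV.
Context {R : realType}.

Definition rV_cons n (z : measurableTypeR R * 'rV[R]_n) : 'rV[R]_n.+1 :=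
  \row_i if unlift ord0 i is Some j then z.2 ord0 j else z.1.

Definition rV_uncons n (x : 'rV[R]_n.+1) : measurableTypeR R * 'rV[R]_n :=
  (x ord0 ord0, \row_j x ord0 (lift ord0 j)).

Lemma rV_consK n : cancel (@rV_cons n) (@rV_uncons n).
Proof.
case=> a v; rewrite /rV_uncons mxE unlift_none /=; congr pair.
by apply/rowP => j; rewrite !mxE liftK.
Qed.

Lemma measurable_rV_cons n : measurable_fun setT (@rV_cons n).
Proof.
apply: measurable_fun_rV => i; under eq_fun do rewrite mxE.
case: unliftP => [j _|_]; last exact: measurable_fst.
exact: (measurableT_comp (@measurable_coord R n j) measurable_snd).
Qed.

Lemma measurable_rV_uncons n : measurable_fun setT (@rV_uncons n).
Proof.
apply: measurable_fun_pair; first exact: measurable_coord.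
apply: measurable_fun_rV => i; under eq_fun do rewrite mxE.
exact: measurable_coord.
Qed.

Section rV_step.
Variables (n : nat) (m : {sigma_finite_measure set 'rV[R]_n -> \bar R}).

Definition lebesgue_rV_step : set 'rV[R]_n.+1 -> \bar R :=
  pushforward (lebesgue_measure \x m)%E (@rV_cons n).

Let step0 : lebesgue_rV_step set0 = 0%E.
Proof. by rewrite /lebesgue_rV_step /pushforward preimage_set0 measure0. Qed.

Let step_ge0 A : (0 <= lebesgue_rV_step A)%E.
Proof. exact: (measure_ge0 (lebesgue_measure \x m)%E). Qed.

Let mpreimage (A : set 'rV[R]_n.+1) :
  measurable A -> measurable (@rV_cons n @^-1` A).
Proof. by move=> mA; rewrite -[X in measurable X]setTI; exact: measurable_rV_cons. Qed.

Let step_sigma_additive : semi_sigma_additive lebesgue_rV_step.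
Proof.
move=> F mF tF mUF; rewrite /lebesgue_rV_step /pushforward preimage_bigcup.
apply: measure_semi_sigma_additive; first by move=> k; exact: mpreimage.
- apply/trivIsetP => /= i j _ _ ij; rewrite -preimage_setI.
  by move/trivIsetP : tF => /(_ _ _ _ _ ij) ->//; rewrite preimage_set0.
- by rewrite -preimage_bigcup; exact: mpreimage.
Qed.

HB.instance Definition _ := isMeasure.Build _ _ _ lebesgue_rV_step
  step0 step_ge0 step_sigma_additive.

Let step_sigma_finite : sigma_finite setT lebesgue_rV_step.
Proof.
have /sigma_finiteP[F [TF ndF Foo]] :=
  sigma_finiteT (@lebesgue_measure R : set (measurableTypeR R) -> \bar R).
have /sigma_finiteP[G [TG ndG Goo]] := sigma_finiteT m.
exists (fun k => @rV_uncons n @^-1` (F k `*` G k)).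
  rewrite -preimage_bigcup (_ : \bigcup_k _ = setT) ?preimage_setT//.
  rewrite -setXTT TF TG predeqE => -[x y]; split; first by move=> [k _ []]; split; exists k.
  move=> [/= [k _ Fkx] [l _ Gly]]; exists (maxn k l) => //; split.
  - by move: x Fkx; exact/subsetPset/ndF/leq_maxl.
  - by move: y Gly; exact/subsetPset/ndG/leq_maxr.
move=> k; have [mF Fkoo] := Foo k; have [mG Gkoo] := Goo k; split.
  rewrite -[X in measurable X]setTI.
  by apply: measurable_rV_uncons => //; exact: measurableX.
rewrite /lebesgue_rV_step /pushforward -comp_preimage.
have -> : @rV_uncons n \o @rV_cons n = id.
  by apply/funext => z; exact: rV_consK.
rewrite preimage_id product_measure1E// lte_mul_pinfty// ge0_fin_numE//.
Qed.

HB.instance Definition _ := Measure_isSigmaFinite.Build _ _ _ lebesgue_rV_step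
  step_sigma_finite.

End rV_step.

Fixpoint lebesgue_rV n : {sigma_finite_measure set 'rV[R]_n -> \bar R} :=
  match n with
  | 0 => \d_ (0 : 'rV[R]_0)
  | n.+1 => lebesgue_rV_step (lebesgue_rV n)
  end.

Lemma lebesgue_rV_box n (a b : 'rV[R]_n) : (forall i, a ord0 i <= b ord0 i) ->
  lebesgue_rV n [set x | forall i, x ord0 i \in `[a ord0 i, b ord0 i]] =
  (\prod_i (b ord0 i - a ord0 i))%:E.
Proof.
elim: n a b => [|n IHn] a b ab.
  rewrite big_ord0 /= diracE; case: (_ \in _) / boolP => //= /negP[].
  by rewrite inE => -[].
pose B (c d : 'rV[R]_n) := [set x : 'rV[R]_n | forall i, x ord0 i \in `[c ord0 i, d ord0 i]].
have -> : lebesgue_rV n.+1 [set x | forall i, x ord0 i \in `[a ord0 i, b ord0 i]] =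
  (lebesgue_measure \x lebesgue_rV n)%E
    (`[a ord0 ord0, b ord0 ord0] `*` B (rV_uncons a).2 (rV_uncons b).2).
  rewrite /= /lebesgue_rV_step /pushforward; congr (product_measure1 _ _ _).
  apply/seteqP; split=> -[s v] /=.
    move=> h; split=> /=; first by have := h ord0; rewrite mxE unlift_none.
    by move=> j; have := h (lift ord0 j); rewrite !mxE liftK.
  case=> /= hs hv i; rewrite mxE; case: unliftP => [j ->|->] //=.
  by have := hv j; rewrite !mxE.
rewrite product_measure1E.
- rewrite IHn; last by move=> i; rewrite !mxE.
  rewrite [X in (X * _)%E](_ : _ = (b ord0 ord0 - a ord0 ord0)%:E); last first.
    rewrite [LHS]lebesgue_measure_itv /= lte_fin; case: ltP => [_|h]; first by rewrite EFinB.
    have -> : b ord0 ord0 = a ord0 ord0 by apply/le_anti; rewrite h ab.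
    by rewrite subrr.
  rewrite big_ord_recl -EFinM; congr (_ * _)%:E.
  by apply: eq_bigr => i _; rewrite !mxE.
- exact: measurable_itv.
- rewrite /B (_ : mkset _ = \bigcap_(i in [set: 'I_n]) ((fun x : 'rV[R]_n => x ord0 i) @^-1`
     `[(rV_uncons a).2 ord0 i, (rV_uncons b).2 ord0 i])); last first.
    by apply/seteqP; split=> x /= h i; [move=> _|]; exact: h.
  apply: fin_bigcap_measurable => [|i _]; first exact: finite_finset.
  rewrite -[X in measurable X]setTI.
  by apply: measurable_coord => //; exact: measurable_itv.
Qed.

End lebesgue_rV.

Notation lebesgue_tx R d := (@lebesgue_measure R \x @lebesgue_rV R d)%E.

Section smooth.
Context {R : realType} {V : normedModType R}.

(* On a finite-dimensional V this is the usual class C^n: all directional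
   derivatives of order at most n exist and are continuous. *)
Fixpoint Cn (n : nat) (phi : V -> R) : Prop :=
  continuous phi /\
  match n with
  | 0 => True
  | n.+1 => forall v, (forall x, derivable phi x v) /\ Cn n ('D_v phi)
  end.

Definition smooth (phi : V -> R) : Prop := forall n, Cn n phi.

Definition supp (phi : V -> R) : set V := closure [set x | phi x != 0].

Definition test_function (U : set V) (phi : V -> R) : Prop :=
  [/\ smooth phi, compact (supp phi) & supp phi `<=` U].

End smooth.

Section euclidean.
Context {R : realType} {d : nat}.
Implicit Types x y : 'rV[R]_d.

Definition dotv x y : R := \sum_i x ord0 i * y ord0 i.

(* The norm `|x| of the library on 'rV_d is the sup norm. *)
Definition enorm x : R := Num.sqrt (dotv x x).

Definition otimes x y : 'M[R]_d := x^T *m y.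

Definition ddot (A B : 'M[R]_d) : R := \sum_i \sum_j A i j * B i j.

End euclidean.

Section fields.
Context {R : realType} {d : nat}.
Local Notation E := 'rV[R]_d.
Local Notation X := (R * E)%type.
Local Notation mu := (lebesgue_tx R d).
Implicit Types (Q : set X) (F phi : X -> R) (v : X -> E).

Definition cylinder (T : R) (Omega : set E) : set X := `]0, T[ `*` Omega.

Definition dt F : X -> R := 'D_((1, 0) : X) F.

Definition dx (i : 'I_d) F : X -> R := 'D_((0, delta_mx ord0 i) : X) F.

Definition divx v : X -> R := fun z => \sum_i dx i (fun w => v w ord0 i) z.

Definition gradx v : X -> 'M[R]_d :=
  fun z => \matrix_(i, j) dx j (fun w => v w ord0 i) z.

Definition symgradx v : X -> 'M[R]_d :=
  fun z => 2^-1 *: (gradx v z + (gradx v z)^T).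

Definition Lp_scalar Q (p : \bar R) F : Prop := F \_ Q \in Lfun mu p.

Definition Lp_vector Q (p : \bar R) v : Prop :=
  forall i, Lp_scalar Q p (fun z => v z ord0 i).

(* Distributions on Q are represented by their action on test functions. *)
Definition distribution := (X -> R) -> R.

Definition distr Q F : distribution :=
  fun phi => \int[mu]_(z in Q) (F z * phi z).

Definition distr_dt (L : distribution) : distribution := fun phi => - L (dt phi).

Definition distr_dx (i : 'I_d) (L : distribution) : distribution :=
  fun phi => - L (dx i phi).

(* Lebesgue integrability; [integrable] alone would ask for Borel
   measurability, which is not stable under modification on a null set. *)
Definition ae_integrable Q F : Prop :=
  exists2 G : X -> R, mu.-integrable Q (EFin \o G) &
    {ae mu, forall z, Q z -> F z = G z}.

(* Only the values of F l on the support of phi matter, and only for small l. *)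
Definition distr_cvg0 Q (F : R -> X -> R) (L : distribution) : Prop :=
  forall phi, test_function Q phi ->
    (\forall l \near 0^'+, ae_integrable Q (fun z => F l z * phi z)) /\
    distr Q (F l) phi @[l --> 0^'+] --> L phi.

End fields.

Section euler.
Context {R : realType} {d : nat}.
Local Notation E := 'rV[R]_d.
Local Notation X := (R * E)%type.
Implicit Types (Q : set X) (p : R -> R) (rho : X -> R) (u f : X -> E).

(* The integrands below are integrable as soon as rho and p \o rho are bounded,
   u is square integrable and f integrable on the supports of test functions. *)
Definition weak_solution Q p rho u f : Prop :=
  (forall (i : 'I_d) phi, test_function Q phi ->
     distr_dt (distr Q (fun z => rho z * u z ord0 i)) phi
     + \sum_j distr_dx j
         (distr Q (fun z => rho z * otimes (u z) (u z) i j)) phi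
     + distr_dx i (distr Q (fun z => p (rho z))) phi
     = distr Q (fun z => rho z * f z ord0 i) phi) /\
  (forall phi, test_function Q phi ->
     distr_dt (distr Q rho) phi
     + \sum_j distr_dx j (distr Q (fun z => rho z * u z ord0 j)) phi = 0).

Definition internal_energy p (r : R) : R :=
  if 0 < r then
    r * (if 1 <= r then \int[lebesgue_measure]_(s in `[1, r]) (p s / s ^+ 2)
         else - \int[lebesgue_measure]_(s in `[r, 1]) (p s / s ^+ 2))
  else 0.

Definition defect Q p rho u f : distribution :=
  let kin z := rho z * enorm (u z) ^+ 2 / 2 in
  let P z := internal_energy p (rho z) in
  fun phi =>
  - (distr_dt (distr Q (fun z => kin z + P z)) phi
     + \sum_j distr_dx j
         (distr Q (fun z => u z ord0 j * (kin z + p (rho z) + P z))) phi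
     - distr Q (fun z => rho z * dotv (f z) (u z)) phi).

End euler.

Section mollification.
Context {R : realType} {d : nat}.
Local Notation E := 'rV[R]_d.
Local Notation X := (R * E)%type.
Implicit Types (Omega : set E) (p : R -> R) (rho g : X -> R) (u : X -> E).

Definition radial_kernel (eta : E -> R) : Prop :=
  [/\ test_function [set x | enorm x < 1] eta,
      forall x, 0 <= eta x <= 1,
      forall x y, enorm x = enorm y -> eta x = eta y &
      \int[lebesgue_rV d]_x eta x = 1].

Variables (Omega : set E) (eta : E -> R) (l : R).

Definition eta_l (x : E) : R := l ^- d * eta (l^-1 *: x).

(* When the ball of radius l around z.2 lies in Omega the restriction to Omega
   is no restriction; elsewhere the value is a dummy. *)
Definition moll g : X -> R :=
  fun z => \int[lebesgue_rV d]_(y in Omega) (g (z.1, y) * eta_l (z.2 - y)).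

Definition favre rho g : X -> R :=
  fun z => moll (fun w => rho w * g w) z / moll rho z.

Definition favre_vec rho u : X -> E :=
  fun z => \row_i favre rho (fun w => u w ord0 i) z.

Definition favre_mx rho (A : X -> 'M[R]_d) : X -> 'M[R]_d :=
  fun z => \matrix_(i, j) favre rho (fun w => A w i j) z.

Definition J1 rho u : X -> R :=
  let ut := favre_vec rho u in
  let uut := favre_mx rho (fun w => otimes (u w) (u w)) in
  fun z => moll rho z *
    ddot (otimes (ut z) (ut z) - uut z) (symgradx ut z).

Definition J2 p rho u : X -> R :=
  fun z => divx (favre_vec rho u) z *
    (p (moll rho z) - moll (fun w => p (rho w)) z).

End mollification.

(* Main.v *)
(* Write r, m, M, q, F for the regularisations of rho, rho u, rho u (x) u, p(rho), rho f, and
   v = m / r. The Euler system is linear in these five fields, so r, m, M, q, F satisfy it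
   exactly wherever the kernel stays inside the domain. If they are smooth, multiplying the
   momentum balance by v gives the energy balance of (r, v) with pressure p(r), up to the work of
   the stress m (x) m / r - M against grad v and the term div v (p(r) - q): these are J1 and J2.
   Smoothness in time is obtained by mollifying in time too, with a parameter sent to 0 while l is
   fixed. When l tends to 0, the remaining terms converge to the defect tested with phi: the
   fields converge in L1, and along a sequence converging fast enough the cubic integrands are
   dominated by averages of the integrable function |u|^3 + |f|^(3/2). *)
From HB Require Import structures.
Require Import Defs.
From mathcomp Require Import all_boot all_order all_algebra.
From mathcomp Require Import all_classical all_reals all_analysis.
From mathcomp Require Import measurable_realfun ring lra.

Set Implicit Arguments.
Unset Strict Implicit.
Unset Printing Implicit Defensive.
Import Order.TTheory GRing.Theory Num.Theory.
Import numFieldNormedType.Exports.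

Local Open Scope classical_set_scope.
Local Open Scope ring_scope.

(** * Translation and scaling invariance of Lebesgue measure *)

(** No bound on the gradient of v is available uniformly in l, so the two limit terms are never
    estimated as l tends to 0. For each fixed l their tested sum equals the integral of an
    expression in which only phi is differentiated, and the limit is taken there. The obstacle is
    then a majorant for products of averages, such as the average of |u|^2 times the average of |u|.
    Young's inequality s^2 t <= s^3 + t^3, used between values at two different points, supplies it.
    With s = |f|^(1/2) it covers the work of the force as well, so velocity and force share one
    majorant. Averages of that majorant still depend on l, hence it is listed among the fields whose
    averages must converge in L1.

    The fields are given on the domain only, with almost everywhere bounds. For each phi they are
    replaced by fields that vanish outside a bounded neighbourhood B of supp phi and whose density
    is clamped. Convolutions then run over the whole space, and near supp phi the averaged density
    stays in a compact interval of positive numbers, where 1/r and the internal energy are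
    continuous. *)

Section affine_R.
Context {R : realType}.
Notation mu := (@lebesgue_measure R).
Local Open Scope ereal_scope.

Lemma measurable_affine (a b : R) :
  measurable_fun [set: measurableTypeR R]
    ((fun x => a * x + b)%R : measurableTypeR R -> measurableTypeR R).
Proof.
by apply: measurable_funD => //; exact: measurable_funM.
Qed.

(** Uniqueness of Lebesgue measure: [a] times the pushforward of [mu] under the affine map gives
    every half-open interval its length. *)
Lemma ge0_integral_affine (a b : R) (f : R -> \bar R) : (0 < a)%R ->
  measurable_fun [set: measurableTypeR R] f -> (forall x, 0 <= f x) ->
  \int[mu]_x f x = a%:E * \int[mu]_x f (a * x + b)%R.
Proof.
move=> a0 mf f0.
pose h : measurableTypeR R -> measurableTypeR R := (fun x => a * x + b)%R.
have mh : measurable_fun setT h := measurable_affine a b.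
pose k := NngNum (ltW a0).
have [nu nuE] : exists nu : {measure set (measurableTypeR R) -> \bar R},
    (nu : set _ -> \bar R) = pushforward mu h.
  by unshelve eexists (pushforward mu h : {measure set _ -> \bar R}).
have E A : measurable A -> mu A = mscale k nu A.
  apply: lebesgue_measure_unique => // _ [[x y] _ <-].
  rewrite [RHS](_ : _ = a%:E * pushforward mu h `]x, y]%classic); last by rewrite -nuE.
  rewrite /pushforward/=.
  rewrite [X in _ = _ * mu X](_ : _ = `](x - b) / a, (y - b) / a]%classic)%R; last first.
    apply/seteqP; split=> z /=; rewrite !in_itv/= /h.
      by rewrite ltr_pdivrMr// ler_pdivlMr// ltrBlDr lerBrDr mulrC.
    by rewrite ltr_pdivrMr// ler_pdivlMr// ltrBlDr lerBrDr mulrC.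
  rewrite !lebesgue_measure_itv/= !lte_fin.
  rewrite ltr_pM2r ?invr_gt0// ltrD2r; case: ifP => _; last by rewrite mule0.
  rewrite -!EFinD -EFinM; congr EFin.
  by rewrite -mulrBl opprB addrA subrK mulrC divfK ?gt_eqF.
transitivity (\int[mscale k nu]_x f x).
  by apply: eq_measure_integral => // A mA _; exact: E.
rewrite ge0_integral_mscale//.
by rewrite nuE ge0_integral_pushforward// preimage_setT.
Qed.

End affine_R.

Section rV.
Context {R : realType}.
Local Open Scope ereal_scope.

Lemma measurable_rV_coordP d (T : measurableType d) n (f : T -> 'rV[R]_n) D :
  measurable_fun D f -> forall i, measurable_fun D (fun t => f t ord0 i).
Proof.
by move=> mf i; apply: (@measurableT_comp _ _ _ _ _ _ (fun x : 'rV[R]_n => x ord0 i)) => //;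
  exact: measurable_coord.
Qed.

(** The measure in dimension [n.+1] is by construction a pushforward of a product, so Tonelli peels
    off the first coordinate. All inductions on the dimension rest on this. *)
Lemma ge0_integral_rVS n (f : 'rV[R]_n.+1 -> \bar R) :
  measurable_fun setT f -> (forall x, 0 <= f x) ->
  \int[lebesgue_rV n.+1]_x f x =
  \int[lebesgue_measure]_s \int[lebesgue_rV n]_v f (rV_cons (s, v)).
Proof.
move=> mf f0.
rewrite (ge0_integral_pushforward (@measurable_rV_cons R n))//.
rewrite preimage_setT fubini_tonelli1//.
  by apply: measurableT_comp => //; exact: measurable_rV_cons.
by move=> z; exact: f0.
Qed.

Lemma measurable_rV_affine n (a : R) (v : 'rV[R]_n) :
  measurable_fun setT (fun x : 'rV[R]_n => (a *: x + v)%R).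
Proof.
apply: measurable_fun_rV => i; under eq_fun do rewrite !mxE.
by apply: measurable_funD => //; apply: measurable_funM => //; exact: measurable_coord.
Qed.

Lemma measurable_rV_shift n (v : 'rV[R]_n) :
  measurable_fun setT (fun x : 'rV[R]_n => (x + v)%R).
Proof.
by rewrite [X in measurable_fun _ X](_ : _ = fun x => (1 *: x + v)%R);
  [exact: measurable_rV_affine|apply/funext => x; rewrite scale1r].
Qed.

(** Induction on the dimension: each coordinate contributes one factor [a]. *)
Lemma ge0_integral_rV_affine n (a : R) (v : 'rV[R]_n) (f : 'rV[R]_n -> \bar R) :
  (0 < a)%R -> measurable_fun setT f -> (forall x, 0 <= f x) ->
  \int[lebesgue_rV n]_x f x =
  (a ^+ n)%:E * \int[lebesgue_rV n]_x f (a *: x + v)%R.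
Proof.
move=> a0; elim: n v f => [|n IH] v f mf f0.
  rewrite expr0 mul1e; apply: eq_integral => x _; congr f.
  by rewrite [LHS]thinmx0 [RHS]thinmx0.
rewrite ge0_integral_rVS//.
pose F s := \int[lebesgue_rV n]_w f (rV_cons (s, w)).
have mfc : measurable_fun setT (f \o @rV_cons R n).
  by apply: measurableT_comp => //; exact: measurable_rV_cons.
have mF : measurable_fun setT F.
  by apply: (measurable_fun_fubini_tonelli_F (f \o @rV_cons R n)) => // z; exact: f0.
rewrite -/F (ge0_integral_affine (v ord0 ord0) a0 mF); last first.
  by move=> x; exact: integral_ge0.
rewrite ge0_integral_rVS//; last first.
  by apply: measurableT_comp => //; exact: measurable_rV_affine.
rewrite exprS EFinM -muleA; congr (_ * _).
have e s : F (a * s + v ord0 ord0)%R = (a ^+ n)%:E *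
   \int[lebesgue_rV n]_w f (a *: rV_cons (s, w) + v)%R.
  rewrite /F (IH (rV_uncons v).2)//; last first.
    by apply: (measurableT_comp mfc); exact: pair1_measurable.
  congr (_ * _); apply: eq_integral => w _; congr f.
  apply/rowP => i; rewrite !mxE; case: unliftP => [j ->|->]//=.
  by rewrite !mxE.
under eq_integral do rewrite e.
rewrite ge0_integralZl_EFin//.
- by move=> s _; exact: integral_ge0.
- apply: (measurable_fun_fubini_tonelli_F
   (fun z => f (a *: @rV_cons R n z + v)%R)) => //.
  apply: measurableT_comp => //.
  apply: (@measurableT_comp _ _ _ _ _ _ (fun x : 'rV[R]_n.+1 => (a *: x + v)%R)).
    exact: measurable_rV_affine.
  exact: measurable_rV_cons.
- by rewrite exprn_ge0// ltW.
Qed.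

Lemma ge0_integral_rV_shift n (v : 'rV[R]_n) (f : 'rV[R]_n -> \bar R) :
  measurable_fun setT f -> (forall x, 0 <= f x) ->
  \int[lebesgue_rV n]_x f (x + v)%R = \int[lebesgue_rV n]_x f x.
Proof.
move=> mf f0; rewrite [RHS](ge0_integral_rV_affine v ltr01 mf f0) expr1n mul1e.
by apply: eq_integral => x _; rewrite scale1r.
Qed.

Lemma ge0_integral_R_shift (b : R) (f : R -> \bar R) :
  measurable_fun [set: measurableTypeR R] f -> (forall x, 0 <= f x) ->
  \int[lebesgue_measure]_x f (x + b)%R = \int[lebesgue_measure]_x f x.
Proof.
move=> mf f0; rewrite [RHS](ge0_integral_affine b ltr01 mf f0) mul1e.
by apply: eq_integral => x _; rewrite mul1r.
Qed.

Lemma measurable_tx_shift n (w : measurableTypeR R * 'rV[R]_n) :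
  measurable_fun setT (fun z : measurableTypeR R * 'rV[R]_n =>
     ((z.1 + w.1)%R : measurableTypeR R, (z.2 + w.2)%R)).
Proof.
apply: measurable_fun_pair.
  by apply: measurable_funD => //; exact: measurable_fst.
apply: (measurableT_comp (measurable_rV_shift w.2)); exact: measurable_snd.
Qed.

Lemma ge0_integral_tx_shift n (w : R * 'rV[R]_n) (f : R * 'rV[R]_n -> \bar R) :
  measurable_fun [set: measurableTypeR R * 'rV[R]_n] f -> (forall x, 0 <= f x) ->
  \int[lebesgue_tx R n]_z f (z + w)%R = \int[lebesgue_tx R n]_z f z.
Proof.
move=> mf f0; rewrite fubini_tonelli1//; last first.
  by apply: (measurableT_comp mf); exact: measurable_tx_shift.
rewrite fubini_tonelli1//.
rewrite -[RHS](ge0_integral_R_shift w.1)//; last 2 first.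
- exact: measurable_fun_fubini_tonelli_F.
- by move=> x; exact: integral_ge0.
apply: eq_integral => s _; rewrite /fubini_F/=.
rewrite -[RHS](ge0_integral_rV_shift w.2)//.
exact: measurableT_comp.
Qed.

End rV.

(** * Continuity of translations in L1 *)

Section ereal_cvg.
Context {R : realType}.
Local Open Scope ereal_scope.

Lemma ge0_cvge0P (u : nat -> \bar R) : (forall k, 0 <= u k) ->
  (forall e, (0 < e)%R -> \forall k \near \oo, u k <= e%:E) ->
  u @ \oo --> 0.
Proof.
move=> u0 ue; apply/fine_cvgP; split.
  near=> k; rewrite ge0_fin_numE//.
  by apply: (@le_lt_trans _ _ 1%:E); [near: k; exact: ue|rewrite ltry].
apply/cvgrPdist_le => e e0; near=> k.
have uke : u k <= e%:E by near: k; exact: ue.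
have ukf : u k \is a fin_num by rewrite ge0_fin_numE// (le_lt_trans uke)// ltry.
rewrite sub0r normrN ger0_norm ?fine_ge0//.
by rewrite -lee_fin fineK.
Unshelve. all: by end_near. Qed.

Lemma ge0_cvge0 (u : nat -> \bar R) : u @ \oo --> 0 ->
  forall e, (0 < e)%R -> \forall k \near \oo, u k < e%:E.
Proof.
move=> /fine_cvgP[uf u0] e e0; near=> k.
have ukf : u k \is a fin_num by near: k.
have h : (`|0 - fine (u k)| < e)%R.
  by near: k; move/cvgrPdist_lt : u0; exact.
rewrite -(fineK ukf) lte_fin (le_lt_trans _ h)// sub0r normrN.
exact: ler_norm.
Unshelve. all: by end_near. Qed.

End ereal_cvg.

Section L1norm.
Local Open Scope ereal_scope.
Context d (T : measurableType d) (R : realType) (mu : {measure set T -> \bar R}).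
Implicit Types f g h : T -> R.

Lemma L1_triangle f g h : measurable_fun setT f -> measurable_fun setT g ->
  measurable_fun setT h ->
  \int[mu]_x `|(f x - h x)%:E| <=
  \int[mu]_x `|(f x - g x)%:E| + \int[mu]_x `|(g x - h x)%:E|.
Proof.
move=> mf mg mh.
have mD (u v : T -> R) : measurable_fun setT u -> measurable_fun setT v ->
    measurable_fun setT (fun x : T => `|(u x - v x)%:E| : \bar R).
  move=> mu1 mv1; apply: measurableT_comp => //; apply/measurable_EFinP.
  exact: measurable_funB.
rewrite -ge0_integralD//; [|exact: mD|exact: mD].
apply: ge0_le_integral => //; [exact: mD| |].
  by apply: emeasurable_funD; exact: mD.
by move=> x _; rewrite !abse_EFin -EFinD lee_fin ler_distD.
Qed.

End L1norm.

Section shift_R.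
Context {R : realType}.
Notation mu := (@lebesgue_measure R).
Local Open Scope ereal_scope.

Lemma measurable_R_shift (b : R) :
  measurable_fun [set: measurableTypeR R] ((fun x => x + b)%R : measurableTypeR R -> measurableTypeR R).
Proof. by apply: measurable_funD. Qed.

(** Dominated convergence: the cut-off function is continuous except at the two points N and -N,
    which form a null set. *)
Lemma L1_shift_R_itv (h : R -> R) (N : R) (s : nat -> R) :
  continuous h -> (forall k, `|s k| <= 1)%R -> s @ \oo --> 0%R ->
  let h1 x := if (- N <= x <= N)%R then h x else 0%R in
  \int[mu]_x `|(h1 (x + s k)%R - h1 x)%:E| @[k --> \oo] --> 0.
Proof.
move=> ch s1 s0 h1.
have mh1 : measurable_fun [set: measurableTypeR R] h1.
  rewrite (_ : h1 = (h \_ `[(- N)%R, N]%classic)%R); last first.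
    apply/funext => x; rewrite /h1 patchE.
    by rewrite mem_setE in_itv.
  apply/(measurable_restrictT _ _).1 => //.
  apply: measurable_funS (continuous_measurable_fun ch) => //.
have [M M0 hM] : exists2 M : R, (0 <= M)%R & forall x, (`|h1 x| <= M)%R.
  have cptI : compact `[(- N)%R, N]%classic by exact: segment_compact.
  have : bounded_set (h @` `[(- N)%R, N]%classic)%classic.
    apply: compact_bounded; apply: continuous_compact => //.
    exact: continuous_subspaceT.
  move=> [M [_ hM]]; exists (`|M| + 1)%R; first by rewrite addr_ge0.
  move=> x; rewrite /h1; case: ifPn => xN; last by rewrite normr0 addr_ge0.
  apply: hM; first by rewrite (le_lt_trans (ler_norm _))// ltrDl.
  by exists x => //=; rewrite in_itv.
(* The shifts have size at most 1, so the difference lives on the interval enlarged by 1. *)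
pose G : R -> R := (fun x => (M + M) * \1_(`[(- N - 1)%R, (N + 1)%R]%classic) x)%R.
have h1E x : ~ (`[(- N)%R, N]%classic : set R) x -> h1 x = 0%R.
  by rewrite /= in_itv/= /h1; case: ifP.
have ch1 x : x <> N -> x <> (- N)%R -> {for x, continuous h1}.
  move=> /eqP xN /eqP xNN.
  suff [e|e] : {near x, h =1 h1} \/ {near x, cst 0%R =1 h1}.
  - rewrite /prop_for /continuous_at -(nbhs_singleton e).
    by apply: cvg_trans (ch x); exact: near_eq_cvg.
  - rewrite /prop_for /continuous_at -(nbhs_singleton e).
    by apply: cvg_trans (near_eq_cvg e) _; exact: cvg_cst.
  have [xin|xnin] := boolP (- N < x < N)%R.
    left; move/andP: xin => [x1 x2]; near=> y; rewrite /h1 ifT//.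
    apply/andP; split; apply: ltW; near: y; [exact: lt_nbhsr|exact: lt_nbhsl].
  right; have [xlt|xgt] : (x < - N)%R \/ (N < x)%R.
    move: xnin; rewrite negb_and -!leNgt => /orP[]; rewrite le_eqVlt.
      by rewrite (negbTE xNN); left.
    by rewrite eq_sym (negbTE xN); right.
  - near=> y; rewrite /h1 ifF//; apply/negbTE; rewrite negb_and -!ltNge; apply/orP; left.
    by near: y; exact: lt_nbhsl.
  - near=> y; rewrite /h1 ifF//; apply/negbTE; rewrite negb_and -!ltNge; apply/orP; right.
    by near: y; exact: lt_nbhsr.
have [| | | | |_ _] := @dominated_convergence _ _ _ mu setT measurableT
  (fun k x => `|(h1 (x + s k)%R - h1 x)%:E|) (cst 0) (EFin \o G);
  last by rewrite integral0.
- move=> k; apply: measurableT_comp => //; apply/measurable_EFinP.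
  apply: measurable_funB => //.
  apply: (measurableT_comp mh1); exact: measurable_R_shift.
- exact: measurable_cst.
- exists [set N; (- N)%R]; split.
  + exact: measurableU.
  + by apply: countable_lebesgue_measure0; apply: finite_set_countable; exact: finite_set2.
  move=> x /= xh; apply: contrapT => /not_orP[xN xNN]; apply: xh => _.
  suff : (h1 (x + s k) - h1 x)%R @[k --> \oo] --> 0%R.
    move=> /cvg_norm; rewrite normr0 => h0; apply/fine_cvgP; split; first exact: nearW.
    exact: h0.
  rewrite -(subrr (h1 x)); apply: cvgB; last exact: cvg_cst.
  apply: (continuous_cvg _ (ch1 _ xN xNN)).
  rewrite -[X in _ --> X](addr0 x).
  by apply: cvgD => //; exact: cvg_cst.
- rewrite (_ : EFin \o G = fun x => (M + M)%:E * (EFin \o \1_(`[(- N - 1)%R, (N + 1)%R]%classic)) x); last first.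
    by apply/funext => x; rewrite /G/= EFinM.
  apply: integrableZl => //.
  apply: integrable_indic_itv.
- apply: nearW => x k _; rewrite abse_id abse_EFin lee_fin /G indicE.
  have [xN|xN] := boolP (x \in _).
    rewrite mulr1 (le_trans (ler_normB _ _))// lerD//.
  rewrite mulr0 !h1E ?subrr ?normr0//.
  + move=> xi; move/negP : xN; apply; rewrite inE/= in_itv/=.
    by move: xi; rewrite /= in_itv/= => /andP[? ?]; apply/andP; split; lra.
  + move=> xi; move/negP : xN; apply; rewrite inE/= in_itv/=.
    move: xi (s1 k); rewrite /= in_itv/= ler_norml => /andP[? ?] /andP[? ?].
    by apply/andP; split; lra.
Unshelve. all: by end_near. Qed.

(** Density argument: cutting [g] off to a bounded interval and approximating it there by a
    continuous function cost e/6 each. The resulting error e/3 counts twice, once translated, and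
    the previous lemma gives the last e/3. *)
Lemma L1_shift_R (g : R -> R) (s : nat -> R) :
  mu.-integrable setT (EFin \o g) ->
  (forall k, `|s k| <= 1)%R -> s @ \oo --> 0%R ->
  \int[mu]_x `|(g (x + s k)%R - g x)%:E| @[k --> \oo] --> 0.
Proof.
move=> ig s1 s0.
have mg : measurable_fun [set: measurableTypeR R] g.
  by apply/measurable_EFinP; exact: measurable_int ig.
apply: ge0_cvge0P => [k|e e0]; first exact: integral_ge0.
have e4 : (0 < e / 6)%R by rewrite divr_gt0.
pose gN N : R -> R := (g \_ `[(- N%:R)%R, N%:R]%classic)%R.
have mgN N : measurable_fun [set: measurableTypeR R] (gN N).
  apply/(measurable_restrictT _ _).1 => //.
  exact: measurable_funS mg.
have [| | | | |_ _] := @dominated_convergence _ _ _ mu setT measurableT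
  (fun N x => `|(g x - gN N x)%:E|) (cst 0) (EFin \o (fun x => `|g x|%R)).
- move=> k; apply: measurableT_comp => //; apply/measurable_EFinP.
  exact: measurable_funB.
- exact: measurable_cst.
- apply: nearW => x _; apply/fine_cvgP; split; first exact: nearW.
  apply: (@cvg_near_cst _ R); near=> N.
  rewrite /= /gN patchE mem_set ?subrr ?normr0//=.
  rewrite in_itv/= -ler_norml; near: N.
  exact: nbhs_infty_ger.
- exact: integrable_norm.
- apply: nearW => x k _; rewrite abse_id abse_EFin lee_fin /gN patchE.
  by case: ifP => _; rewrite ?subrr ?subr0 ?normr0.
rewrite integral0 => /ge0_cvge0 /(_ _ e4)[N _ /(_ N (leqnn N))/= gNe].
pose I := `[(- N%:R)%R, N%:R : R]%classic.
have mI : measurable (I : set (measurableTypeR R)) by exact: measurable_itv.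
have fI : mu I < +oo by rewrite lebesgue_measure_itv/=; case: ifP; rewrite ltry.
have iI : mu.-integrable I (EFin \o g) by exact: integrableS ig.
have [h_ [ch ih h0]] := approximation_continuous_integrable mI fI iI.
have [n _ /(_ n (leqnn n))/= hne] := ge0_cvge0 h0 e4.
pose h1 (x : R) : R := if (- N%:R <= x <= N%:R)%R then h_ n x else 0%R.
have h1E : h1 = (h_ n \_ I)%R.
  by apply/funext => x; rewrite /h1 patchE mem_setE in_itv.
have mh1 : measurable_fun [set: measurableTypeR R] h1.
  rewrite h1E; apply/(measurable_restrictT _ _).1 => //.
  by apply: measurable_funS (continuous_measurable_fun (ch n)).
have gh1 : \int[mu]_x `|(g x - h1 x)%:E| <= (e / 3)%:E.
  apply: le_trans (L1_triangle _ mg (mgN N) mh1) _.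
  rewrite (_ : e / 3 = e / 6 + e / 6)%R; last by lra.
  rewrite EFinD; apply: leeD; first exact: ltW.
  apply: le_trans (ltW hne); rewrite [leRHS]integral_mkcond.
  rewrite le_eqVlt; apply/orP; left; apply/eqP; apply: eq_integral => x _.
  rewrite h1E /gN !patchE -/I; case: ifP => _ //.
  by rewrite subrr; exact: abse0.
near=> k.
have mk (f : R -> R) : measurable_fun [set: measurableTypeR R] f ->
    measurable_fun [set: measurableTypeR R] (fun x => f (x + s k)%R).
  by move=> mf; apply: (measurableT_comp mf); exact: measurable_R_shift.
apply: le_trans (L1_triangle _ (mk _ mg) (mk _ mh1) mg) _.
rewrite (_ : e = e / 3 + (e / 3 + e / 3))%R; last by lra.
rewrite !EFinD; apply: leeD.
  pose F x := `|(g x - h1 x)%:E|.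
  rewrite (_ : (fun x => _) = (fun x => F (x + s k)%R))// ge0_integral_R_shift//.
    by apply: measurableT_comp => //; apply/measurable_EFinP; exact: measurable_funB.
  by move=> x; exact: abse_ge0.
apply: le_trans (L1_triangle _ (mk _ mh1) mh1 mg) _.
apply: leeD; last by under eq_integral do rewrite !abse_EFin distrC.
apply: ltW; near: k; apply: ge0_cvge0; last by rewrite divr_gt0.
exact: L1_shift_R_itv.
Unshelve. all: by end_near. Qed.

End shift_R.

Section shift_tx.
Context {R : realType}.
Local Open Scope ereal_scope.

Lemma norm_tx_fst n (w : R * 'rV[R]_n) : (`|w.1| <= `|w|)%R.
Proof. by rewrite prod_normE le_max lexx. Qed.

Lemma norm_tx_snd n (w : R * 'rV[R]_n) : (`|w.2| <= `|w|)%R.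
Proof. by rewrite prod_normE le_max lexx orbT. Qed.

Lemma norm_rV_coord n (w : 'rV[R]_n) i : (`|w ord0 i| <= `|w|)%R.
Proof.
rewrite [leRHS](mx_normrE w) -[leLHS]/((fun ij : 'I_1 * 'I_n => `|w ij.1 ij.2|%R) (ord0, i)).
exact: le_bigmax.
Qed.

Lemma norm_rV_le n (w : 'rV[R]_n) (e : R) : (0 <= e)%R ->
  (forall i, `|w ord0 i| <= e)%R -> (`|w| <= e)%R.
Proof.
move=> e0 we; rewrite [leLHS](mx_normrE w); apply: bigmax_le => //.
by move=> [j i] _ /=; rewrite (ord1 j).
Qed.

Lemma norm_rV_uncons n (w : 'rV[R]_n.+1) : (`|rV_uncons w| <= `|w|)%R.
Proof.
rewrite prod_normE ge_max norm_rV_coord/=.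
by apply: norm_rV_le => // i; rewrite mxE norm_rV_coord.
Qed.

Lemma tonelli_tx1 n (f : R * 'rV[R]_n -> \bar R) :
  measurable_fun [set: measurableTypeR R * 'rV[R]_n] f -> (forall z, 0 <= f z) ->
  \int[lebesgue_tx R n]_z f z =
  \int[lebesgue_measure]_s \int[lebesgue_rV n]_x f (s, x).
Proof. exact: fubini_tonelli1. Qed.

Lemma tonelli_tx2 n (f : R * 'rV[R]_n -> \bar R) :
  measurable_fun [set: measurableTypeR R * 'rV[R]_n] f -> (forall z, 0 <= f z) ->
  \int[lebesgue_tx R n]_z f z =
  \int[lebesgue_rV n]_x \int[lebesgue_measure]_s f (s, x).
Proof. exact: fubini_tonelli2. Qed.

Let shift_t n (s : R) (z : R * 'rV[R]_n) : (z + (s, 0) = (z.1 + s, z.2))%R.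
Proof. by case: z => a b; congr pair; rewrite /= addr0. Qed.

Let shift_x n (x : 'rV[R]_n) (z : R * 'rV[R]_n) : (z + (0, x) = (z.1, z.2 + x))%R.
Proof. by case: z => a b; congr pair; rewrite /= addr0. Qed.

(** Provides the majorant, independent of the shift, for dominated convergence in the remaining
    variables. *)
Lemma L1_shift_le_R (f : R -> R) (b : R) :
  measurable_fun [set: measurableTypeR R] f ->
  \int[lebesgue_measure]_x `|(f (x + b)%R - f x)%:E| <=
  2%:E * \int[lebesgue_measure]_x `|(f x)%:E|.
Proof.
move=> mf; apply: le_trans (@L1_triangle _ _ _ _ _ (cst 0%R) _ _ _ _) _ => //.
  by apply: (measurableT_comp mf); exact: measurable_R_shift.
under eq_integral do rewrite subr0.
rewrite (ge0_integral_R_shift b (f := fun x => `|(f x)%:E|))//; last first.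
  by apply: measurableT_comp => //; exact/measurable_EFinP.
under [X in _ + X]eq_integral do rewrite sub0r abse_EFin normrN -abse_EFin.
by rewrite (_ : 2%R = 1 + 1)%R// EFinD ge0_muleDl// !mul1e.
Qed.

Lemma L1_shift_le_rV n (f : 'rV[R]_n -> R) b :
  measurable_fun setT f ->
  \int[lebesgue_rV n]_x `|(f (x + b)%R - f x)%:E| <=
  2%:E * \int[lebesgue_rV n]_x `|(f x)%:E|.
Proof.
move=> mf; apply: le_trans (@L1_triangle _ _ _ _ _ (cst 0%R) _ _ _ _) _ => //.
  apply: (measurableT_comp mf);
    exact: measurable_rV_shift.
under eq_integral do rewrite subr0.
rewrite (ge0_integral_rV_shift b (f := fun x => `|(f x)%:E|))//; last first.
  by apply: measurableT_comp => //; exact/measurable_EFinP.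
under [X in _ + X]eq_integral do rewrite sub0r abse_EFin normrN -abse_EFin.
by rewrite (_ : 2%R = 1 + 1)%R// EFinD ge0_muleDl// !mul1e.
Qed.

(** The shift is split into a time shift and a space shift; each is treated on sections, with
    dominated convergence in the other variable. The spatial case is a hypothesis because this lemma
    also serves as the induction step from [n] to [n.+1] in the next one. *)
Lemma L1_shift_tx n :
  (forall (g : 'rV[R]_n -> R) (w : nat -> 'rV[R]_n),
     (lebesgue_rV n).-integrable setT (EFin \o g) ->
     (forall k, `|w k| <= 1)%R -> `|w k|%R @[k --> \oo] --> 0%R ->
     \int[lebesgue_rV n]_x `|(g (x + w k)%R - g x)%:E| @[k --> \oo] --> 0) ->
  forall (g : R * 'rV[R]_n -> R) (w : nat -> R * 'rV[R]_n),
     (lebesgue_tx R n).-integrable setT (EFin \o g) ->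
     (forall k, `|w k| <= 1)%R -> `|w k|%R @[k --> \oo] --> 0%R ->
     \int[lebesgue_tx R n]_x `|(g (x + w k)%R - g x)%:E| @[k --> \oo] --> 0.
Proof.
move=> IH g w ig w1 w0.
have mg : measurable_fun [set: measurableTypeR R * 'rV[R]_n] g.
  by apply/measurable_EFinP; exact: measurable_int ig.
have w20 : `|(w k).2|%R @[k --> \oo] --> 0%R.
  apply: squeeze_cvgr (cvg_cst 0%R) w0.
  by apply: nearW => k; rewrite normr_ge0 norm_tx_snd.
have w10 : (w k).1 @[k --> \oo] --> 0%R.
  apply/norm_cvg0P; apply: squeeze_cvgr (cvg_cst 0%R) w0.
  by apply: nearW => k; rewrite normr_ge0 norm_tx_fst.
have mgw (v : R * 'rV[R]_n) : measurable_fun [set: measurableTypeR R * 'rV[R]_n] (fun z => g (z + v)%R).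
  by apply: (measurableT_comp mg); exact: measurable_tx_shift.
have mgg (v : R * 'rV[R]_n) : measurable_fun [set: measurableTypeR R * 'rV[R]_n]
    (fun z => `|(g (z + v)%R - g z)%:E|).
  apply: measurableT_comp => //; apply/measurable_EFinP.
  exact: measurable_funB.
have mag : measurable_fun [set: measurableTypeR R * 'rV[R]_n] (fun z => `|(g z)%:E|).
  by apply: measurableT_comp => //; exact/measurable_EFinP.
have fag : \int[lebesgue_tx R n]_z `|(g z)%:E| < +oo by case/integrableP : ig.
have A : \int[lebesgue_tx R n]_z `|(g (z + ((w k).1, 0))%R - g z)%:E| @[k --> \oo] --> 0.
  have E k : \int[lebesgue_tx R n]_z `|(g (z + ((w k).1, 0))%R - g z)%:E| =
    \int[lebesgue_rV n]_x \int[lebesgue_measure]_s `|(g (s + (w k).1, x)%R - g (s, x))%:E|.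
    rewrite (tonelli_tx2 (mgg _) (fun=> abse_ge0 _)); apply: eq_integral => x _.
    by apply: eq_integral => s _; rewrite shift_t.
  under eq_fun do rewrite E.
  have [| | | | |_ _] := @dominated_convergence _ _ _ (lebesgue_rV n) setT measurableT
    (fun k x => \int[lebesgue_measure]_s `|(g (s + (w k).1, x)%R - g (s, x))%:E|)
    (cst 0) (fun x => 2%:E * \int[lebesgue_measure]_s `|(g (s, x))%:E|);
    last by rewrite integral0.
  - move=> k; apply: (measurable_fun_fubini_tonelli_G
      (fun z : measurableTypeR R * 'rV[R]_n => `|(g (z.1 + (w k).1, z.2)%R - g z)%:E|)) => //.
    by have := mgg ((w k).1, 0)%R; under eq_fun do rewrite shift_t.
  - exact: measurable_cst.
  - have := ae_integrable2 ig; apply: filterS => x ix _.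
    apply: (L1_shift_R ix) => // k.
    by rewrite (le_trans _ (w1 k))// norm_tx_fst.
  - apply: integrableZl => //.
    apply/integrableP; split; first exact: (measurable_fun_fubini_tonelli_G _ mag).
    under eq_integral do rewrite gee0_abs ?integral_ge0//.
    by rewrite -(tonelli_tx2 mag (fun=> abse_ge0 _)).
  - apply: nearW => x k _; rewrite gee0_abs ?integral_ge0//.
    by apply: L1_shift_le_R; apply: (measurableT_comp mg).
have B : \int[lebesgue_tx R n]_z `|(g (z + (0%R, (w k).2))%R - g z)%:E| @[k --> \oo] --> 0.
  have E k : \int[lebesgue_tx R n]_z `|(g (z + (0%R, (w k).2))%R - g z)%:E| =
    \int[lebesgue_measure]_s \int[lebesgue_rV n]_x `|(g (s, x + (w k).2)%R - g (s, x))%:E|.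
    rewrite (tonelli_tx1 (mgg _) (fun=> abse_ge0 _)); apply: eq_integral => s _.
    by apply: eq_integral => x _; rewrite shift_x.
  under eq_fun do rewrite E.
  have [| | | | |_ _] := @dominated_convergence _ _ _ (@lebesgue_measure R) setT measurableT
    (fun k s => \int[lebesgue_rV n]_x `|(g (s, x + (w k).2)%R - g (s, x))%:E|)
    (cst 0) (fun s => 2%:E * \int[lebesgue_rV n]_x `|(g (s, x))%:E|);
    last by rewrite integral0.
  - move=> k; apply: (measurable_fun_fubini_tonelli_F
      (fun z : measurableTypeR R * 'rV[R]_n => `|(g (z.1, z.2 + (w k).2)%R - g z)%:E|)) => //.
    by have := mgg (0, (w k).2)%R; under eq_fun do rewrite shift_x.
  - exact: measurable_cst.
  - have := ae_integrable1 ig; apply: filterS => s ix _.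
    apply: (IH _ _ ix) => // k.
    by rewrite (le_trans _ (w1 k))// norm_tx_snd.
  - apply: integrableZl => //.
    apply/integrableP; split; first exact: (measurable_fun_fubini_tonelli_F _ mag).
    under eq_integral do rewrite gee0_abs ?integral_ge0//.
    by rewrite -(tonelli_tx1 mag (fun=> abse_ge0 _)).
  - apply: nearW => x k _; rewrite gee0_abs ?integral_ge0//.
    by apply: L1_shift_le_rV; apply: (measurableT_comp mg).
apply: (@squeeze_cvge _ _ _ _ (cst 0) _
  (fun k => \int[lebesgue_tx R n]_z `|(g (z + ((w k).1, 0))%R - g z)%:E| +
    \int[lebesgue_tx R n]_z `|(g (z + (0%R, (w k).2))%R - g z)%:E|)).
- apply: nearW => k; rewrite integral_ge0//=.
  apply: le_trans (L1_triangle _ (mgw (w k)) (mgw (0%R, (w k).2)) mg) _.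
  apply: leeD => //.
  pose F z := `|(g (z + ((w k).1, 0))%R - g z)%:E|.
  rewrite (_ : (fun x => _) = (fun x => F (x + (0%R, (w k).2))%R)); last first.
    apply/funext => z; rewrite /F -addrA (_ : (_, _) + (_, _) = w k)%R//.
    by case: (w k) => ? ?; congr pair; rewrite /= ?addr0 ?add0r.
  by rewrite (ge0_integral_tx_shift _ (mgg _) (fun=> abse_ge0 _)).
- exact: cvg_cst.
- by rewrite -(adde0 0); apply: cvgeD.
Qed.

(** Induction on the dimension: a row of length [n.+1] is a pair of a number and a row of length
    [n], which is the setting of [L1_shift_tx]. *)
Lemma L1_shift_rV n (g : 'rV[R]_n -> R) (w : nat -> 'rV[R]_n) :
  (lebesgue_rV n).-integrable setT (EFin \o g) ->
  (forall k, `|w k| <= 1)%R -> `|w k|%R @[k --> \oo] --> 0%R ->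
  \int[lebesgue_rV n]_x `|(g (x + w k)%R - g x)%:E| @[k --> \oo] --> 0.
Proof.
elim: n g w => [|n IH] g w ig w1 w0.
  rewrite (_ : (fun k => _) = cst 0); first exact: cvg_cst.
  apply/funext => k; apply: integral0_eq => x _.
  by rewrite (_ : x + w k = x)%R ?subrr ?abse0// [LHS]thinmx0 [RHS]thinmx0.
have mg : measurable_fun setT g by apply/measurable_EFinP; exact: measurable_int ig.
pose G (z : R * 'rV[R]_n) := g (rV_cons z).
have mG : measurable_fun [set: measurableTypeR R * 'rV[R]_n] G.
  by apply: (measurableT_comp mg); exact: measurable_rV_cons.
have E (f : 'rV[R]_n.+1 -> \bar R) : measurable_fun setT f -> (forall x, 0 <= f x) ->
    \int[lebesgue_rV n.+1]_x f x = \int[lebesgue_tx R n]_z f (rV_cons z).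
  move=> mf f0; rewrite ge0_integral_rVS// tonelli_tx1//.
  by apply: (measurableT_comp mf); exact: measurable_rV_cons.
have iG : (lebesgue_tx R n).-integrable setT (EFin \o G).
  apply/integrableP; split; first exact/measurable_EFinP.
  rewrite -(E (fun x => `|(g x)%:E|))//; first by case/integrableP : ig.
  by apply: measurableT_comp => //; exact/measurable_EFinP.
have := @L1_shift_tx n IH G (fun k => rV_uncons (w k)) iG.
rewrite (_ : (fun k => \int[lebesgue_rV n.+1]_x _) =
   (fun k => \int[lebesgue_tx R n]_z `|(G (z + rV_uncons (w k))%R - G z)%:E|)).
  apply.
    by move=> k; rewrite (le_trans (norm_rV_uncons _)).
  apply: squeeze_cvgr (cvg_cst 0%R) w0.
  by apply: nearW => k; rewrite normr_ge0 norm_rV_uncons.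
apply/funext => k; rewrite E//; last first.
  apply: measurableT_comp => //; apply/measurable_EFinP; apply: measurable_funB => //.
  apply: (measurableT_comp mg);
    exact: measurable_rV_shift.
apply: eq_integral => z _; congr (`| (g _ - _)%:E |).
apply/rowP => i; rewrite !mxE; case: unliftP => [j ->|->]//=.
by rewrite !mxE.
Qed.

Lemma L1_shift n (g : R * 'rV[R]_n -> R) (w : nat -> R * 'rV[R]_n) :
  (lebesgue_tx R n).-integrable setT (EFin \o g) ->
  (forall k, `|w k| <= 1)%R -> `|w k|%R @[k --> \oo] --> 0%R ->
  \int[lebesgue_tx R n]_x `|(g (x + w k)%R - g x)%:E| @[k --> \oo] --> 0.
Proof. by apply: L1_shift_tx => *; exact: L1_shift_rV. Qed.

(** Uniformity over small shifts, by contradiction: shifts of size at most 1/(k+1) violating the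
    bound would form a sequence excluded by [L1_shift]. *)
Lemma L1_shift_eps n (g : R * 'rV[R]_n -> R) :
  (lebesgue_tx R n).-integrable setT (EFin \o g) ->
  forall e, (0 < e)%R -> exists2 r, (0 < r)%R & forall w, (`|w| <= r)%R ->
  \int[lebesgue_tx R n]_x `|(g (x + w)%R - g x)%:E| <= e%:E.
Proof.
move=> ig e e0; apply: contrapT => h.
have /choice[w hw] (k : nat) : exists w : R * 'rV[R]_n, (`|w| <= k.+1%:R^-1)%R /\
    e%:E < \int[lebesgue_tx R n]_x `|(g (x + w)%R - g x)%:E|.
  apply: contrapT => hk; apply: h; exists k.+1%:R^-1%R => // w wk.
  by rewrite leNgt; apply/negP => ?; apply: hk; exists w.
have w1 k : (`|w k| <= 1)%R.
  by rewrite (le_trans (hw k).1)// invf_le1// ler1n.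
have w0 : `|w k|%R @[k --> \oo] --> 0%R.
  apply: squeeze_cvgr (cvg_cst 0%R) (@cvg_harmonic R).
  by apply: nearW => k; rewrite normr_ge0 (hw k).1.
have [k _ /(_ k (leqnn k))/=] := ge0_cvge0 (L1_shift ig w1 w0) e0.
by move/lt_trans => /(_ _ (hw k).2); rewrite ltxx.
Qed.

End shift_tx.

(** * Borel and compact subsets *)

Section borel.
Context {R : realType}.

(** The sigma-algebra is generated by coordinates, so openness is reached through the countably many
    boxes with rational centre and radius 1/(k+1) contained in [U]. *)
Lemma open_measurable_rV n (U : set 'rV[R]_n) : open U -> measurable U.
Proof.
move=> oU.
pose box (qk : 'rV[rat]_n * nat) : set 'rV[R]_n :=
  [set x | forall i, `|x ord0 i - ratr (qk.1 ord0 i)| < qk.2.+1%:R^-1].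
have mbox qk : measurable (box qk).
  rewrite (_ : box qk = \bigcap_(i in [set: 'I_n]) ((fun x : 'rV[R]_n => x ord0 i) @^-1`
     [set s | `|s - ratr (qk.1 ord0 i)| < qk.2.+1%:R^-1])); last first.
    by apply/seteqP; split=> x /= h i; [move=> _|]; exact: h.
  apply: fin_bigcap_measurable => [|i _]; first exact: finite_finset.
  rewrite -[X in measurable X]setTI.
  apply: measurable_coord => //.
  rewrite (_ : [set _ | _] = `]ratr (qk.1 ord0 i) - qk.2.+1%:R^-1,
    ratr (qk.1 ord0 i) + qk.2.+1%:R^-1[%classic); first exact: measurable_itv.
  by apply/seteqP; split=> s /=; rewrite in_itv/= ltr_distl.
have -> : U = \bigcup_(qk in [set: 'rV[rat]_n * nat])
    (if pselect (box qk `<=` U) then box qk else set0).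
  apply/seteqP; split => x; last first.
    by move=> [qk _]; case: pselect => // qkU; exact: qkU.
  move=> Ux.
  have /nbhs_ballP[e /= e0 eU] : nbhs x U by exact: open_nbhs_nbhs.
  (* Half of [e], because a point of the box is compared with [x] through the rational centre. *)
  have [k /= ke] : exists k, (k.+1%:R^-1 : R) < e / 2.
    have e2 : 0 < e / 2 by rewrite divr_gt0.
    near \oo => k; exists k; near: k.
    exact: (near_infty_natSinv_lt (PosNum e2)).
  have /choice[q qx] (i : 'I_n) : exists q : rat, `|x ord0 i - ratr q| < k.+1%:R^-1.
    have /rat_in_itvoo[q] : x ord0 i - k.+1%:R^-1 < x ord0 i + k.+1%:R^-1.
      by rewrite ltrD2l (@lt_trans _ _ 0) ?oppr_lt0// invr_gt0.
    by move=> qi; exists q; rewrite ltr_distlC; move: qi; rewrite in_itv/=.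
  exists (\row_i q i, k) => //; case: pselect => [_ i|].
    by rewrite mxE.
  case=> y yb; apply: eU.
  rewrite -ball_normE/=; apply: le_lt_trans (_ : 2 * k.+1%:R^-1 < e); last first.
    by rewrite mulrC -ltr_pdivlMr.
  apply: norm_rV_le => [|i]; first by rewrite mulr_ge0.
  rewrite !mxE; have := yb i; rewrite /= mxE; have := qx i.
  rewrite distrC; move=> h1 h2; rewrite distrC; apply: le_trans (ler_distD (ratr (q i)) _ _) _.
  by rewrite mulr_natl mulr2n lerD// ltW.
apply: countable_bigcupT_measurable; first exact: countableP.
by move=> qk; case: pselect => ? /=; [exact: mbox|exact: measurable0].
Unshelve. all: by end_near. Qed.

Lemma continuous_measurable_rV n (f : 'rV[R]_n -> R) :
  continuous f -> measurable_fun setT f.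
Proof.
move=> /continuousP cf; apply: (measurability _ (RGenOpens.measurableE R)).
move=> _ [_ [a [b ->] <-]]; rewrite setTI; apply: open_measurable_rV.
exact/cf/interval_open.
Qed.

Lemma continuous_rV_uncons n : continuous (@rV_uncons R n : 'rV[R]_n.+1 -> R * 'rV[R]_n).
Proof.
move=> x A /nbhs_ballP[e e0 eA]; apply/nbhs_ballP; exists e => // y.
move=> xy; apply: eA; move: xy; rewrite -!ball_normE/=; apply: le_lt_trans.
rewrite (_ : rV_uncons x - rV_uncons y = rV_uncons (x - y)) ?norm_rV_uncons//.
by congr pair; rewrite ?mxE//; apply/rowP => i; rewrite !mxE.
Qed.

(** Transported from rows of length [n.+1], since [rV_uncons] is continuous and [rV_cons] is
    measurable. *)
Lemma open_measurable_tx n (U : set (R * 'rV[R]_n)) : open U ->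
  measurable (U : set (measurableTypeR R * 'rV[R]_n)).
Proof.
move=> oU.
have -> : U = @rV_cons R n @^-1` ((@rV_uncons R n : 'rV[R]_n.+1 -> R * 'rV[R]_n) @^-1` U).
  by rewrite -comp_preimage; apply/seteqP; split=> z /=; rewrite rV_consK.
rewrite -[X in measurable X]setTI; apply: measurable_rV_cons => //.
apply: open_measurable_rV.
by move/continuousP : (@continuous_rV_uncons n); exact.
Qed.

Lemma closed_measurable_tx n (U : set (R * 'rV[R]_n)) : closed U ->
  measurable (U : set (measurableTypeR R * 'rV[R]_n)).
Proof.
move=> /closed_openC/open_measurable_tx/measurableC; by rewrite setCK.
Qed.

Lemma compact_measurable_tx n (U : set (R * 'rV[R]_n)) : compact U ->
  measurable (U : set (measurableTypeR R * 'rV[R]_n)).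
Proof.
move=> cU; apply: closed_measurable_tx; apply: compact_closed => //.
Qed.

Lemma continuous_measurable_tx n (f : R * 'rV[R]_n -> R) :
  continuous f -> measurable_fun [set: measurableTypeR R * 'rV[R]_n] f.
Proof.
move=> /continuousP cf; apply: (measurability _ (RGenOpens.measurableE R)).
move=> _ [_ [a [b ->] <-]]; rewrite setTI; apply: open_measurable_tx.
exact/cf/interval_open.
Qed.

Lemma lebesgue_rV_ball_fin n (M : R) : 0 <= M ->
  (lebesgue_rV n [set x | (`|x| <= M)%R] < +oo)%E.
Proof.
move=> M0.
have -> : [set x : 'rV[R]_n | `|x| <= M] = [set x | forall i, x ord0 i \in `[(const_mx (- M) : 'rV[R]_n) ord0 i,
   (const_mx M : 'rV[R]_n) ord0 i]]; last first.
  by rewrite lebesgue_rV_box ?ltry// => i; rewrite !mxE; lra.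
apply/seteqP; split=> x /= h.
  by move=> i; rewrite !mxE in_itv/= -ler_norml (le_trans (norm_rV_coord _ _)).
by apply: norm_rV_le => // i; have := h i; rewrite !mxE in_itv/= -ler_norml.
Qed.

Lemma closed_norm_le (V : normedModType R) (a : R) : closed [set x : V | `|x| <= a].
Proof.
rewrite (_ : [set _ | _] = Num.norm @^-1` [set s | s <= a])//.
by apply: closed_comp (@closed_le R a) => x _; exact: norm_continuous.
Qed.

Lemma compact_rV_ball n (M : R) : compact [set x : 'rV[R]_n | `|x| <= M].
Proof.
apply: bounded_closed_compact; last exact: closed_norm_le.
by exists M; split; [exact: num_real|move=> b Mb x /= /le_trans; apply; exact: ltW].
Qed.

Lemma closed_tx_box n (a b : R) : closed [set z : R * 'rV[R]_n | `|z.1| <= a /\ `|z.2| <= b].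
Proof.
rewrite (_ : [set _ | _] = fst @^-1` [set s : R | `|s| <= a] `&`
   (snd : R * 'rV[R]_n -> _) @^-1` [set s | `|s| <= b])//.
apply: closedI.
  by apply: closed_comp (@closed_norm_le _ a) => x _; exact: cvg_fst.
by apply: closed_comp (@closed_norm_le _ b) => x _; exact: cvg_snd.
Qed.

Lemma compact_tx_box n (a b : R) : compact [set z : R * 'rV[R]_n | `|z.1| <= a /\ `|z.2| <= b].
Proof.
rewrite (_ : [set _ | _] = `[-a, a]%classic `*` [set x : 'rV[R]_n | `|x| <= b]).
  by apply: compact_setX; [exact: segment_compact|exact: compact_rV_ball].
by apply/seteqP; split=> -[s x] /= []; rewrite in_itv/= ler_norml.
Qed.

Lemma lebesgue_tx_box_fin n (a b : R) : 0 <= b ->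
  (lebesgue_tx R n [set z | (`|z.1| <= a)%R /\ (`|z.2| <= b)%R] < +oo)%E.
Proof.
move=> b0.
rewrite [X in (_ \x _)%E X](_ : _ = `[-a, a]%classic `*` [set x : 'rV[R]_n | (`|x| <= b)%R]); last first.
  by apply/seteqP; split=> -[s x] /= []; rewrite in_itv/= ler_norml.
rewrite product_measure1E//.
- rewrite lte_mul_pinfty//; last exact: lebesgue_rV_ball_fin.
  rewrite [X in X \is a _](_ : _ = lebesgue_measure `[- a, a]%classic)//.
  by rewrite lebesgue_measure_itv/=; case: ifP.
- rewrite -[X in measurable X]setCK; apply: measurableC; apply: open_measurable_rV.
  exact/closed_openC/closed_norm_le.
Qed.

Lemma compact_fin_tx n (K : set (R * 'rV[R]_n)) : compact K ->
  (lebesgue_tx R n K < +oo)%E.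
Proof.
move=> cK; have [M [_ hM]] := compact_bounded cK.
have M1 : M < `|M| + 1 by rewrite (le_lt_trans (ler_norm _))// ltrDl.
apply: le_lt_trans (lebesgue_tx_box_fin n (`|M| + 1) (b := `|M| + 1) _).
  apply: le_measure; rewrite ?inE.
  - exact: compact_measurable_tx.
  - by apply: closed_measurable_tx; exact: closed_tx_box.
  - move=> z Kz /=; have zM := hM _ M1 _ Kz.
    by rewrite !(le_trans _ zM) ?norm_tx_fst ?norm_tx_snd.
by rewrite addr_ge0.
Qed.

End borel.

(** * Smooth functions and integrable functions *)

Section smooth_closure.
Context {R : realType} {V : normedModType R}.
Implicit Types f g : V -> R.

Lemma CnS n f : Cn n.+1 f -> Cn n f.
Proof.
elim: n f => [|n IH] f [cf hf]; first by split.
by split=> // v; have [df cdf] := hf v; split=> //; exact: IH.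
Qed.

Lemma CnD n f g : Cn n f -> Cn n g -> Cn n (f \+ g).
Proof.
elim: n f g => [|n IH] f g [cf hf] [cg hg].
  by split=> // x; apply: cvgD; [exact: cf|exact: cg].
split=> [x|v]; first by apply: cvgD; [exact: cf|exact: cg].
have [df cdf] := hf v; have [dg cdg] := hg v.
split=> [x|]; first exact: derivableD.
rewrite (_ : 'D_v _ = 'D_v f \+ 'D_v g); first exact: IH.
by apply/funext => x; rewrite deriveD.
Qed.

Lemma CnM n f g : Cn n f -> Cn n g -> Cn n (f \* g).
Proof.
elim: n f g => [|n IH] f g [cf hf] [cg hg].
  by split=> // x; apply: cvgM; [exact: cf|exact: cg].
split=> [x|v]; first by apply: cvgM; [exact: cf|exact: cg].
have [df cdf] := hf v; have [dg cdg] := hg v.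
split=> [x|]; first exact: derivableM.
rewrite (_ : 'D_v _ = (f \* 'D_v g) \+ (g \* 'D_v f)).
  by apply: CnD; apply: IH => //; exact: CnS.
by apply/funext => x; rewrite deriveM.
Qed.

Lemma Cn_cst n (a : R) : Cn n (cst a : V -> R).
Proof.
elim: n a => [|n IH] a; split=> //; try exact: cst_continuous.
move=> v; split=> [x|]; first exact: derivable_cst.
by rewrite (_ : 'D_v _ = cst 0)//; apply/funext => x; rewrite derive_cst.
Qed.

Lemma smoothM f g : smooth f -> smooth g -> smooth (f \* g).
Proof. by move=> sf sg n; exact: CnM. Qed.

Lemma smooth_cst (a : R) : smooth (cst a : V -> R).
Proof. by move=> n; exact: Cn_cst. Qed.

Lemma smooth_continuous f : smooth f -> continuous f.
Proof. by move=> /(_ 0%N)[]. Qed.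

Lemma smooth_derivable f x v : smooth f -> derivable f x v.
Proof. by move=> /(_ 1%N)[_ /(_ v)[]]. Qed.

Lemma smooth_derive f v : smooth f -> smooth ('D_v f).
Proof. by move=> sf n; have [_ /(_ v)[]] := sf n.+1. Qed.

Lemma derive_eq0_open (f : V -> R) (A : set V) x v : open A -> A x ->
  (forall y, A y -> f y = 0) -> 'D_v f x = 0.
Proof.
move=> oA Ax f0; rewrite -(derive_cst (0 : R) x v).
apply: near_eq_derive; near=> y; rewrite f0//; near: y.
exact: open_nbhs_nbhs.
Unshelve. all: by end_near. Qed.

End smooth_closure.

Section affine.
Context {R : realType} {V W : normedModType R} (L : V -> W) (L0 : V -> W).
Hypothesis L0L : forall x v (h : R), L (h *: v + x) = h *: L0 v + L x.

Let quot (f : W -> R) x v : (fun h : R => h^-1 *: (((f \o L) \o shift x) (h *: v) - (f \o L) x)) =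
  (fun h => h^-1 *: ((f \o shift (L x)) (h *: L0 v) - f (L x))).
Proof. by apply/funext => h; rewrite /= L0L. Qed.

(** [L0] is the linear part of [L]. The two difference quotients are the same function of [h], so
    the equality holds without any differentiability of [f]. *)
Lemma derive_affine (f : W -> R) x v : 'D_v (f \o L) x = 'D_(L0 v) f (L x).
Proof. by rewrite /derive quot. Qed.

Lemma derivable_affineE (f : W -> R) x v :
  derivable (f \o L) x v = derivable f (L x) (L0 v).
Proof. by rewrite /derivable quot. Qed.

Hypothesis cL : continuous L.

Lemma Cn_affine n (f : W -> R) : Cn n f -> Cn n (f \o L).
Proof.
elim: n f => [|n IH] f [cf hf].
  by split=> // x; apply: continuous_comp; [exact: cL|exact: cf].
split=> [x|v]; first by apply: continuous_comp; [exact: cL|exact: cf].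
have [df cdf] := hf (L0 v); split=> [x|]; first by rewrite derivable_affineE.
rewrite (_ : 'D_v _ = 'D_(L0 v) f \o L); first exact: IH.
by apply/funext => x; rewrite derive_affine.
Qed.

Lemma smooth_affine (f : W -> R) : smooth f -> smooth (f \o L).
Proof. by move=> sf n; exact: Cn_affine. Qed.

End affine.

Section support.
Context {R : realType} {V : normedModType R}.
Implicit Types f : V -> R.

Lemma out_supp f x : ~ supp f x -> f x = 0.
Proof.
move=> nfx; apply: contrapT => /eqP fx0; apply: nfx.
exact: subset_closure.
Qed.

Lemma out_supp_derive f x v : ~ supp f x -> 'D_v f x = 0.
Proof.
move=> nfx; apply: (@derive_eq0_open _ _ f (~` supp f)) => //.
  exact/closed_openC/closed_closure.
by move=> y; exact: out_supp.
Qed.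

Lemma supp_subset f (A : set V) : closed A -> (forall x, ~ A x -> f x = 0) ->
  supp f `<=` A.
Proof.
move=> cA fA; rewrite /supp [X in _ `<=` X](closure_id A).1//.
apply: closure_subset => x /eqP fx; apply: contrapT => nAx.
exact/fx/fA.
Qed.

Lemma compact_bounded_fun f (K : set V) : continuous f -> compact K ->
  (forall x, ~ K x -> f x = 0) -> exists2 M, 0 <= M & forall x, `|f x| <= M.
Proof.
move=> cf cK f0.
have /compact_bounded[M [_ hM]] : compact (f @` K).
  by apply: continuous_compact => //; exact: continuous_subspaceT.
exists (`|M| + 1) => [|x]; first by rewrite addr_ge0.
have [Kx|nKx] := pselect (K x); last by rewrite f0// normr0 addr_ge0.
apply: hM; last by exists x.
by rewrite (le_lt_trans (ler_norm _))// ltrDl.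
Qed.

Lemma test_function_bounded (U : set V) f : test_function U f ->
  exists2 M, 0 <= M & forall x, `|f x| <= M.
Proof.
move=> [sf cf _]; apply: (compact_bounded_fun _ cf (@out_supp f)).
exact: smooth_continuous.
Qed.

Lemma test_function_bounded_derive (U : set V) f v : test_function U f ->
  exists2 M, 0 <= M & forall x, `|'D_v f x| <= M.
Proof.
move=> [sf cf _]; apply: (compact_bounded_fun _ cf (fun x => @out_supp_derive f x v)).
exact/smooth_continuous/smooth_derive.
Qed.

End support.

Section line.
Context {R : realType} {V : normedModType R} (x v : V).
Let L (h : R) : V := h *: v + x.
Let LL (y w : R) (h : R) : L (h *: w + y) = h *: (w *: v) + L y.
Proof. by rewrite /L scalerDl scalerA addrA. Qed.

(** Turns a directional derivative into an ordinary one, so that the mean value theorem, the chain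
    rule and differentiation under the integral in one real variable apply. *)
Lemma derivable_line (f : V -> R) h :
  derivable (fun h : R => f (h *: v + x)) h 1 = derivable f (h *: v + x) v.
Proof. by rewrite (derivable_affineE LL) scale1r. Qed.

Lemma derive_line (f : V -> R) h :
  'D_1 (fun h : R => f (h *: v + x)) h = 'D_v f (h *: v + x).
Proof. by rewrite (derive_affine LL) scale1r. Qed.

End line.

Section real_integrable.
Context d (T : measurableType d) (R : realType) (mu : {measure set T -> \bar R}) (D : set T).
Hypothesis mD : measurable D.
Implicit Types f g k : T -> R.
Notation L1 f := (mu.-integrable D (EFin \o f)).

Lemma L1_measurable f : L1 f -> measurable_fun D f.
Proof. by move=> /measurable_int/measurable_EFinP. Qed.

Lemma L1D f g : L1 f -> L1 g -> L1 (fun x => f x + g x).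
Proof. by move=> If Ig; have := integrableD mD If Ig; exact: eq_integrable. Qed.

Lemma L1Z (c : R) f : L1 f -> L1 (fun x => c * f x).
Proof. by move=> If; have := integrableZl mD c If; exact: eq_integrable. Qed.

Lemma L1N f : L1 f -> L1 (fun x => - f x).
Proof. by move=> If; have := L1Z (-1) If; apply: eq_integrable => // x _ /=; rewrite mulN1r. Qed.

Lemma L1B f g : L1 f -> L1 g -> L1 (fun x => f x - g x).
Proof. by move=> If Ig; apply: L1D => //; exact: L1N. Qed.

Lemma L1_sum (I : Type) (s : seq I) (f : I -> T -> R) :
  (forall i, L1 (f i)) -> L1 (fun x => \sum_(i <- s) f i x).
Proof.
move=> If; elim: s => [|i s IH].
  by under [X in _ \o X]eq_fun do rewrite big_nil; exact: integrable0.
under [X in _ \o X]eq_fun do rewrite big_cons; exact: L1D.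
Qed.

Lemma L1_norm f : L1 f -> L1 (fun x => `|f x|).
Proof. exact: integrable_norm. Qed.

Lemma L1_le f g : measurable_fun D f -> (forall x, D x -> `|f x| <= g x) -> L1 g -> L1 f.
Proof.
move=> mf fg Ig; apply: le_integrable Ig => //; first exact/measurable_EFinP.
move=> x Dx /=; rewrite lee_fin (le_trans (fg _ Dx))//; exact: ler_norm.
Qed.

Lemma L1_bounded f g (M : R) : measurable_fun D g -> (forall x, D x -> `|g x| <= M) ->
  L1 f -> L1 (fun x => f x * g x).
Proof.
move=> mg gM If; apply: (@L1_le _ (fun x => M * `|f x|)).
- by apply: measurable_funM => //; exact: L1_measurable.
- by move=> x Dx; rewrite normrM mulrC ler_wpM2r ?gM.
- exact/L1Z/L1_norm.
Qed.

Lemma L1_cst (c : R) : (mu D < +oo)%E -> L1 (fun=> c).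
Proof.
move=> fD; apply: measurable_bounded_integrable => //.
by exists `|c|; split; [exact: num_real|move=> N cN y _ /=; exact: ltW].
Qed.

End real_integrable.

Section derive_under.
Context {R : realType} {V : normedModType R} d (Y : measurableType d).
Variables (mu : {measure set Y -> \bar R}) (K : V -> Y -> R) (g : Y -> R) (v : V) (M : R).
Hypothesis ig : mu.-integrable setT (EFin \o g).
Hypothesis mK : forall z, measurable_fun setT (K z).
Hypothesis dK : forall z y, derivable (K ^~ y) z v.
Hypothesis bK : forall z y, `|K z y| <= M.
Hypothesis bdK : forall z y, `|'D_v (K ^~ y) z| <= M.

(** One-variable differentiation under the integral along the line through [z] with direction [v],
    with majorant |g| M. *)
Lemma derive_under_integral z :
  derivable (fun z => \int[mu]_y (g y * K z y)) z v /\
  'D_v (fun z => \int[mu]_y (g y * K z y)) z = \int[mu]_y (g y * 'D_v (K ^~ y) z).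
Proof.
pose F (h : R) (y : Y) := g y * K (h *: v + z) y.
pose G y := `|g y| * M.
(* The sign of [M] follows from the bound on the kernel only when [Y] has a point. *)
have M0 : Y -> 0 <= M by move=> y; rewrite (le_trans (normr_ge0 _) (bK z y)).
have I0 : `](-1 : R), 1[%classic 0 by rewrite /= in_itv/= ltrN10 ltr01.
have dF h y : 'D_1 (F ^~ y) h = g y * 'D_v (K ^~ y) (h *: v + z).
  rewrite -(derive_line z v (K ^~ y)) -[RHS]/(g y *: _) -deriveZ//.
  by rewrite (derivable_line z v (K ^~ y)).
have ddF h y : derivable (F ^~ y) h 1.
  by apply: derivableZ; rewrite (derivable_line z v (K ^~ y)).
have iF h : mu.-integrable setT (EFin \o F h).
  by apply: (@L1_bounded _ _ _ _ _ _ _ _ M) => //.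
have G0 y : 0 <= G y by rewrite mulr_ge0// M0.
have iG : mu.-integrable setT (EFin \o G).
  have := L1Z measurableT M (L1_norm ig).
  by apply: eq_integrable => // y _ /=; rewrite mulrC.
have bF h y : `](-1 : R), 1[%classic h -> [set: Y] y -> `|partial1of2 F h y| <= G y.
  by move=> _ _; rewrite partial1of2E dF normrM ler_wpM2l.
have [E D] := (@differentiation_under_integral _ _ _ mu F setT measurableT 0 (-1) 1 I0
  (fun h _ => iF h) (fun h y _ _ => ddF h y) G G0 iG bF,
  @derivable_under_integral _ _ _ mu F setT measurableT 0 (-1) 1 I0
  (fun h _ => iF h) (fun h y _ _ => ddF h y) G G0 iG bF).
split.
  by move: D; rewrite (derivable_line z v (fun z => \int[mu]_y (g y * K z y)) 0) scale0r add0r.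
move: E; rewrite derive1E (derive_line z v (fun z => \int[mu]_y (g y * K z y)) 0) scale0r add0r => ->.
by apply: eq_Rintegral => y _; rewrite partial1of2E dF scale0r add0r.
Qed.

End derive_under.

(** * Averages of translates *)

Section param.
Context d1 d2 (T1 : measurableType d1) (T2 : measurableType d2) (R : realType).
Variable m2 : {sigma_finite_measure set T2 -> \bar R}.

(** Tonelli for the positive and the negative part; the integrals may be infinite, in which case the
    real integral takes its default value. *)
Lemma measurable_Rintegral_param (f : T1 * T2 -> R) : measurable_fun setT f ->
  measurable_fun setT (fun x => \int[m2]_y f (x, y)).
Proof.
move=> mf; have mF : measurable_fun setT (EFin \o f) by exact/measurable_EFinP.
rewrite /Rintegral; apply: measurableT_comp => //.
under eq_fun do rewrite integralE.
have Ep x : (\int[m2]_x0 (fun x1 : T2 => (f (x, x1))%:E)^\+ x0)%E =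
    (\int[m2]_y (EFin \o f)^\+ (x, y))%E.
  by apply: eq_integral => y _; rewrite !funeposE.
have En x : (\int[m2]_x0 (fun x1 : T2 => (f (x, x1))%:E)^\- x0)%E =
    (\int[m2]_y (EFin \o f)^\- (x, y))%E.
  by apply: eq_integral => y _; rewrite !funenegE.
under eq_fun do rewrite Ep En.
apply: emeasurable_funB.
- apply: (measurable_fun_fubini_tonelli_F ((EFin \o f)^\+)%E) => //.
  exact: measurable_funepos.
- apply: (measurable_fun_fubini_tonelli_F ((EFin \o f)^\-)%E) => //.
  exact: measurable_funeneg.
Qed.

End param.

Section Rint.
Context d (T : measurableType d) (R : realType) (mu : {measure set T -> \bar R}).
Implicit Types f g : T -> R.

Lemma EFin_Rintegral D f : measurable D -> mu.-integrable D (EFin \o f) ->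
  (\int[mu]_(x in D) f x)%:E = (\int[mu]_(x in D) (f x)%:E)%E.
Proof. by move=> mD If; rewrite /Rintegral fineK//; exact: integrable_fin_num. Qed.

(** The weight [k] has mass 1, so [c] is its own average and can be moved under the integral. *)
Lemma avg_dist (u k : T -> R) (c M : R) : mu.-integrable setT (EFin \o u) ->
  measurable_fun setT k -> (forall y, 0 <= k y) -> (forall y, k y <= M) ->
  (\int[mu]_y (k y)%:E = 1)%E ->
  (`|(\int[mu]_y (u y * k y) - c)%:E| <= \int[mu]_y (k y * `|u y - c|)%:E)%E.
Proof.
move=> Iu mk k0 kM k1.
have Ik : mu.-integrable setT (EFin \o k).
  apply/integrableP; split; first exact/measurable_EFinP.
  by under eq_integral do rewrite gee0_abs ?lee_fin//; rewrite k1 ltry.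
have Iuk : mu.-integrable setT (EFin \o (fun y => u y * k y)).
  by apply: (@L1_bounded _ _ _ _ _ _ _ _ M) => // y _; rewrite ger0_norm.
have k1' : \int[mu]_y k y = 1 by rewrite /Rintegral k1.
rewrite -[X in (_ - X)%R]mulr1 -k1' -RintegralZl//.
have Ick : mu.-integrable setT (EFin \o (fun y => c * k y)) by exact: L1Z.
rewrite -RintegralB//.
have Id : mu.-integrable setT (EFin \o (fun y => u y * k y - c * k y)) by exact: L1B.
rewrite EFin_Rintegral//; apply: le_trans (le_abse_integral _ _ _) _ => //.
  exact: measurable_int Id.
rewrite le_eqVlt; apply/orP; left; apply/eqP; apply: eq_integral => y _ /=.
by rewrite -mulrBl normrM mulrC [X in X * _]ger0_norm.
Qed.

End Rint.

Section sigma_finite_tx.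
Context {R : realType} {n : nat}.
Local Open Scope ereal_scope.

Lemma sigma_finite_tx : sigma_finite [set: measurableTypeR R * 'rV[R]_n] (lebesgue_tx R n).
Proof.
exists (fun k => [set z | (`|z.1| <= k%:R)%R /\ (`|z.2| <= k%:R)%R]).
  apply/seteqP; split=> [z _|//].
  exists (Num.bound `|(z : R * 'rV[R]_n)|) => //=.
  have zk := ltW (archi_boundP (normr_ge0 (z : R * 'rV[R]_n))).
  by split; apply: le_trans zk; [exact: norm_tx_fst|exact: norm_tx_snd].
move=> k; split; last exact: lebesgue_tx_box_fin.
by apply: closed_measurable_tx; exact: closed_tx_box.
Qed.

(** The product measure packaged as sigma-finite, so that it can be one factor of a further product
    in Tonelli's theorem. *)
Definition lebesgue_tx_sf :
    {sigma_finite_measure set (measurableTypeR R * 'rV[R]_n)%type -> \bar R} :=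
  HB.pack (@lebesgue_measure R \x lebesgue_rV n)
    (Measure_isSigmaFinite.Build _ _ _ (@lebesgue_measure R \x lebesgue_rV n) sigma_finite_tx).

Context dW (W : measurableType dW) (nu : {sigma_finite_measure set W -> \bar R}).
Local Notation X := (measurableTypeR R * 'rV[R]_n)%type.
Variable Phi : X * W -> \bar R.
Hypotheses (mPhi : measurable_fun setT Phi) (Phi0 : forall q, 0 <= Phi q).

Lemma tonelli_txW :
  \int[lebesgue_tx R n]_z \int[nu]_w Phi (z, w) = \int[nu]_w \int[lebesgue_tx R n]_z Phi (z, w).
Proof. exact: (@fubini_tonelli _ _ _ _ _ lebesgue_tx_sf nu Phi mPhi Phi0). Qed.

Lemma measurable_txW : measurable_fun setT (fun w => \int[lebesgue_tx R n]_z Phi (z, w)).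
Proof. exact: (@measurable_fun_fubini_tonelli_G _ _ _ _ _ lebesgue_tx_sf Phi mPhi Phi0). Qed.

End sigma_finite_tx.

Section minkowski.
Context {R : realType} {n : nat} dW (W : measurableType dW).
Variable nu : {sigma_finite_measure set W -> \bar R}.
Local Notation X := (measurableTypeR R * 'rV[R]_n)%type.
Local Notation mu := (lebesgue_tx R n).
Local Open Scope ereal_scope.

(** Minkowski's integral inequality: an average of translates is as close to [g] in L1 as the worst
    translate that carries weight. The shift [a] is [(0, w)] for mollification in space and [(s, 0)]
    for mollification in time. *)
Lemma L1_minkowski (g F : X -> R) (k : W -> R) (a : W -> X) (e : R) :
  measurable_fun setT g -> measurable_fun setT F -> measurable_fun setT k ->
  measurable_fun setT a -> (forall w, 0 <= k w)%R -> \int[nu]_w (k w)%:E = 1 ->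
  {ae mu, forall z, `|(F z - g z)%:E| <=
     \int[nu]_w (k w * `|g (((z : R * 'rV[R]_n) + a w)%R) - g z|)%:E} ->
  (0 <= e)%R ->
  (forall w, k w != 0%R -> \int[mu]_z `|(g ((z : R * 'rV[R]_n) + a w)%R - g z)%:E| <= e%:E) ->
  \int[mu]_z `|(F z - g z)%:E| <= e%:E.
Proof.
move=> mg mF mk ma k0 k1 Fg e0 ge.
pose Phi (q : X * W) : \bar R := (k q.2 * `|g (((q.1 : R * 'rV[R]_n) + a q.2)%R) - g q.1|)%:E.
have mPhi : measurable_fun setT Phi.
  apply/measurable_EFinP; apply: measurable_funM.
    by apply: (measurableT_comp mk); exact: measurable_snd.
  apply: measurableT_comp => //; apply: measurable_funB.
    apply: (measurableT_comp mg); apply: measurable_fun_pair => /=.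
      apply: measurable_funD.
        by apply: (measurableT_comp measurable_fst); exact: measurable_fst.
      by apply: (measurableT_comp measurable_fst); apply: (measurableT_comp ma); exact: measurable_snd.
    apply: measurable_fun_rV => i; under eq_fun do rewrite mxE.
    apply: measurable_funD.
      apply: (measurable_rV_coordP (D := setT)).
      by apply: (measurableT_comp measurable_snd); exact: measurable_fst.
    apply: (measurable_rV_coordP (D := setT)).
    by apply: (measurableT_comp measurable_snd); apply: (measurableT_comp ma); exact: measurable_snd.
  by apply: (measurableT_comp mg); exact: measurable_fst.
have Phi0 q : 0 <= Phi q by rewrite lee_fin mulr_ge0.
have mabs : measurable_fun setT (fun z : X => `|(F z - g z)%:E|).
  by apply: measurableT_comp => //; apply/measurable_EFinP; exact: measurable_funB.
apply: le_trans (_ : \int[mu]_z \int[nu]_w Phi (z, w) <= _).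
  apply: ae_ge0_le_integral => //.
  - by move=> z _; exact: integral_ge0.
  - exact: (measurable_fun_fubini_tonelli_F Phi).
  - by apply: filterS Fg => z h _; exact: h.
rewrite (tonelli_txW _ mPhi Phi0).
apply: le_trans (_ : \int[nu]_w ((k w)%:E * e%:E) <= _).
  apply: ge0_le_integral => //.
  - by move=> w _; exact: integral_ge0.
  - exact: measurable_txW.
  - by apply: emeasurable_funM => //; exact/measurable_EFinP.
  - move=> w _; rewrite /Phi/=.
    under eq_integral do rewrite EFinM.
    have [->|kw] := eqVneq (k w) 0%R.
      by under eq_integral do rewrite mul0e; rewrite integral0 mul0e.
    rewrite ge0_integralZl_EFin//; last first.
      apply/measurable_EFinP; apply: measurableT_comp => //.
      apply: measurable_funB => //; apply: (measurableT_comp mg).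
      exact: (measurable_tx_shift (a w)).
    by apply: lee_wpmul2l; [rewrite lee_fin|exact: ge].
rewrite ge0_integralZr ?k1 ?mul1e// ?lee_fin//;
  first [exact/measurable_EFinP|by move=> w _; rewrite lee_fin].
Qed.

End minkowski.

(** * Mollification kernels *)

Section kernels.
Context {R : realType}.

Lemma coord_le_enorm n (x : 'rV[R]_n) i : `|x ord0 i| <= enorm x.
Proof.
rewrite /enorm /dotv -sqrtr_sqr ler_sqrt ?sumr_ge0//; last by move=> *; rewrite -expr2 sqr_ge0.
by rewrite (bigD1 i)//= -expr2 lerDl sumr_ge0// => j _; rewrite -expr2 sqr_ge0.
Qed.

Lemma norm_le_enorm n (x : 'rV[R]_n) : `|x| <= enorm x.
Proof. by apply: norm_rV_le => [|i]; [exact: sqrtr_ge0|exact: coord_le_enorm]. Qed.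

Lemma enormZ n (a : R) (x : 'rV[R]_n) : enorm (a *: x) = `|a| * enorm x.
Proof.
rewrite /enorm /dotv -sqrtr_sqr -sqrtrM ?sqr_ge0// mulr_sumr; congr Num.sqrt.
by apply: eq_bigr => i _; rewrite !mxE expr2 mulrACA.
Qed.

Lemma enormN n (x : 'rV[R]_n) : enorm (- x) = enorm x.
Proof. by rewrite -scaleN1r enormZ normrN1 mul1r. Qed.

Lemma enorm_delta n (i : 'I_n) : enorm (delta_mx ord0 i : 'rV[R]_n) = 1.
Proof.
rewrite /enorm /dotv (bigD1 i)//= big1 ?addr0; last first.
  by move=> j ji; rewrite !mxE (negbTE ji) andbF mulr0.
by rewrite !mxE !eqxx mulr1 sqrtr1.
Qed.

Variables (n : nat) (eta : 'rV[R]_n -> R).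
Hypothesis heta : radial_kernel eta.

Lemma kernel_ge0 x : 0 <= eta x.
Proof. by case: heta => _ /(_ x)/andP[]. Qed.

Lemma kernel_smooth : smooth eta.
Proof. by case: heta => -[]. Qed.

Lemma kernel_out x : 1 <= enorm x -> eta x = 0.
Proof.
case: heta => -[_ _ suppeta _ _ _] x1; apply: out_supp => /suppeta/=.
by rewrite ltNge x1.
Qed.

Lemma measurable_kernel : measurable_fun setT eta.
Proof. apply: continuous_measurable_rV; exact/smooth_continuous/kernel_smooth. Qed.

Lemma integral_kernel : (\int[lebesgue_rV n]_x (eta x)%:E = 1)%E.
Proof.
case: heta => _ _ _; rewrite /Rintegral.
(* An infinite integral would have real part 0 by convention, which differs from 1. *)
case: (\int[_]_x _)%E => [r /= ->//| |] /=; by move/esym/eqP; rewrite oner_eq0.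
Qed.

Lemma eta_l_ge0 l x : 0 < l -> 0 <= eta_l eta l x.
Proof. by move=> l0; rewrite mulr_ge0 ?kernel_ge0// invr_ge0 exprn_ge0// ltW. Qed.

(** Here the norm is the sup norm; it is at most the Euclidean one, so the sup ball of radius [l]
    contains the support. *)
Lemma eta_l_out l x : 0 < l -> l <= `|x| -> eta_l eta l x = 0.
Proof.
move=> l0 lx; rewrite /eta_l kernel_out ?mulr0// enormZ gtr0_norm ?invr_gt0//.
by rewrite mulrC ler_pdivlMr// mul1r (le_trans lx)// norm_le_enorm.
Qed.

Lemma eta_lN l x : eta_l eta l (- x) = eta_l eta l x.
Proof.
by rewrite /eta_l; congr (_ * _); case: heta => _ _ + _; apply; rewrite scalerN enormN.
Qed.

Lemma eta_l_smooth l : smooth (eta_l eta l).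
Proof.
apply: smoothM; first exact: smooth_cst.
apply: (@smooth_affine _ _ _ (fun x : 'rV[R]_n => l^-1 *: x) (fun x => l^-1 *: x)) kernel_smooth.
  by move=> x v h; rewrite scalerDr !scalerA mulrC.
by move=> x; apply: scaler_continuous.
Qed.

Lemma measurable_eta_l l : measurable_fun setT (eta_l eta l).
Proof. apply: continuous_measurable_rV; exact/smooth_continuous/eta_l_smooth. Qed.

Lemma integral_eta_l l : 0 < l -> (\int[lebesgue_rV n]_x (eta_l eta l x)%:E = 1)%E.
Proof.
move=> l0; rewrite (ge0_integral_rV_affine 0 l0).
- under eq_integral do rewrite /eta_l addr0 scalerA mulVf ?gt_eqF// scale1r EFinM.
  rewrite ge0_integralZl_EFin//.
  + by rewrite integral_kernel mule1 -EFinM mulfV// gt_eqF// exprn_gt0.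
  + by move=> x _; rewrite lee_fin kernel_ge0.
  + by apply/measurable_EFinP; exact: measurable_kernel.
  + by rewrite invr_ge0 exprn_ge0// ltW.
- by apply/measurable_EFinP; exact: measurable_eta_l.
- by move=> x; rewrite lee_fin eta_l_ge0.
Qed.

Hypothesis n0 : (0 < n)%N.
Let e1 : 'rV[R]_n := delta_mx ord0 (Ordinal n0).

(* The spatial kernel restricted to a line: a smooth even bump on R at no extra cost. *)
Definition theta0 (s : R) : R := eta (s *: e1).

Lemma theta0_ge0 s : 0 <= theta0 s.
Proof. exact: kernel_ge0. Qed.

Lemma theta0_out s : 1 <= `|s| -> theta0 s = 0.
Proof. by move=> s1; apply: kernel_out; rewrite enormZ enorm_delta mulr1. Qed.

Lemma theta0N s : theta0 (- s) = theta0 s.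
Proof. by case: heta => _ _ + _; apply; rewrite scaleNr enormN. Qed.

Lemma theta0_smooth : smooth theta0.
Proof.
apply: (@smooth_affine _ _ _ (fun s : R => s *: e1) (fun s => s *: e1)) kernel_smooth.
  by move=> x v h; rewrite scalerDl scalerA.
by move=> x; apply: cvgZl; exact: cvg_id.
Qed.

Lemma measurable_theta0 : measurable_fun [set: measurableTypeR R] theta0.
Proof. by apply: continuous_measurable_fun; exact/smooth_continuous/theta0_smooth. Qed.

Lemma theta0_integrable :
  (@lebesgue_measure R).-integrable setT (EFin \o theta0).
Proof.
apply: (@L1_le _ (measurableTypeR R) R lebesgue_measure setT measurableT theta0 (\1_(`[(-1 : R), 1]%classic))).
- exact: measurable_theta0.
- move=> s _; rewrite ger0_norm ?theta0_ge0// indicE.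
  have [_|sn] := boolP (s \in _).
    by case: heta => _ /(_ (s *: e1))/andP[].
  rewrite theta0_out// leNgt; apply/negP => s1; move/negP: sn; apply.
  by rewrite inE/= in_itv/= -ler_norml ltW.
- exact: integrable_indic_itv.
Qed.

(** Restriction to a line could lose all the mass of a general kernel. Radiality prevents it: [eta]
    is nonzero at some [x0], so [theta0] is positive at the Euclidean norm of [x0], and by
    continuity it exceeds half that value on an interval. *)
Lemma theta0_int_gt0 : 0 < \int[lebesgue_measure]_s (theta0 s).
Proof.
have [x0 ex0] : exists x0, eta x0 != 0.
  apply: contrapT => h; have := integral_kernel.
  rewrite integral0_eq => [/eqP|x _]; first by rewrite eq_sym onee_eq0.
  by apply/eqP; rewrite eqe; apply/negPn/negP => ?; apply: h; exists x.
pose s0 := enorm x0; pose m := theta0 s0 / 2.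
have ts0 : 0 < theta0 s0.
  rewrite lt_neqAle theta0_ge0 andbT eq_sym.
  rewrite (_ : theta0 s0 = eta x0)//; case: heta => _ _ + _; apply.
  by rewrite enormZ enorm_delta mulr1 ger0_norm// sqrtr_ge0.
have m0 : 0 < m by rewrite divr_gt0.
have := smooth_continuous theta0_smooth (x := s0) => /cvgrPdist_lt /(_ _ m0) /nbhs_ballP[r /= r0 hr].
pose I := `[s0 - r / 2, s0 + r / 2]%classic.
have mI : measurable (I : set (measurableTypeR R)) by exact: measurable_itv.
rewrite -lte_fin EFin_Rintegral//; last exact: theta0_integrable.
have th0 (s : R) : (0 <= (theta0 s)%:E)%E by rewrite lee_fin theta0_ge0.
have mth : measurable_fun [set: measurableTypeR R] (EFin \o theta0).
  by apply/measurable_EFinP; exact: measurable_theta0.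
apply: (@lt_le_trans _ _ (\int[lebesgue_measure]_(s in I) (theta0 s)%:E)%E); last first.
  by apply: ge0_subset_integral.
apply: (@lt_le_trans _ _ (\int[lebesgue_measure]_(s in I) m%:E)%E); last first.
  apply: ge0_le_integral => //; first by move=> ? _; rewrite lee_fin ltW.
    exact: measurable_funS mth.
  move=> s; rewrite /I/= in_itv/= => /andP[s1 s2]; rewrite lee_fin.
  have : `|theta0 s0 - theta0 s| < m.
    by apply: hr; rewrite -ball_normE/= ltr_norml; apply/andP; split; lra.
  by rewrite ltr_norml /m => /andP[? ?]; lra.
rewrite integral_cst// mule_gt0 ?lte_fin//.
rewrite -[X in (_ < X)%E]/(lebesgue_measure I) lebesgue_measure_itv/= lte_fin ifT ?lte_fin; last by lra.
by lra.
Qed.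

(** The restriction to a line need not have integral 1, hence the extra normalising factor. *)
Definition theta (e s : R) : R :=
  (e * \int[lebesgue_measure]_s (theta0 s))^-1 * theta0 (e^-1 * s).

Lemma theta_ge0 e s : 0 < e -> 0 <= theta e s.
Proof.
move=> e0; rewrite mulr_ge0 ?theta0_ge0// invr_ge0 mulr_ge0 ?(ltW e0)//.
exact/ltW/theta0_int_gt0.
Qed.

Lemma theta_out e s : 0 < e -> e <= `|s| -> theta e s = 0.
Proof.
move=> e0 es; rewrite /theta theta0_out ?mulr0// normrM gtr0_norm ?invr_gt0//.
by rewrite mulrC ler_pdivlMr// mul1r.
Qed.

Lemma thetaN e s : theta e (- s) = theta e s.
Proof. by rewrite /theta mulrN theta0N. Qed.

Lemma theta_smooth e : smooth (theta e).
Proof.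
apply: smoothM; first exact: smooth_cst.
apply: (@smooth_affine _ _ _ (fun s : R => e^-1 * s) (fun s => e^-1 * s)) theta0_smooth.
  by move=> x v h; rewrite mulrDr mulrCA.
by move=> x; apply: cvgMr; exact: cvg_id.
Qed.

Lemma measurable_theta e : measurable_fun [set: measurableTypeR R] (theta e).
Proof. apply: continuous_measurable_fun; exact/smooth_continuous/theta_smooth. Qed.

Lemma integral_theta e : 0 < e -> (\int[lebesgue_measure]_s (theta e s)%:E = 1)%E.
Proof.
move=> e0; rewrite (ge0_integral_affine 0 e0).
- under eq_integral do rewrite /theta addr0 mulrA mulVf ?gt_eqF// mul1r EFinM.
  rewrite ge0_integralZl_EFin//.
  + rewrite -(EFin_Rintegral _ _)//.
    * by rewrite -!EFinM invfM mulrA mulrA mulfV ?gt_eqF// mul1r mulVf// gt_eqF// theta0_int_gt0.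
    * exact: theta0_integrable.
  + by move=> x _; rewrite lee_fin theta0_ge0.
  + by apply/measurable_EFinP; exact: measurable_theta0.
  + by rewrite invr_ge0 mulr_ge0 ?(ltW e0)//; exact/ltW/theta0_int_gt0.
- by apply/measurable_EFinP; exact: measurable_theta.
- by move=> x; rewrite lee_fin theta_ge0.
Qed.

End kernels.

(** * Mollification operators *)

Section null_product.
Context d1 d2 (T1 : measurableType d1) (T2 : measurableType d2) (R : realType).
Variable m1 : {sigma_finite_measure set T1 -> \bar R}.
Variable m2 : {sigma_finite_measure set T2 -> \bar R}.

Lemma ae_fst (P : T1 -> Prop) : {ae m1, forall x, P x} ->
  {ae (m1 \x m2)%E, forall z, P z.1}.
Proof.
move=> [N [mN N0 PN]]; exists (N `*` setT); split; first exact: measurableX.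
  by rewrite product_measure1E//; transitivity (0 * m2 setT)%E; [congr (_ * _)%E; exact: N0|exact: mul0e].
by move=> z /= nP; split => //; exact: PN.
Qed.

Lemma ae_snd (P : T2 -> Prop) : {ae m2, forall x, P x} ->
  {ae (m1 \x m2)%E, forall z, P z.2}.
Proof.
move=> [N [mN N0 PN]]; exists (setT `*` N); split; first exact: measurableX.
  by rewrite product_measure1E//; transitivity (m1 setT * 0)%E; [congr (_ * _)%E; exact: N0|exact: mule0].
by move=> z /= nP; split => //; exact: PN.
Qed.

End null_product.

Section abs_Rint.
Context d (T : measurableType d) (R : realType) (mu : {measure set T -> \bar R}).

(** True without integrability: if the integral is not finite, its real value is 0. *)
Lemma abs_Rintegral_le (f : T -> R) : measurable_fun setT f ->
  (`|\int[mu]_x f x|%:E <= \int[mu]_x `|f x|%:E)%E.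
Proof.
move=> mf; have := @le_abse_integral _ _ _ mu setT (EFin \o f) measurableT.
move=> /(_ _)/wrap[]; first exact/measurable_EFinP.
rewrite /Rintegral /=; case: (\int[mu]_x (f x)%:E)%E => [r //| |];
  by rewrite /= normr0 => _; exact: integral_ge0.
Qed.

End abs_Rint.

Section operators.
Context {R : realType} {n : nat}.
Local Notation E := 'rV[R]_n.
Local Notation X := (R * E)%type.
Local Notation mX := (measurableTypeR R * 'rV[R]_n)%type.
Local Notation mu := (lebesgue_tx R n).
Implicit Types (g : X -> R) (kap : E -> R) (th : R -> R).

(** The integral runs over the whole space: this version is meant for fields extended by 0, and for
    kernels that may be derivatives of [eta_l]. *)
Definition mollx kap g : X -> R :=
  fun z => \int[lebesgue_rV n]_y (g (z.1, y) * kap (z.2 - y)).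

(* Not in the paper: time is regularised as well, so that the energy identity holds in the
   classical sense, and this regularisation is removed first. *)
Definition mollt th g : X -> R :=
  fun z => \int[lebesgue_measure]_s (g (s, z.2) * th (z.1 - s)).

Definition convol (k : X -> R) g : X -> R := fun z => \int[mu]_w (g w * k (z - w)).

Definition tensor th kap : X -> R := fun z => th z.1 * kap z.2.

Lemma measurable_rVB d (T : measurableType d) (f g : T -> E) :
  measurable_fun setT f -> measurable_fun setT g ->
  measurable_fun setT (fun t => f t - g t).
Proof.
move=> mf mg; apply: measurable_fun_rV => i; under eq_fun do rewrite !mxE.
by apply: measurable_funB; apply: (measurable_rV_coordP (D := setT)).
Qed.

Lemma measurable_mollx_integrand kap g :
  measurable_fun [set: mX] g -> measurable_fun setT kap ->
  measurable_fun [set: mX * E] (fun q => g (q.1.1, q.2) * kap (q.1.2 - q.2)).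
Proof.
move=> mg mk; have m11 : measurable_fun [set: mX * E] (fun q => q.1.1).
  by apply: (measurableT_comp measurable_fst); exact: measurable_fst.
have m12 : measurable_fun [set: mX * E] (fun q => q.1.2).
  by apply: (measurableT_comp measurable_snd); exact: measurable_fst.
apply: measurable_funM.
  by apply: (measurableT_comp mg); apply: measurable_fun_pair => //; exact: measurable_snd.
by apply: (measurableT_comp mk); apply: measurable_rVB => //; exact: measurable_snd.
Qed.

Lemma measurable_mollx kap g :
  measurable_fun [set: mX] g -> measurable_fun setT kap ->
  measurable_fun [set: mX] (mollx kap g).
Proof.
move=> mg mk.
exact: (measurable_Rintegral_param (lebesgue_rV n) (measurable_mollx_integrand mg mk)).
Qed.

Lemma measurable_mollt th g :
  measurable_fun [set: mX] g -> measurable_fun [set: measurableTypeR R] th ->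
  measurable_fun [set: mX] (mollt th g).
Proof.
move=> mg mk.
apply: (measurable_Rintegral_param (@lebesgue_measure R)
  (f := fun q : mX * measurableTypeR R => g (q.2, q.1.2) * th (q.1.1 - q.2))).
have m11 : measurable_fun [set: mX * measurableTypeR R] (fun q => q.1.1).
  by apply: (measurableT_comp measurable_fst); exact: measurable_fst.
have m12 : measurable_fun [set: mX * measurableTypeR R] (fun q => q.1.2).
  by apply: (measurableT_comp measurable_snd); exact: measurable_fst.
apply: measurable_funM.
  by apply: (measurableT_comp mg); apply: measurable_fun_pair => //; exact: measurable_snd.
by apply: (measurableT_comp mk); apply: measurable_funB => //; exact: measurable_snd.
Qed.

Lemma ae_section_rV g : mu.-integrable setT (EFin \o g) ->
  {ae lebesgue_measure, forall t, (lebesgue_rV n).-integrable setT (EFin \o (fun y => g (t, y)))}.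
Proof. by move=> ig; exact: (ae_integrable1 ig). Qed.

Lemma ae_section_R g : mu.-integrable setT (EFin \o g) ->
  {ae lebesgue_rV n, forall x, lebesgue_measure.-integrable setT (EFin \o (fun s => g (s, x)))}.
Proof. by move=> ig; exact: (ae_integrable2 ig). Qed.

(** Young's inequality for the convolution of two L1 functions: by Tonelli the absolute integrand
    has total integral equal to the product of the two norms. The kernel may change sign, which
    covers the derivatives of [eta_l]. *)
Lemma mollx_L1 kap g : mu.-integrable setT (EFin \o g) ->
  (lebesgue_rV n).-integrable setT (EFin \o kap) ->
  mu.-integrable setT (EFin \o mollx kap g).
Proof.
move=> ig ik.
have mg : measurable_fun [set: mX] g by exact: L1_measurable ig.
have mk : measurable_fun setT kap by exact: L1_measurable ik.
have mq := measurable_mollx_integrand mg mk.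
have maq : measurable_fun [set: mX * E] (fun q => (`|g (q.1.1, q.2) * kap (q.1.2 - q.2)|)%:E).
  by apply/measurable_EFinP; apply: measurableT_comp.
have maqt t : measurable_fun [set: E * E] (fun q => (`|g (t, q.2) * kap (q.1 - q.2)|)%:E).
  have mt : measurable_fun [set: E * E] (fun q : E * E => ((t : measurableTypeR R, q.1), q.2)).
    by apply: measurable_fun_pair; [apply: measurable_fun_pair => //; exact: measurable_fst|exact: measurable_snd].
  exact: (measurableT_comp maq mt).
apply/integrableP; split; first by apply/measurable_EFinP; exact: measurable_mollx.
have mN : measurable_fun [set: mX] (fun z => \int[lebesgue_rV n]_y (`|g (z.1, y) * kap (z.2 - y)|)%:E)%E.
  by apply: (measurable_fun_fubini_tonelli_F (m2 := lebesgue_rV n)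
     (fun q : mX * E => (`|g (q.1.1, q.2) * kap (q.1.2 - q.2)|)%:E)).
apply: (@le_lt_trans _ _ (\int[mu]_z \int[lebesgue_rV n]_y (`|g (z.1, y) * kap (z.2 - y)|)%:E)%E).
  apply: ge0_le_integral => //.
  - by apply: measurableT_comp => //; apply/measurable_EFinP; exact: measurable_mollx.
  - move=> z _; apply: abs_Rintegral_le.
    have mz : measurable_fun [set: E] (fun y : E => ((z : mX), y)) by exact: pair1_measurable.
    exact: (measurableT_comp mq mz).
rewrite tonelli_tx1//; last by move=> z; exact: integral_ge0.
have H t : (\int[lebesgue_rV n]_x \int[lebesgue_rV n]_y (`|g (t, y) * kap (x - y)|)%:E =
    \int[lebesgue_rV n]_y (`|g (t, y)|%:E * \int[lebesgue_rV n]_x `|kap x|%:E))%E.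
  rewrite (fubini_tonelli (fun q : E * E => (`|g (t, q.2) * kap (q.1 - q.2)|)%:E))//.
  apply: eq_integral => y _.
  under eq_integral do rewrite normrM EFinM.
  rewrite /= ge0_integralZl_EFin//; last first.
    apply/measurable_EFinP; apply: measurableT_comp => //; apply: (measurableT_comp mk).
    exact: measurable_rV_shift.
  congr (_ * _)%E; rewrite -[RHS](ge0_integral_rV_shift (- y))//.
  by apply/measurable_EFinP; apply: measurableT_comp.
under eq_integral do rewrite H.
have mgt t : measurable_fun setT (fun y => `|g (t, y)|%:E).
  apply/measurable_EFinP; apply: measurableT_comp => //.
  by apply: (measurableT_comp mg); exact: pair1_measurable.
under eq_integral => t _ do rewrite ge0_integralZr ?integral_ge0//.
have mag : measurable_fun [set: mX] (fun z => `|g z|%:E).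
  by apply/measurable_EFinP; apply: measurableT_comp.
rewrite ge0_integralZr ?integral_ge0//; last 2 first.
- exact: (measurable_fun_fubini_tonelli_F (fun z : mX => `|g z|%:E)).
- by move=> t _; exact: integral_ge0.
rewrite -(tonelli_tx1 mag)//.
have /integrableP[_ fg] := ig; have /integrableP[_ fk] := ik.
by rewrite lte_mul_pinfty ?integral_ge0// ge0_fin_numE ?integral_ge0.
Qed.


(** At almost every time the section of [g] is integrable, so [avg_dist] bounds the error pointwise;
    the substitution y = x + w and evenness of the kernel bring it to the form of [L1_minkowski]. *)
Lemma mollx_L1_minkowski kap g (M e : R) : mu.-integrable setT (EFin \o g) ->
  measurable_fun setT kap -> (forall x, 0 <= kap x) -> (forall x, kap x <= M) ->
  (forall x, kap (- x) = kap x) -> (\int[lebesgue_rV n]_x (kap x)%:E = 1)%E -> 0 <= e ->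
  (forall w : E, kap w != 0 -> (\int[mu]_z `|(g (z + (0, w)) - g z)%:E| <= e%:E)%E) ->
  (\int[mu]_z `|(mollx kap g z - g z)%:E| <= e%:E)%E.
Proof.
move=> ig mk k0 kM kN k1 e0 ge.
have mg : measurable_fun [set: mX] g by exact: L1_measurable ig.
apply: (@L1_minkowski _ _ _ E (lebesgue_rV n) g (mollx kap g) kap (fun w => (0, w))) => //.
- exact: measurable_mollx.
- exact: pair1_measurable.
have := @ae_fst _ _ _ _ _ lebesgue_measure (lebesgue_rV n) _ (ae_section_rV ig).
apply: filterS => -[t x] /= igt.
have mkx : measurable_fun setT (fun y : E => kap (x - y)).
  by apply: (measurableT_comp mk); exact: measurable_rVB.
have shiftk (f : E -> \bar R) : measurable_fun setT f -> (forall y, 0 <= f y)%E ->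
   (\int[lebesgue_rV n]_y f y = \int[lebesgue_rV n]_w f ((x : E) + w)%R)%E.
  move=> mf f0; rewrite -(ge0_integral_rV_shift x mf f0).
  by apply: eq_integral => w _; rewrite addrC.
have kx1 : (\int[lebesgue_rV n]_y (kap (x - y))%:E = 1)%E.
  rewrite shiftk; [|exact/measurable_EFinP|by move=> y; rewrite lee_fin].
  by under eq_integral do rewrite opprD addNKr kN.
apply: le_trans (avg_dist (g (t, x)) igt mkx _ _ kx1) _ => //.
rewrite shiftk//.
- rewrite le_eqVlt; apply/orP; left; apply/eqP; apply: eq_integral => w _.
  by rewrite opprD addNKr kN; congr (_ * `|g _ - _|)%:E; congr pair; rewrite /= addr0.
- apply/measurable_EFinP; apply: measurable_funM => //; apply: measurableT_comp => //.
  by apply: measurable_funB => //; apply: (measurableT_comp mg); exact: pair1_measurable.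
- by move=> y; rewrite lee_fin mulr_ge0.
Qed.

Lemma mollt_L1_minkowski th g (M e : R) : mu.-integrable setT (EFin \o g) ->
  measurable_fun [set: measurableTypeR R] th -> (forall x, 0 <= th x) -> (forall x, th x <= M) ->
  (forall x, th (- x) = th x) -> (\int[lebesgue_measure]_x (th x)%:E = 1)%E -> 0 <= e ->
  (forall s : R, th s != 0 -> (\int[mu]_z `|(g (z + (s, 0)) - g z)%:E| <= e%:E)%E) ->
  (\int[mu]_z `|(mollt th g z - g z)%:E| <= e%:E)%E.
Proof.
move=> ig mk k0 kM kN k1 e0 ge.
have mg : measurable_fun [set: mX] g by exact: L1_measurable ig.
apply: (@L1_minkowski _ _ _ (measurableTypeR R) lebesgue_measure g (mollt th g) th (fun s => (s, 0))) => //.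
- exact: measurable_mollt.
have := @ae_snd _ _ _ _ _ lebesgue_measure (lebesgue_rV n) _ (ae_section_R ig).
apply: filterS => -[t x] /= igt.
have mkx : measurable_fun [set: measurableTypeR R] (fun s => th (t - s)).
  by apply: (measurableT_comp mk); exact: measurable_funB.
have shiftk (f : R -> \bar R) : measurable_fun [set: measurableTypeR R] f -> (forall y, 0 <= f y)%E ->
   (\int[lebesgue_measure]_y f y = \int[lebesgue_measure]_w f ((t : R) + w)%R)%E.
  move=> mf f0; rewrite -(ge0_integral_R_shift t mf f0).
  by apply: eq_integral => w _; rewrite addrC.
have kx1 : (\int[lebesgue_measure]_s (th (t - s))%:E = 1)%E.
  rewrite shiftk; [|exact/measurable_EFinP|by move=> y; rewrite lee_fin].
  by under eq_integral do rewrite opprD addNKr kN.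
apply: le_trans (avg_dist (g (t, x)) igt mkx _ _ kx1) _ => //.
rewrite shiftk//.
- rewrite le_eqVlt; apply/orP; left; apply/eqP; apply: eq_integral => w _.
  by rewrite opprD addNKr kN; congr (_ * `|g _ - _|)%:E; congr pair; rewrite /= addr0.
- apply/measurable_EFinP; apply: measurable_funM => //; apply: measurableT_comp => //.
  by apply: measurable_funB => //; apply: (measurableT_comp mg); exact: pair2_measurable.
- by move=> y; rewrite lee_fin mulr_ge0.
Qed.

(** Fubini for a tensor kernel. It shows that the space-time regularisation is a time average of the
    spatial one, so removing it at fixed [l] is only a statement about [mollt]. *)
Lemma convol_tens th kap g (Mt Mk : R) z : mu.-integrable setT (EFin \o g) ->
  measurable_fun [set: measurableTypeR R] th -> (forall x, `|th x| <= Mt) ->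
  measurable_fun setT kap -> (forall x, `|kap x| <= Mk) ->
  convol (tensor th kap) g z = mollt th (mollx kap g) z.
Proof.
move=> ig mth bth mk bk.
have mkz : measurable_fun [set: mX] (fun w => th (z.1 - w.1) * kap (z.2 - w.2)).
  apply: measurable_funM.
    by apply: (measurableT_comp mth); apply: measurable_funB => //; exact: measurable_fst.
  by apply: (measurableT_comp mk); apply: measurable_rVB => //; exact: measurable_snd.
have iF : mu.-integrable setT (EFin \o (fun w => g w * (th (z.1 - w.1) * kap (z.2 - w.2)))).
  apply: (@L1_bounded _ _ _ _ _ _ _ _ (Mt * Mk)) => // w _.
  by rewrite normrM ler_pM.
rewrite /convol /tensor /mollt /Rintegral; congr fine.
rewrite -(integral12_prod_meas1 iF).
apply: ae_eq_integral => //.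
- exact: measurable_fubini_F iF.
- apply/measurable_EFinP; apply: measurable_funM; last first.
    by apply: (measurableT_comp mth); exact: measurable_funB.
  have := measurable_mollx (L1_measurable ig) mk.
  by move=> /measurableT_comp; apply; exact: pair2_measurable.
- have [N [mN N0 sub]] := ae_section_rV ig; exists N; split => // s ns.
  apply: sub => igs; apply: ns => _ /=.
  have iK : (lebesgue_rV n).-integrable setT (EFin \o (fun y => g (s, y) * kap (z.2 - y))).
    apply: (@L1_bounded _ _ _ _ _ _ _ _ Mk) => //.
    by apply: (measurableT_comp mk); exact: measurable_rVB.
  rewrite /mollx mulrC EFinM EFin_Rintegral// -integralZl//.
  by apply: eq_integral => y _ /=; rewrite -EFinM; congr EFin; ring.
Qed.

End operators.

Lemma continuous_subl (R : realType) (V : normedModType R) (x : V) :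
  continuous (fun y => x - y).
Proof. by move=> y; apply: cvgB; [exact: cvg_cst|exact: cvg_id]. Qed.

Section derive_operators.
Context {R : realType} {n : nat}.
Local Notation E := 'rV[R]_n.
Local Notation X := (R * E)%type.
Local Notation mX := (measurableTypeR R * 'rV[R]_n)%type.
Local Notation mu := (lebesgue_tx R n).
Implicit Types (g : X -> R) (kap : E -> R) (th : R -> R) (k : X -> R).

Lemma measurable_convol_kernel k (z : X) : continuous k ->
  measurable_fun [set: mX] (fun w => k (z - w)).
Proof.
move=> ck; apply: continuous_measurable_tx => w.
by apply: continuous_comp; [exact: continuous_subl|exact: ck].
Qed.

Lemma measurable_mollx_kernel kap (x : E) : continuous kap ->
  measurable_fun setT (fun y : E => kap (x - y)).
Proof.
move=> ck; apply: continuous_measurable_rV => w.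
by apply: continuous_comp; [exact: continuous_subl|exact: ck].
Qed.

Let shiftL (V : normedModType R) (w : V) : forall x v (h : R), (h *: v + x) - w = h *: v + (x - w).
Proof. by move=> x v h; rewrite addrA. Qed.

Lemma convol_derive k g z v (M : R) : mu.-integrable setT (EFin \o g) -> smooth k ->
  (forall w, `|k w| <= M) -> (forall w, `|'D_v k w| <= M) ->
  derivable (convol k g) z v /\ 'D_v (convol k g) z = convol ('D_v k) g z.
Proof.
move=> ig sk bk bdk.
have dk w y : 'D_v (fun z => k (z - w)) y = 'D_v k (y - w).
  exact: (derive_affine (shiftL w)).
have := @derive_under_integral R X _ mX mu (fun z w => k (z - w)) g v M ig.
move=> /(_ _ _ _ _ z)/wrap[].
- by move=> y; apply: measurable_convol_kernel; exact: smooth_continuous.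
- by move=> y w; rewrite (derivable_affineE (shiftL w)); exact: smooth_derivable.
- by move=> y w; exact: bk.
- by move=> y w; rewrite dk.
move=> [D E0]; split; first exact: D.
apply: etrans E0 _.
by apply: eq_Rintegral => w _; rewrite dk.
Qed.

(** Integrability is asked of the section at the given time, so the derivative is known for almost
    every time only. *)
Lemma mollx_derive kap g t x (v : E) (M : R) :
  (lebesgue_rV n).-integrable setT (EFin \o (fun y => g (t, y))) -> smooth kap ->
  (forall w, `|kap w| <= M) -> (forall w, `|'D_v kap w| <= M) ->
  derivable (mollx kap g) (t, x) (0, v) /\
  'D_((0, v) : X) (mollx kap g) (t, x) = mollx ('D_v kap) g (t, x).
Proof.
move=> ig sk bk bdk.
have dk w y : 'D_v (fun z => kap (z - w)) y = 'D_v kap (y - w).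
  exact: (derive_affine (shiftL w)).
have := @derive_under_integral R E _ E (lebesgue_rV n) (fun z w => kap (z - w)) (fun y => g (t, y)) v M ig.
move=> /(_ _ _ _ _ x)/wrap[].
- by move=> y; apply: measurable_mollx_kernel; exact: smooth_continuous.
- by move=> y w; rewrite (derivable_affineE (shiftL w)); exact: smooth_derivable.
- by move=> y w; exact: bk.
- by move=> y w; rewrite dk.
have L (y w : E) (h : R) : (t, h *: w + y) = h *: ((0, w) : X) + (t, y).
  by congr pair; rewrite /= scaler0 add0r.
move=> [D E0]; split.
  by rewrite -(derivable_affineE L).
rewrite -(derive_affine L); apply: etrans E0 _.
by apply: eq_Rintegral => w _; rewrite dk.
Qed.

Lemma smooth_fst th : smooth th -> smooth (fun z : X => th z.1).
Proof.
apply: (@smooth_affine R X R fst fst) => // z.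
exact: cvg_fst.
Qed.

Lemma smooth_snd kap : smooth kap -> smooth (fun z : X => kap z.2).
Proof.
apply: (@smooth_affine R X E snd snd) => // z.
exact: cvg_snd.
Qed.

Lemma smooth_tensor th kap : smooth th -> smooth kap -> smooth (tensor th kap : X -> R).
Proof. by move=> sth sk; apply: smoothM; [exact: smooth_fst|exact: smooth_snd]. Qed.

Lemma derive_tensor th kap z (v : X) : smooth th -> smooth kap ->
  'D_v (tensor th kap : X -> R) z = th z.1 * 'D_v.2 kap z.2 + kap z.2 * 'D_v.1 th z.1.
Proof.
move=> sth sk; rewrite [LHS](@deriveM _ _ (fun z : X => th z.1) (fun z : X => kap z.2));
  [|exact/smooth_derivable/smooth_fst|exact/smooth_derivable/smooth_snd].
by congr (_ * _ + _ * _).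
Qed.

Lemma derive_tensor_x th kap (v : E) : smooth th -> smooth kap ->
  'D_((0, v) : X) (tensor th kap : X -> R) = tensor th ('D_v kap).
Proof.
by move=> sth sk; apply/funext => z; rewrite derive_tensor//= derive0 mulr0 addr0.
Qed.

End derive_operators.

(** * Dominated convergence and integration by parts *)

Section fast.
Context d (T : measurableType d) (R : realType) (mu : {measure set T -> \bar R}) (D : set T).
Hypothesis mD : measurable D.

Lemma L1_ae_le (f g : T -> R) : measurable_fun D f ->
  {ae mu, forall x, D x -> `|f x| <= g x} ->
  mu.-integrable D (EFin \o g) -> mu.-integrable D (EFin \o f).
Proof.
move=> mf fg ig; have mg : measurable_fun D g by exact: L1_measurable ig.
apply/integrableP; split; first exact/measurable_EFinP.
case/integrableP : ig => _; apply: le_lt_trans.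
apply: ae_ge0_le_integral => //.
- by apply: measurableT_comp => //; exact/measurable_EFinP.
- by apply: measurableT_comp => //; exact/measurable_EFinP.
move: fg; apply: filterS => x fgx Dx; rewrite /= lee_fin.
by rewrite (le_trans (fgx Dx))// ler_norm.
Qed.

Lemma L1_indic (B : set T) : measurable B -> (mu B < +oo)%E ->
  mu.-integrable D (EFin \o \1_B).
Proof.
move=> mB fB; apply/integrableP; split; first exact/measurable_EFinP.
rewrite (eq_integral (EFin \o \1_B)); last by move=> x _; rewrite /= ger0_norm.
rewrite integral_indic//; apply: le_lt_trans fB.
by apply: le_measure; rewrite ?inE//; exact: measurableI.
Qed.

Lemma Rdominated_convergence (f : nat -> T -> R) (f0 g : T -> R) :
  (forall k, measurable_fun D (f k)) -> measurable_fun D f0 ->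
  {ae mu, forall x, D x -> f k x @[k --> \oo] --> f0 x} ->
  mu.-integrable D (EFin \o g) ->
  {ae mu, forall x, D x -> forall k, `|f k x| <= g x} ->
  mu.-integrable D (EFin \o f0) /\
  \int[mu]_(x in D) f k x @[k --> \oo] --> \int[mu]_(x in D) f0 x.
Proof.
move=> mf mf0 ff0 ig fg.
have [| | | | |I0 _ C0] := @dominated_convergence _ _ _ mu D mD (fun k => EFin \o f k)
   (EFin \o f0) (EFin \o g).
- by move=> k; exact/measurable_EFinP.
- exact/measurable_EFinP.
- move: ff0 => [N [mN N0 sub]]; exists N; split => // x nx; apply: sub => h; apply: nx => Dx.
  by apply: cvg_EFin; [exact: nearW|exact: h].
- by [].
- move: fg => [N [mN N0 sub]]; exists N; split => // x nx; apply: sub => h; apply: nx => k Dx.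
  by rewrite /= lee_fin; exact: h.
split => //; rewrite /Rintegral; apply: fine_cvg.
by rewrite fineK//; exact: integrable_fin_num.
Qed.

(** The sum of the sequence has finite integral, hence is finite almost everywhere. It dominates
    every term, and the terms of a convergent series tend to 0. *)
Lemma L1_fast_cvg (s : nat -> T -> R) :
  (forall k, measurable_fun D (s k)) -> (forall k x, 0 <= s k x) ->
  (forall k, (\int[mu]_(x in D) (s k x)%:E <= (1 / (2 ^ k.+1)%:R)%:E)%E) ->
  exists S : T -> R, mu.-integrable D (EFin \o S) /\
    {ae mu, forall x, D x -> (forall k, s k x <= S x) /\ s k x @[k --> \oo] --> 0}.
Proof.
move=> ms s0 sk.
pose S x := (\sum_(k <oo) (s k x)%:E)%E.
have s0E k x : (0 <= (s k x)%:E)%E by rewrite lee_fin.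
have S0 x : (0 <= S x)%E by apply: nneseries_ge0.
have mS : measurable_fun D S.
  by apply: ge0_emeasurable_sum => // k _; exact/measurable_EFinP.
have iS : mu.-integrable D S.
  apply/integrableP; split => //.
  under eq_integral do rewrite gee0_abs//.
  rewrite integral_nneseries//; last by move=> k; exact/measurable_EFinP.
  apply: (@le_lt_trans _ _ 1%:E); last by rewrite ltry.
  (* The bounds 1/2^(k+1) add up to at most 1. *)
  apply: le_trans (epsilon_trick0 xpredT ler01).
  by apply: lee_nneseries => [k _ _|k _]; [exact: integral_ge0|exact: sk].
have [N [mN N0 sub]] := integrable_ae mD iS.
exists (fine \o S); split.
  apply/integrableP; split.
    by apply/measurable_EFinP; apply: measurableT_comp.
  case/integrableP : iS => _; apply: le_lt_trans.
  apply: ge0_le_integral => //.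
  - by apply: measurableT_comp => //; apply/measurable_EFinP; apply: measurableT_comp.
  - exact: measurableT_comp.
  - by move=> x _; rewrite /= gee0_abs//; case: (S x) (S0 x) => [r r0|_|//] /=; [rewrite ger0_norm|rewrite normr0 leey].
exists N; split => // x nx; apply: sub => /= h; apply: nx => Dx.
have Sf := h Dx.
have pS n : \sum_(0 <= k < n) s k x <= fine (S x).
  rewrite -lee_fin fineK// -sumEFin; exact: nneseries_lim_ge.
split=> [k|].
  apply: le_trans (pS k.+1); rewrite big_nat_recr//= lerDr; exact: sumr_ge0.
apply: cvg_series_cvg_0; apply: nondecreasing_is_cvgn.
  by apply/nondecreasing_seqP => k; rewrite /series/= big_nat_recr//= lerDl.
by exists (fine (S x)) => _ [k _ <-]; exact: pS.
Qed.

(* The L1 errors are summable, so Y n converges almost everywhere and Y n i0 has an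
   integrable majorant; this avoids uniform integrability arguments. *)
Lemma fast_dominated_cvg (I : finType) (Y : nat -> I -> T -> R) (Y0 : I -> T -> R)
    (F : nat -> T -> R) (F0 : T -> R) (i0 : I) (C : R) :
  (mu D < +oo)%E ->
  (forall n i, measurable_fun D (Y n i)) -> (forall i, mu.-integrable D (EFin \o Y0 i)) ->
  (forall n i, (\int[mu]_(x in D) `|(Y n i x - Y0 i x)%:E| <= (1 / (2 ^ n.+1)%:R)%:E)%E) ->
  (forall n, measurable_fun D (F n)) -> measurable_fun D F0 ->
  {ae mu, forall x, D x -> (forall i, Y n i x @[n --> \oo] --> Y0 i x) ->
     F n x @[n --> \oo] --> F0 x} ->
  {ae mu, forall x, D x -> forall n, `|F n x| <= C * (1 + Y n i0 x)} -> 0 <= C ->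
  [/\ mu.-integrable D (EFin \o F0), (forall n, mu.-integrable D (EFin \o F n)) &
   \int[mu]_(x in D) F n x @[n --> \oo] --> \int[mu]_(x in D) F0 x].
Proof.
move=> fD mY iY YY0 mF mF0 FF0 FY C0.
have mY0 i : measurable_fun D (Y0 i) by exact: L1_measurable (iY i).
have mYY n i : measurable_fun D (fun x => `|Y n i x - Y0 i x|).
  by apply: measurableT_comp => //; exact: measurable_funB.
have H i := L1_fast_cvg (fun n => mYY n i) (fun n x => normr_ge0 _) (fun n => YY0 n i).
have {H} /choice[S HS] : forall i, exists S : T -> R, mu.-integrable D (EFin \o S) /\
    {ae mu, forall x, D x -> (forall k, `|Y k i x - Y0 i x| <= S x) /\
       `|Y k i x - Y0 i x| @[k --> \oo] --> 0} by move=> i; exact: H.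
pose G x := C * (1 + (Y0 i0 x + S i0 x)).
have iG : mu.-integrable D (EFin \o G).
  apply: L1Z => //; apply: L1D => //; first exact: L1_cst.
  by apply: L1D => //; exact: (HS i0).1.
have aeY : {ae mu, forall x, forall i, D x -> (forall k, `|Y k i x - Y0 i x| <= S i x) /\
       `|Y k i x - Y0 i x| @[k --> \oo] --> 0}.
  by apply: filter_forall => i; exact: (HS i).2.
have FG : {ae mu, forall x, D x -> forall n, `|F n x| <= G x}.
  move: FY aeY; apply: filterS2 => x FYx Yx Dx n.
  apply: le_trans (FYx Dx n) _; rewrite ler_wpM2l// lerD2l -lerBlDl.
  by apply: le_trans ((Yx i0 Dx).1 n); exact: ler_norm.
have FF : {ae mu, forall x, D x -> F n x @[n --> \oo] --> F0 x}.
  move: FF0 aeY; apply: filterS2 => x FFx Yx Dx.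
  by apply: FFx => // i; apply/subr_cvg0/norm_cvg0P; exact: (Yx i Dx).2.
have [I0 Cv] := Rdominated_convergence mF mF0 FF iG FG.
split => // n; apply: L1_ae_le iG => //.
by move: FG; apply: filterS => x FGx Dx; exact: FGx.
Qed.

End fast.

Section integration_by_parts.
Context {R : realType} {n : nat}.
Local Notation E := 'rV[R]_n.
Local Notation X := (R * E)%type.
Local Notation mX := (measurableTypeR R * 'rV[R]_n)%type.
Local Notation mu := (lebesgue_tx R n).

Lemma line_lipschitz (V : normedModType R) (psi : V -> R) (z v : V) (C h : R) :
  (forall z, derivable psi z v) -> (forall z, `|'D_v psi z| <= C) -> 0 < h ->
  `|psi (h *: v + z) - psi z| <= C * h.
Proof.
move=> dpsi bpsi h0.
pose f (s : R) := psi (s *: v + z).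
have df (s : R) : is_derive s 1 f ('D_v psi (s *: v + z)).
  apply: DeriveDef; last by rewrite derive_line.
  by rewrite derivable_line.
have cf : {within `[0, h], continuous f}.
  apply: continuous_subspaceT => s; apply: differentiable_continuous.
  by apply/derivable1_diffP; case: (df s).
have [c _] := MVT h0 (fun x _ => df x) cf.
rewrite /f scale0r add0r subr0 => ->.
by rewrite normrM (gtr0_norm h0) ler_wpM2r// ltW.
Qed.

Lemma Rintegral_tx_shift (f : X -> R) w : mu.-integrable setT (EFin \o f) ->
  \int[mu]_z f (z + w) = \int[mu]_z f z.
Proof.
move=> If; have mf : measurable_fun [set: mX] f by exact: L1_measurable If.
rewrite /Rintegral; congr fine; rewrite integralE [RHS]integralE.
rewrite -(ge0_integral_tx_shift w (f := (EFin \o f)^\+)%E)//; last first.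
  by apply: measurable_funepos; exact/measurable_EFinP.
rewrite -(ge0_integral_tx_shift w (f := (EFin \o f)^\-)%E)//; last first.
  by apply: measurable_funeneg; exact/measurable_EFinP.
by congr (_ - _)%E; apply: eq_integral => z _; rewrite ?funeposE ?funenegE.
Qed.

Lemma integrable_tx_shift (f : X -> R) w : mu.-integrable setT (EFin \o f) ->
  mu.-integrable setT (EFin \o (fun z => f (z + w))).
Proof.
move=> If; have mf : measurable_fun [set: mX] f by exact: L1_measurable If.
apply/integrableP; split.
  by apply/measurable_EFinP; apply: (measurableT_comp mf); exact: measurable_tx_shift.
rewrite (ge0_integral_tx_shift w (f := fun z => `|(f z)%:E|%E))//.
  by case/integrableP : If.
by apply: measurableT_comp => //; exact/measurable_EFinP.
Qed.

(** Difference quotients have integral 0 by translation invariance, and they converge to the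
    derivative boundedly on a bounded set. *)
Lemma integral_derive0 (psi : X -> R) (v : X) (K : set X) (C : R) :
  mu.-integrable setT (EFin \o psi) ->
  (forall z, derivable psi z v) -> (forall z, `|'D_v psi z| <= C) ->
  compact K -> (forall z, ~ K z -> psi z = 0) ->
  mu.-integrable setT (EFin \o 'D_v psi) /\ \int[mu]_z 'D_v psi z = 0.
Proof.
move=> Ipsi dpsi bpsi cK psi0.
have mpsi : measurable_fun [set: mX] psi by exact: L1_measurable Ipsi.
pose h k : R := k.+1%:R^-1.
have h0 k : 0 < h k by rewrite invr_gt0.
have h1 k : h k <= 1 by rewrite invf_le1// ler1n.
pose q k z := (h k)^-1 * (psi (h k *: v + z) - psi z).
have [M [_ hM]] := compact_bounded cK.
pose M1 := `|M| + 1.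
have KM z : K z -> `|z| <= M1 by move=> Kz; apply: hM => //; rewrite (le_lt_trans (ler_norm _))// ltrDl.
(* The steps [h k] are at most 1, so a point that enters [K] after the shift is within the norm of
   [v] of it. *)
pose B := [set z : mX | `|z.1| <= M1 + `|v| /\ `|z.2| <= M1 + `|v|].
have mB : measurable B by apply: closed_measurable_tx; exact: closed_tx_box.
have C0 : 0 <= C by rewrite (le_trans _ (bpsi 0)).
have mq k : measurable_fun [set: mX] (q k).
  apply: measurable_funM => //; apply: measurable_funB => //.
  by under eq_fun do rewrite addrC; apply: (measurableT_comp mpsi); exact: measurable_tx_shift.
have q_cvg z : q k z @[k --> \oo] --> 'D_v psi z.
  have /cvgr_dnbhsP := dpsi z.
  move=> /(_ h); apply; split; first by move=> k; rewrite gt_eqF.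
  exact: cvg_harmonic.
have qB k z : `|q k z| <= C * \1_B z.
  rewrite indicE; have [zB|zB] := boolP (z \in B).
    rewrite mulr1 /q normrM gtr0_norm ?invr_gt0// mulrC ler_pdivrMr//.
    exact: line_lipschitz.
  rewrite mulr0 /q !psi0 ?subrr ?mulr0 ?normr0//.
    move=> /KM zM; move/negP : zB; apply; rewrite inE/B/=; split.
      by rewrite (le_trans (norm_tx_fst _))// (le_trans zM)// lerDl.
    by rewrite (le_trans (norm_tx_snd _))// (le_trans zM)// lerDl.
  move=> /KM zM; move/negP : zB; apply; rewrite inE/B/=.
  have zle : `|z| <= M1 + `|v|.
    rewrite -[z](addKr (h k *: v)) (le_trans (ler_normD _ _))// addrC lerD//.
    by rewrite normrN normrZ gtr0_norm// ler_piMl.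
  by split; apply: le_trans zle; [exact: norm_tx_fst|exact: norm_tx_snd].
have [|||||ID Cv] := @Rdominated_convergence _ _ _ mu setT measurableT q ('D_v psi) (fun z => C * \1_B z).
- exact: mq.
- by apply: (measurable_fun_cvg mq) => z _; exact: q_cvg.
- by apply: nearW => z _; exact: q_cvg.
- apply: L1Z => //; apply: L1_indic => //.
  by apply: lebesgue_tx_box_fin; rewrite addr_ge0// addr_ge0.
- by apply: nearW => z _ k; exact: qB.
have Ish k : mu.-integrable setT (EFin \o (fun z => psi (h k *: v + z))).
  rewrite (_ : (fun _ => _) = (fun z => psi (z + h k *: v))); first exact: integrable_tx_shift.
  by apply/funext => z; rewrite addrC.
have q0 k : \int[mu]_z q k z = 0.
  rewrite RintegralZl//; last by apply: L1B.
  rewrite RintegralB//.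
  under [X in X - _]eq_Rintegral do rewrite addrC.
  by rewrite Rintegral_tx_shift// subrr mulr0.
split; first exact: ID.
move: Cv; under eq_fun do rewrite q0.
by move=> /cvg_lim <- //; rewrite lim_cst.
Qed.

End integration_by_parts.

(** * Internal energy and the energy flux *)

Section energy.
Context {R : realType} (p : R -> R).
Hypothesis cp : continuous p.
Notation leb := (@lebesgue_measure R).
Let f (s : R) : R := p s / s ^+ 2.

Let cf (s : R) : 0 < s -> {for s, continuous f}.
Proof.
move=> s0; apply: cvgM; first exact: cp.
by apply: cvgV; [rewrite expf_neq0// gt_eqF|exact: exprn_continuous].
Qed.

Let integrable_f (a b : R) : 0 < a -> leb.-integrable `[a, b] (EFin \o f).
Proof.
move=> a0; apply: continuous_compact_integrable; first exact: segment_compact.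
apply: continuous_in_subspaceT => s; rewrite inE/= in_itv/= => /andP[as' _].
by apply: cf; exact: lt_le_trans as'.
Qed.

(** A base point below both 1 and [r] merges the two cases of the definition into one formula, to
    which the fundamental theorem of calculus applies. *)
Let internal_energyE (a r : R) : 0 < a -> a < 1 -> a < r ->
  internal_energy p r =
  r * (\int[leb]_(s in `[a, r]) f s - \int[leb]_(s in `[a, 1]) f s).
Proof.
move=> a0 a1 ar; rewrite /internal_energy (lt_trans a0 ar); congr (_ * _).
have E (x y : R) : a < x -> x <= y ->
    \int[leb]_(s in `[x, y]) f s = \int[leb]_(s in `[a, y]) f s - \int[leb]_(s in `[a, x]) f s.
  move=> ax xy; rewrite (@Rintegral_itvB _ f (BLeft a) (BRight y) x); last 3 first.
  - exact: integrable_f.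
  - by rewrite bnd_simp ltW.
  - by rewrite bnd_simp.
  rewrite Rintegral_itv_obnd_cbnd//.
  apply: integrableS (integrable_f y (lt_trans a0 ax)) => //.
  by apply: subset_itvr; rewrite bnd_simp.
case: leP => r1; first exact: E.
by rewrite -[RHS]opprB -(E _ _ ar (ltW r1)).
Qed.

(** The product rule for r times a primitive of p(s)/s^2: the primitive itself is P/r, and its
    derivative contributes p/r. *)
Lemma is_derive_internal_energy (r : R) : 0 < r ->
  is_derive r 1 (internal_energy p) ((internal_energy p r + p r) / r).
Proof.
move=> r0; pose a := Num.min r 1 / 2.
have m0 : 0 < Num.min r 1 by rewrite lt_min r0/=.
have a0 : 0 < a by rewrite divr_gt0.
have am : a < Num.min r 1 by rewrite ltr_pdivrMr// ltr_pMr// ltr1n.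
have ar : a < r by rewrite (lt_le_trans am)// ge_min lexx.
have a1 : a < 1 by rewrite (lt_le_trans am)// ge_min lexx orbT.
pose F (x : R) : R := \int[leb]_(s in `[a, x]) f s.
have [dF F'] := @continuous_FTC1_closed _ f a r (r + 1) (ltr_pwDr ltr01 (lexx r)) (integrable_f _ a0) ar (cf r0).
have iF : is_derive r 1 F (f r).
  by apply: DeriveDef; [exact: dF|rewrite -derive1E].
apply: (@near_eq_is_derive R R^o R^o (fun x : R^o => x * (F x - F 1) : R^o) (internal_energy p : R^o -> R^o) (r : R^o) (1 : R^o) _ _ _).
  near=> x; rewrite (internal_energyE a0 a1)//; near: x; exact: lt_nbhsr.
apply: is_derive_eq.
rewrite (internal_energyE a0 a1)// -/(F r) -/(F 1) /f subr0.
rewrite /GRing.scale/=; field; exact: lt0r_neq0.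
Unshelve. all: by end_near. Qed.

Lemma continuous_internal_energy (r : R) : 0 < r -> {for r, continuous (internal_energy p)}.
Proof.
move=> r0; apply: differentiable_continuous; apply/derivable1_diffP.
by case: (is_derive_internal_energy r0).
Qed.

Lemma measurable_internal_energy : measurable_fun [set: measurableTypeR R] (internal_energy p).
Proof.
rewrite (_ : [set: _] = `]0, +oo[%classic `|` `]-oo, 0]%classic); last first.
  by apply/seteqP; split => // s _; have [s0|s0] := ltP 0 s; [left|right]; rewrite /= in_itv/= ?andbT.
apply/measurable_funU; [exact: measurable_itv|exact: measurable_itv|split].
  apply: open_continuous_measurable_fun; first exact: interval_open.
  by move=> s; rewrite inE/= in_itv/= andbT => s0; exact: continuous_internal_energy.
apply: (@eq_measurable_fun _ _ (measurableTypeR R) (measurableTypeR R) _ (cst 0)); last exact: measurable_cst.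
move=> s; rewrite inE/= in_itv/= => s0.
by rewrite /internal_energy ltNge s0.
Qed.

End energy.

Section chain.
Context {R : realType} {V : normedModType R}.

(** Chain rule for a single direction; restricting to the line makes full differentiability of [f]
    unnecessary. *)
Lemma is_derive_comp_line (P : R -> R) (f : V -> R) z v (dP df : R) :
  is_derive (f z) 1 P dP -> is_derive z v f df -> is_derive z v (P \o f) (dP * df).
Proof.
move=> hP [df1 df2].
have E0 : (0 : R) *: v + z = z by rewrite scale0r add0r.
have hf : is_derive (0 : R) 1 (fun h => f (h *: v + z)) df.
  by apply: DeriveDef; [rewrite derivable_line E0|rewrite derive_line E0].
have hP' : is_derive ((fun h : R => f (h *: v + z)) 0) 1 P dP by rewrite E0.
have [d1 d2] := is_derive1_comp hP' hf.
apply: DeriveDef.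
  by have := derivable_line z v (P \o f) 0; rewrite E0 => <-.
by have := derive_line z v (P \o f) 0; rewrite E0 => <-.
Qed.

End chain.

Section functionals.
Context {R : realType} {d : nat} (p : R -> R).
Implicit Types (r q : R) (m F rx : 'I_d -> R) (M mx : 'I_d -> 'I_d -> R).

Definition ener r m : R := (\sum_i m i ^+ 2) / (2 * r) + internal_energy p r.

(* With r, m, M, q, F the regularised density, momentum, rho u (x) u, pressure and rho f,
   and v = m / r the Favre velocity, energy_flux is the energy balance tested with ph plus
   the commutator stress (m (x) m / r - M) acting on v, and stress_work is J1 + J2.
   At the solution itself the stress vanishes and energy_flux integrates to the defect. *)
Definition energy_flux r m M q F (ph pht : R) (phx : 'I_d -> R) : R :=
  ener r m * pht + \sum_j m j / r * (ener r m + q) * phx j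
  - \sum_i \sum_j (m i * m j / r - M i j) * (m i / r) * phx j
  + (\sum_i m i / r * F i) * ph.

(** The quotient rule: derivative in direction [j] of component [i] of m / r, when [mx i j] and
    [rx j] are the derivatives of [m i] and [r]. *)
Definition gradv r m rx mx i j : R := (mx i j - m i / r * rx j) / r.

Definition stress_work r m M q rx mx : R :=
  \sum_i \sum_j (m i * m j / r - M i j) * gradv r m rx mx i j
  + (\sum_j gradv r m rx mx j j) * (p r - q).

End functionals.

Section tools.
Context {R : realType}.

Lemma cvg_sum_fin (T : Type) (F : set_system T) {FF : Filter F} (I : Type) (s : seq I)
    (f : I -> T -> R) (l : I -> R) :
  (forall i, f i x @[x --> F] --> l i) ->
  \sum_(i <- s) f i x @[x --> F] --> \sum_(i <- s) l i.
Proof.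
move=> fl; elim: s => [|i s IH].
  by under eq_fun do rewrite big_nil; rewrite big_nil; exact: cvg_cst.
by under eq_fun do rewrite big_cons; rewrite big_cons; exact: cvgD (fl i) IH.
Qed.

Lemma measurable_invr : measurable_fun [set: measurableTypeR R] (@GRing.inv R).
Proof.
rewrite (_ : [set: _] = [set x : measurableTypeR R | x != 0] `|` [set 0]); last first.
  by apply/seteqP; split => // x _ /=; have [->|] := eqVneq x 0; [right|left].
have oN : open [set x : R | x != 0] by exact: open_neq.
apply/measurable_funU; [exact: open_measurable|exact: measurable_set1|split].
  by apply: open_continuous_measurable_fun => // x; rewrite inE => x0; exact: inv_continuous.
apply: (@eq_measurable_fun _ _ (measurableTypeR R) (measurableTypeR R) _ (cst 0)).
  by move=> x; rewrite inE => ->; rewrite invr0.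
exact: measurable_cst.
Qed.

End tools.

(** * Domination up to a constant, and estimates of the energy functionals *)

Section bound.
Context {R : realType} {T : Type} (P : T -> Prop).
Implicit Types f g : T -> R.

(** The constant is uniform in [t]. Since [T] may contain the regularisation parameter besides the
    point, this gives bounds uniform in that parameter. *)
Definition dominated f g := exists2 C, 0 <= C & forall t, P t -> `|f t| <= C * g t.

Lemma dominatedD f1 f2 g : dominated f1 g -> dominated f2 g ->
  dominated (fun t => f1 t + f2 t) g.
Proof.
move=> [C1 C10 h1] [C2 C20 h2]; exists (C1 + C2); first exact: addr_ge0.
by move=> t Pt; rewrite (le_trans (ler_normD _ _))// mulrDl lerD ?h1 ?h2.
Qed.

Lemma dominatedN f g : dominated f g -> dominated (fun t => - f t) g.
Proof. by move=> [C C0 h]; exists C => // t Pt; rewrite normrN h. Qed.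

Lemma dominatedB f1 f2 g : dominated f1 g -> dominated f2 g ->
  dominated (fun t => f1 t - f2 t) g.
Proof. by move=> h1 h2; apply: dominatedD => //; exact: dominatedN. Qed.

Lemma dominatedM f1 f2 g1 g2 : dominated f1 g1 -> dominated f2 g2 ->
  dominated (fun t => f1 t * f2 t) (fun t => g1 t * g2 t).
Proof.
move=> [C1 C10 h1] [C2 C20 h2]; exists (C1 * C2); first exact: mulr_ge0.
by move=> t Pt; rewrite normrM mulrACA ler_pM ?h1 ?h2.
Qed.

Lemma dominated_trans g f h : dominated f g -> dominated g h -> dominated f h.
Proof.
move=> [C1 C10 h1] [C2 C20 h2]; exists (C1 * C2); first exact: mulr_ge0.
move=> t Pt; rewrite (le_trans (h1 _ Pt))// -mulrA ler_wpM2l//.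
exact: le_trans (ler_norm _) (h2 _ Pt).
Qed.

Lemma dominated_le f g : (forall t, P t -> `|f t| <= g t) -> dominated f g.
Proof. by move=> fg; exists 1 => // t Pt; rewrite mul1r fg. Qed.

Lemma dominated_sum (I : Type) (s : seq I) (f : I -> T -> R) g :
  (forall t, P t -> 0 <= g t) ->
  (forall i, dominated (f i) g) -> dominated (fun t => \sum_(i <- s) f i t) g.
Proof.
move=> g0 fg; elim: s => [|i s IH].
  by exists 0 => // t Pt; rewrite big_nil normr0 mul0r.
by under [X in dominated X]eq_fun do rewrite big_cons; exact: dominatedD.
Qed.

End bound.

Section functionals.
Context {R : realType} {d : nat} (p : R -> R).
Hypothesis cp : continuous p.
Implicit Types (r q : R).

Section cvg.
Context (T : Type) (G : set_system T) {FG : Filter G}.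
Variables (r q : T -> R) (m F rx : T -> 'I_d -> R) (M mx : T -> 'I_d -> 'I_d -> R).
Variables (r0 q0 : R) (m0 F0 rx0 : 'I_d -> R) (M0 mx0 : 'I_d -> 'I_d -> R).
Hypotheses (rr : r t @[t --> G] --> r0) (qq : q t @[t --> G] --> q0).
Hypotheses (mm : forall i, m t i @[t --> G] --> m0 i)
  (ff : forall i, F t i @[t --> G] --> F0 i) (rxx : forall i, rx t i @[t --> G] --> rx0 i)
  (MM : forall i j, M t i j @[t --> G] --> M0 i j)
  (mxx : forall i j, mx t i j @[t --> G] --> mx0 i j).
Hypothesis r00 : 0 < r0.

Let invr_cvg : (r t)^-1 @[t --> G] --> r0^-1.
Proof. by apply: cvgV rr; rewrite gt_eqF. Qed.

Lemma ener_cvg : ener p (r t) (m t) @[t --> G] --> ener p r0 m0.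
Proof.
apply: cvgD; last exact: cvg_comp rr (continuous_internal_energy cp r00).
apply: cvgM; first by apply: cvg_sum_fin => i; under eq_fun do rewrite expr2; rewrite expr2; exact: cvgM.
by apply: cvgV; [rewrite mulf_neq0// gt_eqF|apply: cvgMr].
Qed.

Lemma energy_flux_cvg ph pht phx :
  energy_flux p (r t) (m t) (M t) (q t) (F t) ph pht phx @[t --> G] -->
  energy_flux p r0 m0 M0 q0 F0 ph pht phx.
Proof.
apply: cvgD; last first.
  by apply: cvgMl; apply: cvg_sum_fin => i; apply: cvgM => //; exact: cvgM.
apply: cvgB; [apply: cvgD|].
- by apply: cvgMl; exact: ener_cvg.
- apply: cvg_sum_fin => j; apply: cvgMl; apply: cvgM; first exact: cvgM.
  by apply: cvgD => //; exact: ener_cvg.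
- apply: cvg_sum_fin => i; apply: cvg_sum_fin => j; apply: cvgMl; apply: cvgM; last exact: cvgM.
  by apply: cvgB => //; apply: cvgM => //; exact: cvgM.
Qed.

Lemma gradv_cvg i j : gradv (r t) (m t) (rx t) (mx t) i j @[t --> G] --> gradv r0 m0 rx0 mx0 i j.
Proof. by apply: cvgM => //; apply: cvgB => //; apply: cvgM => //; exact: cvgM. Qed.

Lemma stress_work_cvg : stress_work p (r t) (m t) (M t) (q t) (rx t) (mx t) @[t --> G] -->
  stress_work p r0 m0 M0 q0 rx0 mx0.
Proof.
apply: cvgD.
  apply: cvg_sum_fin => i; apply: cvg_sum_fin => j; apply: cvgM; last exact: gradv_cvg.
  by apply: cvgB => //; apply: cvgM => //; exact: cvgM.
apply: cvgM; first by apply: cvg_sum_fin => j; exact: gradv_cvg.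
have pr : p (r t) @[t --> G] --> p r0 by apply: continuous_cvg => //; exact: cp.
exact: cvgB.
Qed.

End cvg.

Section measurability.
Context dT (T : measurableType dT) (D : set T).
Variables (r q : T -> R) (m F rx : T -> 'I_d -> R) (M mx : T -> 'I_d -> 'I_d -> R).
Hypotheses (mr : measurable_fun D r) (mq : measurable_fun D q)
  (mm : forall i, measurable_fun D (m ^~ i)) (mF : forall i, measurable_fun D (F ^~ i))
  (mrx : forall i, measurable_fun D (rx ^~ i))
  (mM : forall i j, measurable_fun D (fun t => M t i j))
  (mmx : forall i j, measurable_fun D (fun t => mx t i j)).

Let mV (f : T -> R) : measurable_fun D f -> measurable_fun D (fun t => (f t)^-1).
Proof. by move=> mf; apply: (measurableT_comp measurable_invr mf). Qed.

Lemma measurable_ener : measurable_fun D (fun t => ener p (r t) (m t)).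
Proof.
apply: measurable_funD; last exact: (measurableT_comp (measurable_internal_energy cp) mr).
apply: measurable_funM; first by apply: measurable_sum => i; exact: measurable_funX.
by apply: mV; exact: measurable_funM.
Qed.

Lemma measurable_energy_flux ph pht phx : measurable_fun D ph -> measurable_fun D pht ->
  (forall i : 'I_d, measurable_fun D (phx ^~ i)) ->
  measurable_fun D (fun t => energy_flux p (r t) (m t) (M t) (q t) (F t) (ph t) (pht t) (phx t)).
Proof.
move=> mph mpht mphx; have mrV := mV mr; have me := measurable_ener.
apply: measurable_funD; last first.
  apply: measurable_funM => //; apply: measurable_sum => i.
  by apply: measurable_funM => //; exact: measurable_funM.
apply: measurable_funB; [apply: measurable_funD|].
- exact: measurable_funM.
- apply: measurable_sum => j; apply: measurable_funM => //; apply: measurable_funM; first exact: measurable_funM.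
  exact: measurable_funD.
- apply: measurable_sum => i; apply: measurable_sum => j; apply: measurable_funM => //.
  apply: measurable_funM; last exact: measurable_funM.
  by apply: measurable_funB => //; apply: measurable_funM => //; exact: measurable_funM.
Qed.

Lemma measurable_stress_work :
  measurable_fun D (fun t => stress_work p (r t) (m t) (M t) (q t) (rx t) (mx t)).
Proof.
have mrV := mV mr.
have mg i j : measurable_fun D (fun t => gradv (r t) (m t) (rx t) (mx t) i j).
  by apply: measurable_funM => //; apply: measurable_funB => //; apply: measurable_funM => //; exact: measurable_funM.
apply: measurable_funD.
  apply: measurable_sum => i; apply: measurable_sum => j; apply: measurable_funM => //.
  by apply: measurable_funB => //; apply: measurable_funM => //; exact: measurable_funM.
apply: measurable_funM; first by apply: measurable_sum => j.
by apply: measurable_funB => //; apply: measurableT_comp mr => //; exact: continuous_measurable_fun.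
Qed.

End measurability.

Section bounds.
Context (T : Type) (P : T -> Prop).
Variables (r q : T -> R) (m F rx : T -> 'I_d -> R) (M mx : T -> 'I_d -> 'I_d -> R).
Variables (ph pht : T -> R) (phx : T -> 'I_d -> R) (A U B : T -> R) (c C : R).
Hypotheses (A0 : forall t, P t -> 0 <= A t) (U0 : forall t, P t -> 0 <= U t)
  (B0 : forall t, P t -> 0 <= B t) (c0 : 0 < c).
Local Notation dom := (dominated P).
Hypotheses (cr : forall t, P t -> c <= r t) (rC : forall t, P t -> r t <= C)
  (dq : dom q (cst 1)) (dm : forall i, dom (m ^~ i) A) (dF : forall i, dom (F ^~ i) B)
  (drx : forall i, dom (rx ^~ i) (cst 1)) (dM : forall i j, dom (fun t => M t i j) U)
  (dmx : forall i j, dom (fun t => mx t i j) A)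
  (dph : dom ph (cst 1)) (dpht : dom pht (cst 1)) (dphx : forall i, dom (phx ^~ i) (cst 1)).

(** [A], [U], [B] bound averages of |u|, |u|^2 and |f|. They are kept apart because an average of
    |u|^2 is not controlled by the square of the average of |u|. *)
Let Z t := (1 + A t) ^+ 3 + U t * A t + B t * A t.

Let dom_cont (h : R -> R) : {in `[c, C], continuous h} -> dom (h \o r) (cst 1).
Proof.
move=> ch; have /compact_bounded[N [_ hN]] : compact (h @` `[c, C]%classic).
  apply: continuous_compact; last exact: segment_compact.
  by apply: continuous_in_subspaceT => x; rewrite inE => xc; exact: ch.
exists (`|N| + 1); first by rewrite addr_ge0.
move=> t Pt; rewrite mulr1; apply: hN; first by rewrite (le_lt_trans (ler_norm _))// ltrDl.
by exists (r t) => //; rewrite /= in_itv/= cr// rC.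
Qed.

Let drV : dom (fun t => (r t)^-1) (cst 1).
Proof.
apply: (@dom_cont (@GRing.inv R)) => x; rewrite in_itv/= => /andP[cx _].
by apply: inv_continuous; rewrite gt_eqF// (lt_le_trans c0).
Qed.

Let domT (g f h : T -> R) : dom f g -> (forall t, P t -> 0 <= g t <= h t) -> dom f h.
Proof.
move=> fg gh; apply: dominated_trans fg _; apply: dominated_le => t Pt.
by have /andP[g0 ?] := gh _ Pt; rewrite ger0_norm.
Qed.

Let domM (g1 g2 f1 f2 h : T -> R) : dom f1 g1 -> dom f2 g2 ->
  (forall t, P t -> 0 <= g1 t * g2 t <= h t) -> dom (fun t => f1 t * f2 t) h.
Proof. by move=> h1 h2; apply: domT; exact: dominatedM. Qed.

Let D3 t : P t -> 0 <= A t /\ A t * (1 + A t) ^+ 2 <= (1 + A t) ^+ 3 /\ A t ^+ 3 <= (1 + A t) ^+ 3 /\ 1 <= (1 + A t) ^+ 3 /\ A t <= (1 + A t) ^+ 3 /\ (1 + A t) ^+ 2 <= (1 + A t) ^+ 3.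
Proof.
move=> /A0 a0; split=> //.
have h2 : 0 <= A t ^+ 2 by exact: exprn_ge0.
have h3 : 0 <= A t ^+ 3 by exact: exprn_ge0.
have -> : (1 + A t) ^+ 3 = 1 + 3 * A t + 3 * A t ^+ 2 + A t ^+ 3 by ring.
have -> : (1 + A t) ^+ 2 = 1 + 2 * A t + A t ^+ 2 by ring.
have -> : A t * (1 + 2 * A t + A t ^+ 2) = A t + 2 * A t ^+ 2 + A t ^+ 3 by ring.
lra.
Qed.

Let Z0 t : P t -> 0 <= Z t.
Proof.
move=> Pt; have a0 := A0 Pt.
by rewrite !addr_ge0 ?mulr_ge0 ?exprn_ge0 ?addr_ge0 ?U0 ?B0.
Qed.

Let leZ (x : R) t : P t -> x <= (1 + A t) ^+ 3 + U t * A t \/ x <= B t * A t -> x <= Z t.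
Proof.
move=> Pt; have [a0 [_ [_ [h _]]]] := D3 Pt.
have b := mulr_ge0 (B0 Pt) a0; have u := mulr_ge0 (U0 Pt) a0.
by case=> h'; rewrite /Z; lra.
Qed.

Let dv i : dom (fun t => m t i / r t) A.
Proof.
apply: (domM (g1 := A) (g2 := cst 1)) => // t /A0 ?.
by rewrite mulr1 lexx andbT.
Qed.

Let de : dom (fun t => ener p (r t) (m t)) (fun t => (1 + A t) ^+ 2).
Proof.
apply: dominatedD; last first.
  apply: (domT (g := cst 1)) => [|t /A0 a0].
    apply: (dom_cont (h := internal_energy p)) => x; rewrite in_itv/= => /andP[cx _].
    by apply: continuous_internal_energy => //; exact: lt_le_trans cx.
  by rewrite ler01/= expr2; nra.
apply: (domM (g1 := fun t => A t ^+ 2) (g2 := cst (1 * 1))).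
- apply: dominated_sum => [t /A0 a0|i]; first exact: exprn_ge0.
  under [X in dominated _ X]eq_fun do rewrite expr2.
  apply: (domM (dm i) (dm i)) => t /A0 a0.
  by rewrite expr2 lexx mulr_ge0.
- under [X in dominated _ X]eq_fun do rewrite invfM.
  apply: dominatedM => //; exists `|2^-1| => // t _; by rewrite mulr1.
- by move=> t /A0 a0; rewrite !mulr1 exprn_ge0//= !expr2; nra.
Qed.

Let dS i j : dom (fun t => m t i * m t j / r t - M t i j) (fun t => A t ^+ 2 + U t).
Proof.
apply: dominatedB.
  apply: (domM (g1 := fun t => A t * A t) (g2 := cst 1)) => //; first exact: dominatedM.
  move=> t Pt; have a0 := A0 Pt; have u0 := U0 Pt.
  by rewrite mulr1 mulr_ge0//= expr2; lra.
apply: (domT (dM i j)) => t Pt; rewrite U0//= lerDr; exact/exprn_ge0/A0.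
Qed.

Let dg i j : dom (fun t => gradv (r t) (m t) (rx t) (mx t) i j) A.
Proof.
apply: (domM (g1 := A) (g2 := cst 1)) => //; last first.
  by move=> t Pt; rewrite mulr1 A0/=.
apply: dominatedB => //; apply: (domM (dv i) (drx j)).
by move=> t Pt; rewrite mulr1 A0/=.
Qed.

Lemma energy_flux_dominated :
  dom (fun t => energy_flux p (r t) (m t) (M t) (q t) (F t) (ph t) (pht t) (phx t)) Z.
Proof.
apply: dominatedD; last first.
  apply: (domM (g1 := fun t => A t * B t) (g2 := cst 1)) => //.
    apply: dominated_sum => [t Pt|i]; first by rewrite mulr_ge0 ?A0 ?B0.
    exact: dominatedM.
  move=> t Pt; rewrite mulr1 mulr_ge0 ?A0 ?B0//=; apply: leZ => //.
  by right; rewrite mulrC.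
apply: dominatedB; [apply: dominatedD|].
- apply: (domM de dpht) => t Pt; have [a0 [_ [_ [_ [_ h]]]]] := D3 Pt.
  rewrite mulr1 exprn_ge0 ?addr_ge0//=; apply: leZ => //; left.
  by rewrite (le_trans h)// lerDl mulr_ge0// U0.
- apply: dominated_sum => // j.
  have h : dom (fun t => ener p (r t) (m t) + q t) (fun t => (1 + A t) ^+ 2).
    apply: dominatedD; first exact: de.
    by apply: (domT dq) => t /A0 a0; rewrite ler01/= expr2; nra.
  apply: (domM (dominatedM (dv j) h) (dphx j)) => t Pt; have [a0 [h' _]] := D3 Pt.
  rewrite mulr1 mulr_ge0 ?exprn_ge0 ?addr_ge0//=; apply: leZ => //; left.
  by rewrite (le_trans h')// lerDl mulr_ge0// U0.
- apply: dominated_sum => // i; apply: dominated_sum => // j.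
  apply: (domM (dominatedM (dS i j) (dv i)) (dphx j)) => t Pt; have [a0 [_ [h' _]]] := D3 Pt.
  have u0 := U0 Pt.
  rewrite mulr1 mulr_ge0 ?addr_ge0 ?exprn_ge0//=; apply: leZ => //; left.
  by rewrite mulrDl -exprSr lerD2r.
Qed.

Lemma stress_work_dominated :
  dom (fun t => stress_work p (r t) (m t) (M t) (q t) (rx t) (mx t) * ph t) Z.
Proof.
apply: (domM (g1 := Z) (g2 := cst 1)) => //; last by move=> t Pt; rewrite mulr1 Z0/=.
apply: dominatedD.
  apply: dominated_sum => // i; apply: dominated_sum => // j.
  apply: (domM (dS i j) (dg i j)) => t Pt; have [a0 [_ [h' _]]] := D3 Pt.
  have u0 := U0 Pt.
  rewrite mulr_ge0 ?addr_ge0 ?exprn_ge0//=; apply: leZ => //; left.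
  by rewrite mulrDl -exprSr lerD2r.
apply: (domM (g1 := A) (g2 := cst 1)) => //.
- by apply: dominated_sum.
- by apply: dominatedB => //; apply: (dom_cont (h := p)) => x _; exact: cp.
- move=> t Pt; have [a0 [_ [_ [_ [h' _]]]]] := D3 Pt.
  rewrite mulr1 a0/=; apply: leZ => //; left.
  by rewrite (le_trans h')// lerDl mulr_ge0// U0.
Qed.

End bounds.
End functionals.

(** * Energy balance for regular fields *)

Section pointwise_rules.
Context {R : realType} {V : normedModType R} (z w : V).
Implicit Types f g : V -> R.

Lemma is_derive_mul f g df dg : is_derive z w f df -> is_derive z w g dg ->
  is_derive z w (fun x => f x * g x) (df * g z + f z * dg).
Proof.
move=> hf hg; apply: (@is_derive_eq _ _ _ (f * g)).
by rewrite addrC [df * _]mulrC.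
Qed.

Lemma is_derive_add f g df dg : is_derive z w f df -> is_derive z w g dg ->
  is_derive z w (fun x => f x + g x) (df + dg).
Proof. by move=> hf hg; exact: (is_deriveD hf hg). Qed.

Lemma is_derive_sub f g df dg : is_derive z w f df -> is_derive z w g dg ->
  is_derive z w (fun x => f x - g x) (df - dg).
Proof. by move=> hf hg; exact: (is_deriveB hf hg). Qed.

Lemma is_derive_bigsum n (f : 'I_n -> V -> R) (df : 'I_n -> R) :
  (forall i, is_derive z w (f i) (df i)) ->
  is_derive z w (fun x => \sum_i f i x) (\sum_i df i).
Proof.
move=> hf; have := is_derive_sum hf.
by rewrite (_ : \sum_(i < n) f i = fun x => \sum_i f i x)//; apply/funext => x; rewrite fct_sumE.
Qed.

Lemma is_derive_inv f df : f z != 0 -> is_derive z w f df ->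
  is_derive z w (fun x => (f x)^-1) (- df / f z ^+ 2).
Proof.
move=> fz [h1 h2]; apply: DeriveDef; first exact: derivableV.
by rewrite deriveV// h2 /GRing.scale/= mulNr mulrC mulNr.
Qed.

End pointwise_rules.

Section identity.
Context {R : realType} {d : nat} (p : R -> R).
Hypothesis cp : continuous p.

Section one_direction.
Context {V : normedModType R} (z w : V).
Variables (r q : V -> R) (m : V -> 'I_d -> R) (M : V -> 'I_d -> 'I_d -> R).
Variables (r' q' : R) (m' : 'I_d -> R) (M' : 'I_d -> 'I_d -> R).
Hypotheses (rz : 0 < r z) (hr : is_derive z w r r') (hq : is_derive z w q q')
  (hm : forall i, is_derive z w (m ^~ i) (m' i))
  (hM : forall i j, is_derive z w (fun x => M x i j) (M' i j)).

Definition vel' i : R := (m' i - m z i / r z * r') / r z.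

(** Chain rule in conservative variables: m / r is the partial derivative of the energy in the
    momentum, and the bracket is the one in the density. *)
Definition ener' : R := \sum_i m z i / r z * m' i +
  ((internal_energy p (r z) + p (r z)) / r z - (\sum_i m z i ^+ 2) / (2 * r z ^+ 2)) * r'.

Lemma is_derive_vel i : is_derive z w (fun x => m x i / r x) (vel' i).
Proof.
have r0 : r z != 0 by rewrite gt_eqF.
apply: (is_derive_eq (is_derive_mul (hm i) (is_derive_inv r0 hr))).
by rewrite /vel'; field.
Qed.

Lemma is_derive_ener : is_derive z w (fun x => ener p (r x) (m x)) ener'.
Proof.
have r0 : r z != 0 by rewrite gt_eqF.
have r20 : 2 * r z != 0 by rewrite mulf_neq0.
have h1 := is_derive_bigsum (fun i => is_derive_mul (hm i) (hm i)).
have h2 := @is_derive_inv _ _ z w (fun x => 2 * r x) _ r20 (is_derive_mul (is_derive_cst (2 : R) z w) hr).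
apply: (is_derive_eq (is_derive_add (is_derive_mul h1 h2) (is_derive_comp_line (is_derive_internal_energy cp rz) hr))).
rewrite mul0r add0r /ener' mulrBl addrA [RHS]addrAC; congr (_ + _).
rewrite (_ : \sum_i (m' i * m z i + m z i * m' i) = 2 * \sum_i m z i * m' i); last first.
  by rewrite mulr_sumr; apply: eq_bigr => i _; ring.
rewrite (_ : \sum_i m z i / r z * m' i = (\sum_i m z i * m' i) / r z); last first.
  by rewrite mulr_suml; apply: eq_bigr => i _; field.
under [\sum_i m z i ^+ 2]eq_bigr do rewrite expr2.
by field.
Qed.

(** The complete field multiplying the space derivatives of the test function: the energy flux with
    pressure [q], minus the commutator stress applied to the velocity. *)
Definition flux x j : R := m x j / r x * (ener p (r x) (m x) + q x) -
  \sum_i (m x i * m x j / r x - M x i j) * (m x i / r x).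

Lemma is_derive_flux j : is_derive z w (flux ^~ j)
  (vel' j * (ener p (r z) (m z) + q z) + m z j / r z * (ener' + q') -
   \sum_i ((m' i * (m z j / r z) + m z i * vel' j - M' i j) * (m z i / r z) +
           (m z i * m z j / r z - M z i j) * vel' i)).
Proof.
apply: is_derive_sub; first by apply: is_derive_mul; [exact: is_derive_vel|apply: is_derive_add hq; exact: is_derive_ener].
apply: is_derive_bigsum => i; apply: is_derive_mul; last exact: is_derive_vel.
apply: is_derive_sub => //; under [X in is_derive _ _ X]eq_fun do rewrite -mulrA.
by apply: is_derive_mul => //; exact: is_derive_vel.
Qed.

End one_direction.

(* The factor of [r_t + div m] is the same in [e_t] and in the divergence of the flux, so
   the mass balance removes the pressure and internal energy terms. *)
Lemma energy_balance (r q : R) (m F : 'I_d -> R) (M : 'I_d -> 'I_d -> R)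
    (rt : R) (mt : 'I_d -> R) (rx qx : 'I_d -> R) (mx : 'I_d -> 'I_d -> R)
    (Mx : 'I_d -> 'I_d -> R) (ph pht : R) (phx : 'I_d -> R) : 0 < r ->
  rt + \sum_j mx j j = 0 ->
  (forall i, mt i + \sum_j Mx i j + qx i = F i) ->
  let v i := m i / r in
  let P := internal_energy p r in
  let A := (P + p r) / r - (\sum_i m i ^+ 2) / (2 * r ^+ 2) in
  let e := ener p r m in
  let e' mt rt := \sum_i v i * mt i + A * rt in
  let v' := gradv r m rx mx in
  let S i j := m i * m j / r - M i j in
  e' mt rt * ph + e * pht +
  \sum_j ((v' j j * (e + q) + v j * (e' (mx ^~ j) (rx j) + qx j) -
     \sum_i ((mx i j * v j + m i * v' j j - Mx i j) * v i + S i j * v' i j)) * ph +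
     (v j * (e + q) - \sum_i S i j * v i) * phx j) =
  energy_flux p r m M q F ph pht phx - stress_work p r m M q rx mx * ph.
Proof.
move=> r0 mass mom v P A e e' v' S.
have rn : r != 0 by rewrite gt_eqF.
(* Twice the kinetic energy. *)
pose E2 := \sum_i m i * v i.
have X j : v' j j * (e + q) + v j * (e' (mx ^~ j) (rx j) + qx j) -
     \sum_i ((mx i j * v j + m i * v' j j - Mx i j) * v i + S i j * v' i j) =
   v' j j * (e + q - E2) + A * (v j * rx j) + v j * qx j - \sum_i S i j * v' i j +
   \sum_i v i * Mx i j.
  rewrite (_ : \sum_i ((mx i j * v j + m i * v' j j - Mx i j) * v i + S i j * v' i j) =
    v j * (\sum_i v i * mx i j) + v' j j * E2 - \sum_i v i * Mx i j + \sum_i S i j * v' i j).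
    by rewrite /e'; ring.
  rewrite /E2 !mulr_sumr -sumrN -!big_split/=; apply: eq_bigr => i _; ring.
pose del := \sum_j v' j j; pose SS := \sum_i \sum_j S i j * v' i j.
pose Vr := \sum_j v j * rx j.
have X' : \sum_j (v' j j * (e + q) + v j * (e' (mx ^~ j) (rx j) + qx j) -
     \sum_i ((mx i j * v j + m i * v' j j - Mx i j) * v i + S i j * v' i j)) =
   del * (e + q - E2) + A * Vr + \sum_j v j * qx j - SS + \sum_i v i * \sum_j Mx i j.
  rewrite (eq_bigr _ (fun j _ => X j)) !big_split/= sumrN.
  congr (_ + _ + _ - _ + _); [by rewrite mulr_suml|by rewrite mulr_sumr|exact: exchange_big|].
  by rewrite exchange_big/=; apply: eq_bigr => i _; rewrite mulr_sumr.
have hm : \sum_j mx j j = Vr + r * del.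
  rewrite /Vr /del mulr_sumr -big_split/=; apply: eq_bigr => j _.
  by rewrite /v' /gradv /v; field.
have hrt : rt = - (Vr + r * del) by rewrite -hm; apply/eqP; rewrite -addr_eq0 mass.
have hF : \sum_i v i * F i = \sum_i v i * mt i + \sum_i v i * \sum_j Mx i j + \sum_i v i * qx i.
  by rewrite -!big_split/=; apply: eq_bigr => i _; rewrite -mom; ring.
(* The identity behind the cancellation: with it, the multiples of the divergence of v combine with
   the density derivatives into [A] times the mass balance, and only p - q survives. *)
have hA : e + p r - E2 = r * A.
  rewrite /e /ener /A -/P /E2 (_ : \sum_i m i * v i = (\sum_i m i ^+ 2) / r); first by field.
  by rewrite mulr_suml; apply: eq_bigr => i _; rewrite /v; field.
rewrite big_split/= -mulr_suml X' /energy_flux /stress_work -/e -/v'.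
rewrite (_ : \sum_i m i / r * F i = \sum_i v i * F i)// hF.
rewrite -/SS -/del.
have -> : \sum_j (v j * (e + q) - \sum_i S i j * v i) * phx j =
  \sum_j m j / r * (e + q) * phx j - \sum_i \sum_j S i j * (m i / r) * phx j.
  rewrite [X in _ = _ - X]exchange_big/= -sumrB; apply: eq_bigr => j _.
  by rewrite mulrBl mulr_suml.
rewrite -/SS /e' hrt.
have -> : e = r * A + E2 - p r by rewrite -hA; ring.
ring.
Qed.

End identity.

Lemma Rintegral_sum d (T : measurableType d) (R : realType) (mu : {measure set T -> \bar R})
    (D : set T) (I : Type) (s : seq I) (f : I -> T -> R) : measurable D ->
  (forall i, mu.-integrable D (EFin \o f i)) ->
  \int[mu]_(z in D) \sum_(i <- s) f i z = \sum_(i <- s) \int[mu]_(z in D) f i z.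
Proof.
move=> mD If; elim: s => [|i s IH].
  by under eq_Rintegral do rewrite big_nil; rewrite /Rintegral integral0 big_nil.
under eq_Rintegral do rewrite big_cons.
by rewrite RintegralD ?IH ?big_cons//; exact: L1_sum.
Qed.

(** * The energy balance integrated against a test function *)

Section integrated.
Context {R : realType} {d : nat} (p : R -> R).
Hypothesis cp : continuous p.
Local Notation E := 'rV[R]_d.
Local Notation X := (R * E)%type.
Local Notation mX := (measurableTypeR R * E)%type.
Local Notation mu := (lebesgue_tx R d).

Section localized.
Variables (Q : set X) (phi : X -> R).
Hypothesis tphi : test_function Q phi.
Local Notation K := (supp phi).

Let cK : compact K. Proof. by case: tphi. Qed.
Let sphi : smooth phi. Proof. by case: tphi. Qed.

Lemma L1_test (G : X -> R) : measurable_fun [set: mX] G -> dominated K G (cst 1) ->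
  (forall z, ~ K z -> G z = 0) -> mu.-integrable setT (EFin \o G).
Proof.
move=> mG [C C0 hC] G0; apply: (@L1_le _ mX R mu setT measurableT G (fun z => C * \1_K z)) => //.
- move=> z _; rewrite indicE; have [zK|zK] := boolP (z \in K).
    by rewrite hC// -inE.
  by rewrite G0 ?normr0 ?mulr0// => Kz; move: zK; rewrite notin_setE.
- apply: L1Z => //; apply: L1_indic => //; first exact: compact_measurable_tx.
  exact: compact_fin_tx.
Qed.

Lemma dominated_test : dominated K phi (cst 1).
Proof.
by have [M M0 hM] := test_function_bounded tphi; exists M => // z _; rewrite mulr1.
Qed.

Lemma dominated_test_derive w : dominated K ('D_w phi) (cst 1).
Proof.
by have [M M0 hM] := test_function_bounded_derive w tphi; exists M => // z _; rewrite mulr1.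
Qed.

Lemma dominatedM1 (T : Type) (P : T -> Prop) (f g : T -> R) :
  dominated P f (cst 1) -> dominated P g (cst 1) -> dominated P (fun t => f t * g t) (cst 1).
Proof.
move=> hf hg; apply: dominated_trans (dominatedM hf hg) _.
by apply: dominated_le => t _; rewrite mulr1 normr1.
Qed.

(** Differentiability of [G] is asked on the support of phi only: the fields to which this is
    applied contain 1/r, and r is bounded below only there. Off the support the product vanishes
    near each point. *)
Lemma integral_derive_test (G G' : X -> R) (w : X) :
  measurable_fun [set: mX] G -> (forall z, K z -> is_derive z w G (G' z)) ->
  dominated K G (cst 1) -> dominated K G' (cst 1) ->
  mu.-integrable setT (EFin \o (fun z => G' z * phi z + G z * 'D_w phi z)) /\
  \int[mu]_z (G' z * phi z + G z * 'D_w phi z) = 0.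
Proof.
move=> mG dG bG bG'.
pose psi z := G z * phi z.
have mphi : measurable_fun [set: mX] phi by apply: continuous_measurable_tx; exact: smooth_continuous.
have hpsi z : is_derive z w psi (G' z * phi z + G z * 'D_w phi z).
  have [Kz|nKz] := pselect (K z).
    have [d1 d2] : is_derive z w phi ('D_w phi z) by apply: DeriveDef => //; exact: smooth_derivable.
    by apply: is_derive_mul; [exact: dG|].
  rewrite (out_supp nKz) (out_supp_derive _ nKz) !mulr0 addr0.
  have oK : open (~` K) by exact/closed_openC/closed_closure.
  apply: (@near_eq_is_derive _ _ _ (cst 0)).
    have : \forall y \near z, (~` K) y by exact: open_nbhs_nbhs.
    by apply: filterS => y /out_supp phiy; rewrite /psi phiy mulr0.
have psi0 z : ~ K z -> psi z = 0 by move=> nK; rewrite /psi (out_supp nK) mulr0.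
have Dpsi : 'D_w psi = fun z => G' z * phi z + G z * 'D_w phi z.
  by apply/funext => z; case: (hpsi z).
rewrite -Dpsi.
have [C C0 hC] : dominated K ('D_w psi) (cst 1).
  rewrite Dpsi; apply: dominatedD; apply: dominatedM1 => //; first exact: dominated_test.
  exact: dominated_test_derive.
apply: (@integral_derive0 _ _ psi w K C) => //.
- apply: L1_test => //; first exact: measurable_funM.
  exact: dominatedM1 dominated_test.
- move=> z; have [Kz|nKz] := pselect (K z).
    by rewrite (le_trans (hC _ Kz))// mulr1.
  have -> : 'D_w psi z = 0 by case: (hpsi z) => _ ->; rewrite (out_supp nKz) (out_supp_derive _ nKz) !mulr0 addr0.
  by rewrite normr0.
Qed.

End localized.

(** The regularity that convolving an integrable field with a compactly supported smooth kernel
    provides. *)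
Definition C1b (f : X -> R) := [/\ measurable_fun [set: mX] f, forall z w, derivable f z w,
  exists N, forall z, `|f z| <= N & forall w, exists N, forall z, `|'D_w f z| <= N].

Section balance.
Variables (Q : set X) (phi : X -> R).
Hypothesis tphi : test_function Q phi.
Local Notation K := (supp phi).
Variables (r q : X -> R) (m F : X -> 'I_d -> R) (M : X -> 'I_d -> 'I_d -> R) (c : R).
Hypotheses (Cr : C1b r) (Cq : C1b q) (Cm : forall i, C1b (m ^~ i))
  (CM : forall i j, C1b (fun z => M z i j)).
Hypotheses (c0 : 0 < c) (cr : forall z, K z -> c <= r z).
Hypothesis mass : forall z, K z -> dt r z + \sum_j dx j (m ^~ j) z = 0.
Hypothesis momentum : forall z i, K z ->
  dt (m ^~ i) z + \sum_j dx j (fun z => M z i j) z + dx i q z = F z i.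

(** The integrand is a sum of exact derivatives of compactly supported functions, one in time and
    one in each space direction; [energy_balance] identifies this sum pointwise. *)
Lemma integral_energy_balance :
  \int[mu]_z (energy_flux p (r z) (m z) (M z) (q z) (F z) (phi z) (dt phi z) (fun j => dx j phi z) -
    stress_work p (r z) (m z) (M z) (q z) (fun j => dx j r z) (fun i j => dx j (m ^~ i) z) * phi z) = 0.
Proof.
pose G z := ener p (r z) (m z).
pose Fl z j := flux p r q m M z j.
have dC (f : X -> R) z w : C1b f -> is_derive z w f ('D_w f z).
  by case=> _ df _ _; apply: DeriveDef.
have bC (f : X -> R) : C1b f -> dominated K f (cst 1).
  case=> _ _ [N hN] _; exists `|N| => // z _.
  by rewrite mulr1 (le_trans (hN z))// ler_norm.
have bD (f : X -> R) w : C1b f -> dominated K ('D_w f) (cst 1).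
  case=> _ _ _ /(_ w)[N hN]; exists `|N| => // z _.
  by rewrite mulr1 (le_trans (hN z))// ler_norm.
pose G' (w : X) z := ener' p z r m ('D_w r z) (fun i => 'D_w (m ^~ i) z).
have r0 z : K z -> 0 < r z by move=> /cr; exact: lt_le_trans.
have dG w z : K z -> is_derive z w G (G' w z).
  by move=> Kz; apply: is_derive_ener => //; [exact: r0|exact: dC|move=> i; exact: dC].
pose v' (w : X) z i := vel' z r m ('D_w r z) (fun i => 'D_w (m ^~ i) z) i.
pose Fl' (w : X) j z := v' w z j * (G z + q z) + m z j / r z * (G' w z + 'D_w q z) -
   \sum_i (('D_w (m ^~ i) z * (m z j / r z) + m z i * v' w z j - 'D_w (fun z => M z i j) z) * (m z i / r z) +
           (m z i * m z j / r z - M z i j) * v' w z i).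
have dF w j z : K z -> is_derive z w (Fl ^~ j) (Fl' w j z).
  move=> Kz; exact: (is_derive_flux cp (M' := fun i j => 'D_w (fun z => M z i j) z) (r0 _ Kz) (dC _ _ _ Cr)
    (dC _ _ _ Cq) (fun i => dC _ _ _ (Cm i)) (fun i j => dC _ _ _ (CM i j))).
have mC (f : X -> R) : C1b f -> measurable_fun [set: mX] f by case.
have mrV : measurable_fun [set: mX] (fun z => (r z)^-1).
  by apply: (measurableT_comp measurable_invr); exact: mC.
have mG : measurable_fun [set: mX] G.
  by apply: measurable_ener => //; [exact: mC|move=> i; exact: mC].
have mF j : measurable_fun [set: mX] (Fl ^~ j).
  apply: measurable_funB.
    by apply: measurable_funM; [apply: measurable_funM => //|apply: measurable_funD => //]; exact: mC.
  apply: measurable_sum => i; apply: measurable_funM; last by apply: measurable_funM => //; exact: mC.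
  apply: measurable_funB; last exact: mC.
  by apply: measurable_funM => //; apply: measurable_funM => //; exact: mC.
have [N N0 hN] := bC _ Cr.
have dom_cont (h : R -> R) : {in `[c, N], continuous h} -> dominated K (h \o r) (cst 1).
  move=> ch; have /compact_bounded[N' [_ hN']] : compact (h @` `[c, N]%classic).
    apply: continuous_compact; last exact: segment_compact.
    by apply: continuous_in_subspaceT => x; rewrite inE => xc; exact: ch.
  exists (`|N'| + 1); first by rewrite addr_ge0.
  move=> t Pt; rewrite mulr1; apply: hN'; first by rewrite (le_lt_trans (ler_norm _))// ltrDl.
  exists (r t) => //; rewrite /= in_itv/= cr//=.
  by have := hN _ Pt; rewrite mulr1; apply: le_trans; exact: ler_norm.
have bcst (x : R) : dominated K (cst x) (cst 1).
  by exists `|x| => // z _; rewrite mulr1.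
have br := bC _ Cr.
have brV : dominated K (fun z => (r z)^-1) (cst 1).
  apply: (dom_cont (@GRing.inv R)) => x; rewrite in_itv/= => /andP[cx _].
  by apply: inv_continuous; rewrite gt_eqF// (lt_le_trans c0).
have bp : dominated K (fun z => p (r z)) (cst 1) by apply: (dom_cont p) => x _; exact: cp.
have bP : dominated K (fun z => internal_energy p (r z)) (cst 1).
  apply: (dom_cont (internal_energy p)) => x; rewrite in_itv/= => /andP[cx _].
  by apply: continuous_internal_energy => //; exact: lt_le_trans cx.
have bS (f : 'I_d -> X -> R) : (forall i, dominated K (f i) (cst 1)) ->
  dominated K (fun z => \sum_i f i z) (cst 1) by move=> h; exact: dominated_sum.
have bm i : dominated K (m ^~ i) (cst 1) by exact: bC.
have bX i : dominated K (fun z => m z i ^+ 2) (cst 1).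
  by under [X in dominated _ X]eq_fun do rewrite expr2; exact: dominatedM1.
have bG : dominated K G (cst 1).
  apply: dominatedD => //; apply: dominatedM1; first exact: bS.
  by under [X in dominated _ X]eq_fun do rewrite invfM; exact: (dominatedM1 (bcst _)).
have bG' w : dominated K (G' w) (cst 1).
  apply: dominatedD.
    by apply: bS => i; apply: dominatedM1; [exact: dominatedM1|exact: bD].
  apply: dominatedM1; last exact: bD.
  apply: dominatedB; first by apply: dominatedM1 => //; exact: dominatedD.
  apply: dominatedM1; first exact: bS.
  under [X in dominated _ X]eq_fun do rewrite invfM -exprVn expr2.
  by apply: (dominatedM1 (bcst _)); exact: dominatedM1.
have bv' w i : dominated K (fun z => v' w z i) (cst 1).
  apply: dominatedM1 => //; apply: dominatedB; first exact: bD.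
  by apply: dominatedM1; [exact: dominatedM1|exact: bD].
have bq := bC _ Cq; have bM i j := bC _ (CM i j).
have bF j : dominated K (Fl ^~ j) (cst 1).
  apply: dominatedB; first by apply: dominatedM1; [exact: dominatedM1|exact: dominatedD].
  apply: bS => i; apply: dominatedM1; last exact: dominatedM1.
  by apply: dominatedB => //; apply: dominatedM1 => //; exact: dominatedM1.
have bF' w j : dominated K (Fl' w j) (cst 1).
  apply: dominatedB.
    apply: dominatedD.
      by apply: dominatedM1 => //; exact: dominatedD.
    by apply: dominatedM1; [exact: dominatedM1|apply: dominatedD => //; exact: bD].
  apply: bS => i; apply: dominatedD.
    apply: dominatedM1; last exact: dominatedM1.
    apply: dominatedB; last exact: bD.
    apply: dominatedD; last exact: dominatedM1.
    by apply: dominatedM1; [exact: bD|exact: dominatedM1].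
  apply: dominatedM1 => //.
  by apply: dominatedB => //; apply: dominatedM1 => //; exact: dominatedM1.
pose et : X := (1, 0); pose ex j : X := (0, delta_mx ord0 j).
(* [None] is the time direction with the energy, [Some j] the direction j with component j of the
   flux. *)
pose H (o : option 'I_d) z := if o is Some j then Fl' (ex j) j z * phi z + Fl z j * dx j phi z
  else G' et z * phi z + G z * dt phi z.
have hH o : mu.-integrable setT (EFin \o H o) /\ \int[mu]_z H o z = 0.
  case: o => [j|]; apply: (integral_derive_test tphi) => //.
transitivity (\int[mu]_z \sum_(o <- None :: [seq Some j | j <- index_enum 'I_d]) H o z); last first.
  by rewrite Rintegral_sum => [|//|o]; [rewrite big1// => o _; exact: (hH o).2|exact: (hH o).1].
apply: eq_Rintegral => z _; rewrite big_cons big_map.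
have [Kz|nKz] := pselect (K z); last first.
  have o1 := out_supp nKz; have o2 w := out_supp_derive w nKz.
  rewrite /energy_flux /stress_work /H o1 /dt /dx !o2 !mulr0 !addr0 subr0 add0r.
  rewrite big1; last by move=> j _; rewrite o2 mulr0.
  rewrite big1; last by move=> i _; rewrite big1// => j _; rewrite o2 mulr0.
  by rewrite subrr add0r big1// => j _; rewrite o2 !mulr0 addr0.
rewrite -(@energy_balance R d p (r z) (q z) (m z) (F z) (M z) (dt r z) (fun i => dt (m ^~ i) z)
  (fun j => dx j r z) (fun j => dx j q z) (fun i j => dx j (m ^~ i) z)
  (fun i j => dx j (fun z => M z i j) z) (phi z) (dt phi z) (fun j => dx j phi z)).
- by [].
- exact: r0.
- exact: mass.
- by move=> i; exact: momentum.
Qed.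

End balance.
End integrated.

(** * Bounds for averaged fields *)

Section jensen.
Context dW (W : measurableType dW) (R : realType) (nu : {measure set W -> \bar R}).
Local Notation L1 f := (nu.-integrable setT (EFin \o f)).

Lemma le_RintegralT (f g : W -> R) : L1 f -> L1 g -> (forall w, f w <= g w) ->
  \int[nu]_w f w <= \int[nu]_w g w.
Proof. by move=> If Ig fg; apply: le_Rintegral => // w _. Qed.

(* A substitute for Jensen's inequality: a pointwise Young inequality, averaged twice, bounds
   products of averages. *)
Lemma weighted_young (k x y h : W -> R) :
  (forall w, 0 <= k w) -> L1 k -> L1 (fun w => x w * k w) -> L1 (fun w => y w * k w) ->
  L1 (fun w => h w * k w) -> (forall s t, x s * y t <= h s + h t) ->
  (\int[nu]_w (x w * k w)) * (\int[nu]_w (y w * k w)) <=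
  2 * (\int[nu]_w k w) * \int[nu]_w (h w * k w).
Proof.
move=> k0 Ik Ixk Iyk Ihk xyh.
set X := \int[nu]_w (x w * k w); set Y := \int[nu]_w (y w * k w).
set H := \int[nu]_w (h w * k w); set m := \int[nu]_w k w.
(* Integrate the pointwise inequality in [s] against [k], with [t] fixed; the second integration is
   in [t]. *)
have yX t : y t * X <= H + h t * m.
  rewrite /X /H /m -!RintegralZl// -RintegralD//; last exact: L1Z.
  apply: le_RintegralT; first exact: L1Z.
    by apply: L1D => //; exact: L1Z.
  by move=> s; rewrite mulrA -mulrDl ler_wpM2r// mulrC.
rewrite (_ : 2 * m * H = H * m + m * H); last by ring.
rewrite /Y -RintegralZl// -[in leRHS]/m /m /H -!RintegralZl// -RintegralD//; [|exact: L1Z|exact: L1Z].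
apply: le_RintegralT; first exact: L1Z.
  by apply: L1D => //; exact: L1Z.
move=> t; rewrite mulrA [leRHS](_ : _ = (H + h t * m) * k t); last by rewrite /H /m; ring.
by rewrite ler_wpM2r// mulrC.
Qed.

Lemma Rintegral_le_dom (f g : W -> R) : measurable_fun setT f -> L1 g ->
  (forall w, `|f w| <= g w) -> `|\int[nu]_w f w| <= \int[nu]_w g w.
Proof.
move=> mf Ig fg; have If : L1 f by apply: L1_le Ig => // w _.
apply: le_trans (le_normr_Rintegral _ If) _ => //.
by apply: le_RintegralT => //; exact: L1_norm.
Qed.

End jensen.


(* The conserved quantities: density and pressure ([inl]), momentum and force, momentum flux. *)
Definition component d := (bool + (bool * 'I_d + 'I_d * 'I_d))%type.
Notation iR := (inl true).
Notation iQ := (inl false).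
Notation iM i := (inr (inl (true, i))).
Notation iF i := (inr (inl (false, i))).
Notation iMM i j := (inr (inr (i, j))).

Section functional.
Context {R : realType} {d : nat} (p : R -> R).
Implicit Types Y : component d -> option 'I_d -> R.

(** [Y i None] stands for the regularised field [i] and [Y i (Some j)] for its derivative in
    direction [j]. The flux reads only the former. *)
Definition fluxY Y ph pht phx := energy_flux p (Y iR None) (fun i => Y (iM i) None)
  (fun i j => Y (iMM i j) None) (Y iQ None) (fun i => Y (iF i) None) ph pht phx.

Definition workY Y := stress_work p (Y iR None) (fun i => Y (iM i) None)
  (fun i j => Y (iMM i j) None) (Y iQ None) (fun j => Y iR (Some j))
  (fun i j => Y (iM i) (Some j)).

End functional.

Section kernel_bound.
Context {R : realType} {d : nat} (p : R -> R) dW (W : measurableType dW)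
  (nu : {measure set W -> \bar R}) (T : Type) (P : T -> Prop).
Hypothesis cp : continuous p.
Variables (g : T -> component d -> W -> R) (a b H kh : T -> W -> R) (k : T -> option 'I_d -> W -> R).
Variables (C0 m0 c : R).
Local Notation L1 f := (nu.-integrable setT (EFin \o f)).
Hypotheses (C00 : 0 <= C0) (kh0 : forall t w, P t -> 0 <= kh t w)
  (Ikh : forall t, P t -> L1 (kh t)) (khm : forall t, P t -> \int[nu]_w kh t w <= m0)
  (IHkh : forall t, P t -> L1 (fun w => H t w * kh t w)).
Hypotheses (ma : forall t, P t -> measurable_fun setT (a t))
  (mb : forall t, P t -> measurable_fun setT (b t))
  (mg : forall t i, P t -> measurable_fun setT (g t i))
  (mk : forall t o, P t -> measurable_fun setT (k t o)).
Hypotheses (a0 : forall t w, P t -> 0 <= a t w) (b0 : forall t w, P t -> 0 <= b t w)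
  (H0 : forall t w, P t -> 0 <= H t w).
Hypotheses (a1H : forall t w, P t -> a t w <= 1 + H t w)
  (aa1H : forall t w, P t -> a t w ^+ 2 <= 1 + H t w)
  (b1H : forall t w, P t -> b t w <= 1 + H t w)
  (aaH : forall t w s, P t -> a t w ^+ 2 * a t s <= H t w + H t s)
  (baH : forall t w s, P t -> b t w * a t s <= H t w + H t s).
Hypothesis kkh : forall t o w, P t -> `|k t o w| <= kh t w.
Hypotheses (gR : forall t w, P t -> `|g t iR w| <= C0) (gQ : forall t w, P t -> `|g t iQ w| <= C0)
  (gM : forall t i w, P t -> `|g t (iM i) w| <= C0 * a t w)
  (gF : forall t i w, P t -> `|g t (iF i) w| <= C0 * b t w)
  (gMM : forall t i j w, P t -> `|g t (iMM i j) w| <= C0 * a t w ^+ 2).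

Let Y t i o := \int[nu]_w (g t i w * k t o w).
Let Hk t := \int[nu]_w (H t w * kh t w).
Hypothesis cY : forall t, P t -> c <= Y t iR None.
Hypothesis c0 : 0 < c.
Variables (ph pht : T -> R) (phx : T -> 'I_d -> R).
Hypotheses (dph : dominated P ph (cst 1)) (dpht : dominated P pht (cst 1))
  (dphx : forall i, dominated P (phx ^~ i) (cst 1)).

Let I1 t (f : W -> R) : P t -> measurable_fun setT f -> (forall w, 0 <= f w) ->
  (forall w, f w <= 1 + H t w) -> L1 (fun w => f w * kh t w).
Proof.
move=> Pt mf f0 fH; apply: (@L1_le _ W R nu setT measurableT _ (fun w => kh t w + H t w * kh t w)).
- by apply: measurable_funM => //; apply: L1_measurable; exact: Ikh.
- move=> w _; rewrite ger0_norm ?mulr_ge0 ?kh0//.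
  by rewrite -{2}[kh t w]mul1r -mulrDl ler_wpM2r ?kh0.
- by apply: L1D => //; [exact: Ikh|exact: IHkh].
Qed.

Let A t := \int[nu]_w (a t w * kh t w).
Let U t := \int[nu]_w (a t w ^+ 2 * kh t w).
Let B t := \int[nu]_w (b t w * kh t w).

Let maa t : P t -> measurable_fun setT (fun w => a t w ^+ 2).
Proof. by move=> Pt; apply: measurable_funX; exact: ma. Qed.

Let Ia t : P t -> L1 (fun w => a t w * kh t w).
Proof. by move=> Pt; apply: I1 => //; [exact: ma|move=> w; exact: a0|move=> w; exact: a1H]. Qed.

Let Iaa t : P t -> L1 (fun w => a t w ^+ 2 * kh t w).
Proof.
move=> Pt; apply: (@I1 t (fun w => a t w ^+ 2)) => //; [exact: maa|move=> w|move=> w; exact: aa1H].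
exact: exprn_ge0 (a0 _ Pt).
Qed.

Let Ib t : P t -> L1 (fun w => b t w * kh t w).
Proof. by move=> Pt; apply: I1 => //; [exact: mb|move=> w; exact: b0|move=> w; exact: b1H]. Qed.

Let Ybound t i o (f : W -> R) : P t -> L1 (fun w => f w * kh t w) ->
  (forall w, `|g t i w| <= C0 * f w) -> `|Y t i o| <= C0 * \int[nu]_w (f w * kh t w).
Proof.
move=> Pt If gf; rewrite -RintegralZl//; apply: Rintegral_le_dom.
- by apply: measurable_funM; [exact: mg|exact: mk].
- exact: L1Z.
- by move=> w; rewrite normrM mulrA ler_pM ?kkh.
Qed.

Let m00 t : P t -> 0 <= m0.
Proof.
by move=> Pt; apply: le_trans (khm Pt); apply: Rintegral_ge0 => w _; exact: kh0.
Qed.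

Let Y1 t i o : P t -> (forall w, `|g t i w| <= C0) -> `|Y t i o| <= C0 * m0.
Proof.
move=> Pt gC; apply: (le_trans (Ybound (f := cst 1) o Pt _ _)).
- by under [X in _ \o X]eq_fun do rewrite mul1r; exact: Ikh.
- by move=> w; rewrite mulr1.
- by rewrite ler_wpM2l//; under eq_Rintegral do rewrite mul1r; exact: khm.
Qed.

Let A0 t : P t -> 0 <= A t.
Proof. by move=> Pt; apply: Rintegral_ge0 => w _; rewrite mulr_ge0 ?a0 ?kh0. Qed.

Let U0 t : P t -> 0 <= U t.
Proof. by move=> Pt; apply: Rintegral_ge0 => w _; rewrite mulr_ge0 ?exprn_ge0 ?a0 ?kh0. Qed.

Let B0 t : P t -> 0 <= B t.
Proof. by move=> Pt; apply: Rintegral_ge0 => w _; rewrite mulr_ge0 ?b0 ?kh0. Qed.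

Let Hk0 t : P t -> 0 <= Hk t.
Proof. by move=> Pt; apply: Rintegral_ge0 => w _; rewrite mulr_ge0 ?H0 ?kh0. Qed.

Let UA t : P t -> U t * A t <= 2 * m0 * Hk t.
Proof.
move=> Pt; apply: le_trans (@weighted_young _ W R nu (kh t) (fun w => a t w ^+ 2) (a t) (H t) _ _ _ _ _ _) _ => //.
- by move=> w; exact: kh0.
- exact: Ikh.
- exact: Iaa.
- exact: Ia.
- exact: IHkh.
- by move=> w s; exact: aaH.
- by rewrite ler_wpM2r ?Hk0// ler_wpM2l// khm.
Qed.

Let BA t : P t -> B t * A t <= 2 * m0 * Hk t.
Proof.
move=> Pt; apply: le_trans (@weighted_young _ W R nu (kh t) (b t) (a t) (H t) _ _ _ _ _ _) _ => //.
- by move=> w; exact: kh0.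
- exact: Ikh.
- exact: Ib.
- exact: Ia.
- exact: IHkh.
- by move=> w s; exact: baH.
- by rewrite ler_wpM2r ?Hk0// ler_wpM2l// khm.
Qed.

(** Two uses of the averaged Young inequality: A^2 <= 2 m0 U, then U A <= 2 m0 Hk. *)
Let A3 t : P t -> A t ^+ 3 <= 4 * m0 ^+ 2 * Hk t.
Proof.
move=> Pt; have AA : A t * A t <= 2 * m0 * U t.
  apply: le_trans (@weighted_young _ W R nu (kh t) (a t) (a t) (fun w => a t w ^+ 2) _ _ _ _ _ _) _ => //.
  - by move=> w; exact: kh0.
  - exact: Ikh.
  - exact: Ia.
  - exact: Ia.
  - exact: Iaa.
  - move=> w s; have : 0 <= (a t w - a t s) ^+ 2 by exact: sqr_ge0.
    rewrite sqrrB; have : 0 <= a t w * a t s by rewrite mulr_ge0 ?a0.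
    lra.
  - by rewrite ler_wpM2r ?U0// ler_wpM2l// khm.
rewrite exprSr expr2; apply: (le_trans (ler_wpM2r (A0 Pt) AA)).
have m2 : 0 <= 2 * m0 by rewrite mulr_ge0// (m00 Pt).
rewrite (_ : 4 * m0 ^+ 2 * Hk t = 2 * m0 * (2 * m0 * Hk t)); last by ring.
by rewrite -(mulrA (2 * m0)) ler_wpM2l// UA.
Qed.

Let ZH : dominated P (fun t => (1 + A t) ^+ 3 + U t * A t + B t * A t) (fun t => 1 + Hk t).
Proof.
have [[t Pt]|nP] := pselect (exists t, P t); last by exists 0 => // t Pt; case: nP; exists t.
have m := m00 Pt.
(* From (1 + A)^3 <= 4 + 4 A^3 and A^3 <= 4 m0^2 Hk, plus 2 m0 for each of U A and B A. *)
exists (4 + 16 * m0 ^+ 2 + 4 * m0).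
  by rewrite !addr_ge0// mulr_ge0// exprn_ge0.
move=> {Pt}t Pt; have A0' := A0 Pt; have U0' := U0 Pt; have B0' := B0 Pt.
rewrite ger0_norm; last by rewrite !addr_ge0 ?mulr_ge0 ?exprn_ge0 ?addr_ge0.
(* The difference of the two sides is 3 (1 + A) (A - 1)^2. *)
have cube : (1 + A t) ^+ 3 <= 4 + 4 * A t ^+ 3.
  have : 0 <= (1 + A t) * (A t - 1) ^+ 2 by rewrite mulr_ge0 ?addr_ge0 ?sqr_ge0.
  have -> : (1 + A t) * (A t - 1) ^+ 2 = 1 - A t - A t ^+ 2 + A t ^+ 3 by ring.
  have -> : (1 + A t) ^+ 3 = 1 + 3 * A t + 3 * A t ^+ 2 + A t ^+ 3 by ring.
  lra.
have h1 := UA Pt; have h2 := BA Pt; have h3 := A3 Pt; have h := Hk0 Pt.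
have mm : 0 <= m0 ^+ 2 by exact: exprn_ge0.
have -> : (4 + 16 * m0 ^+ 2 + 4 * m0) * (1 + Hk t) =
  4 + 16 * m0 ^+ 2 + 4 * m0 + 4 * Hk t + 4 * (4 * m0 ^+ 2 * Hk t) + 2 * (2 * m0 * Hk t) by ring.
lra.
Qed.

Let dY i o : (forall t w, P t -> `|g t i w| <= C0) -> dominated P (fun t => Y t i o) (cst 1).
Proof.
move=> gC; exists `|C0 * m0| => // t Pt; rewrite mulr1.
by apply: le_trans (ler_norm _); apply: Y1 => // w; exact: gC.
Qed.

Let dM i o : dominated P (fun t => Y t (iM i) o) A.
Proof. by exists C0 => // t Pt; apply: Ybound => //; [exact: Ia|move=> w; exact: gM]. Qed.

Let dF i o : dominated P (fun t => Y t (iF i) o) B.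
Proof. by exists C0 => // t Pt; apply: Ybound => //; [exact: Ib|move=> w; exact: gF]. Qed.

Let dMM i j o : dominated P (fun t => Y t (iMM i j) o) U.
Proof.
exists C0 => // t Pt; apply: (@Ybound t _ _ (fun w => a t w ^+ 2)) => //; first exact: Iaa.
by move=> w; exact: gMM.
Qed.

(** A functional cubic in averages is bounded linearly by one average of the weight [H]. Such
    averages converge in L1, and this is what makes dominated convergence possible. *)
Lemma fluxY_bound : dominated P (fun t => fluxY p (Y t) (ph t) (pht t) (phx t)) (fun t => 1 + Hk t).
Proof.
apply: dominated_trans ZH; apply: (@energy_flux_dominated _ _ _ cp T P (fun t => Y t iR None) (fun t => Y t iQ None) (fun t i => Y t (iM i) None)
  (fun t i => Y t (iF i) None) (fun t i j => Y t (iMM i j) None) ph pht phx A U B c (C0 * m0)) => //.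
- by move=> t Pt; apply: le_trans (ler_norm _) _; apply: Y1 => // w; exact: gR.
- by apply: dY => *; exact: gQ.
Qed.

Lemma workY_bound : dominated P (fun t => workY p (Y t) * ph t) (fun t => 1 + Hk t).
Proof.
apply: dominated_trans ZH; apply: (@stress_work_dominated _ _ _ cp T P (fun t => Y t iR None) (fun t => Y t iQ None) (fun t i => Y t (iM i) None)
  (fun t j => Y t iR (Some j)) (fun t i j => Y t (iMM i j) None) (fun t i j => Y t (iM i) (Some j)) ph A U B c (C0 * m0)) => //.
- by move=> t Pt; apply: le_trans (ler_norm _) _; apply: Y1 => // w; exact: gR.
- by apply: dY => *; exact: gQ.
- by move=> i; apply: dY => *; exact: gR.
Qed.

End kernel_bound.

(** * Limits as a regularisation parameter tends to 0 *)

Section limit.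
Context d (T : measurableType d) (R : realType) (mu : {measure set T -> \bar R}) (D : set T).
Hypothesis mD : measurable D.

(** From fast sequences to the full limit, by contradiction: if convergence failed, bad parameters
    could be chosen as small as desired, hence along a sequence fast enough for
    [fast_dominated_cvg]. *)
Lemma dominated_cvg_at0 (I : finType) (Y : R -> I -> T -> R) (Y0 : I -> T -> R)
    (F : R -> T -> R) (F0 : T -> R) (i0 : I) (C s0 : R) :
  (mu D < +oo)%E -> 0 < s0 -> 0 <= C ->
  (forall s i, 0 < s <= s0 -> measurable_fun D (Y s i)) ->
  (forall i, mu.-integrable D (EFin \o Y0 i)) ->
  (forall i e, 0 < e -> exists2 r, 0 < r & forall s, 0 < s <= s0 -> s <= r ->
     (\int[mu]_(x in D) `|(Y s i x - Y0 i x)%:E| <= e%:E)%E) ->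
  (forall s, 0 < s <= s0 -> measurable_fun D (F s)) -> measurable_fun D F0 ->
  {ae mu, forall x, D x -> forall u : nat -> R, (forall n, 0 < u n <= s0) ->
     (forall i, Y (u n) i x @[n --> \oo] --> Y0 i x) -> F (u n) x @[n --> \oo] --> F0 x} ->
  {ae mu, forall x, D x -> forall s, 0 < s <= s0 -> `|F s x| <= C * (1 + Y s i0 x)} ->
  mu.-integrable D (EFin \o F0) /\
  \int[mu]_(x in D) F s x @[s --> 0^'+] --> \int[mu]_(x in D) F0 x.
Proof.
move=> fD s00 C0 mY iY YY0 mF mF0 FF0 FY.
have pos n : 0 < 1 / (2 ^ n.+1)%:R :> R by rewrite divr_gt0// ltr0n expn_gt0.
(* Finitely many fields, so one threshold serves them all. *)
have fast n : exists2 r, 0 < r & forall s, 0 < s <= s0 -> s <= r -> forall i,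
    (\int[mu]_(x in D) `|(Y s i x - Y0 i x)%:E| <= (1 / (2 ^ n.+1)%:R)%:E)%E.
  have /choice[r hr] : forall i, exists r, 0 < r /\ forall s, 0 < s <= s0 -> s <= r ->
      (\int[mu]_(x in D) `|(Y s i x - Y0 i x)%:E| <= (1 / (2 ^ n.+1)%:R)%:E)%E.
    by move=> i; have [r r0 h] := YY0 i _ (pos n); exists r.
  exists (\big[Num.min/1]_i r i).
    by elim/big_ind : _ => // [x y x0 y0|i _]; [rewrite lt_min x0|exact: (hr i).1].
  by move=> s s0s sr i; apply: (hr i).2 => //; apply: (le_trans sr); exact: bigmin_le_cond.
have /choice[r hr] : forall n, exists r, 0 < r /\ forall s, 0 < s <= s0 -> s <= r -> forall i,
    (\int[mu]_(x in D) `|(Y s i x - Y0 i x)%:E| <= (1 / (2 ^ n.+1)%:R)%:E)%E.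
  by move=> n; have [r r0 h] := fast n; exists r.
have key (u : nat -> R) : (forall n, 0 < u n <= s0) -> (forall n, u n <= r n) ->
    mu.-integrable D (EFin \o F0) /\
    \int[mu]_(x in D) F (u n) x @[n --> \oo] --> \int[mu]_(x in D) F0 x.
  move=> us ur.
  have [] := @fast_dominated_cvg _ T R mu D mD I (fun n => Y (u n)) Y0 (fun n => F (u n)) F0 i0 C fD.
  - by move=> n i; exact: mY.
  - exact: iY.
  - by move=> n i; apply: (hr n).2.
  - by move=> n; exact: mF.
  - exact: mF0.
  - by move: FF0; apply: filterS => x h Dx Yx; apply: h.
  - by move: FY; apply: filterS => x h Dx n; apply: h.
  - exact: C0.
  - by [].
split.
  (* A single sufficiently fast sequence already gives integrability of the limit. *)
  have [|n|//] := key (fun n => Num.min s0 (r n)); last by rewrite ge_min lexx orbT.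
  by move=> n; rewrite lt_min s00 (hr n).1/= ge_min lexx.
apply/cvgrPdist_lt => e e0; apply: contrapT => h.
have /choice[u hu] : forall n, exists s, (0 < s <= s0 /\ s <= r n) /\
    ~ `|\int[mu]_(x in D) F0 x - \int[mu]_(x in D) F s x| < e.
  move=> n; apply: contrapT => hn; apply: h.
  have rn : 0 < Num.min s0 (r n) by rewrite lt_min s00 (hr n).1.
  near=> s; apply: contrapT => hs; apply: hn; exists s; split=> //.
  have s0' : 0 < s by near: s; exact: nbhs_right_gt.
  have : s < Num.min s0 (r n) by near: s; exact: nbhs_right_lt.
  by rewrite lt_min => /andP[/ltW -> /ltW ->]; rewrite s0'.
have [_ /cvgrPdist_lt/(_ _ e0)[N _ hN]] := key u (fun n => (hu n).1.1) (fun n => (hu n).1.2).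
by apply: (hu N).2; apply: hN => /=.
Unshelve. all: by end_near. Qed.

End limit.

(** * The kernels as approximate identities *)

Section kernels.
Context {R : realType} {n : nat} (eta : 'rV[R]_n -> R).
Hypothesis heta : radial_kernel eta.
Hypothesis n0 : (0 < n)%N.
Local Notation E := 'rV[R]_n.
Local Notation X := (R * E)%type.
Local Notation mX := (measurableTypeR R * E)%type.
Local Notation mu := (lebesgue_tx R n).

Definition eta_l_diff l (o : option 'I_n) : E -> R :=
  if o is Some j then 'D_(delta_mx ord0 j) (eta_l eta l) else eta_l eta l.

Lemma eta_l_diff_smooth l o : smooth (eta_l_diff l o).
Proof. by case: o => [j|]; [apply: smooth_derive|]; exact: eta_l_smooth. Qed.

Lemma measurable_eta_l_diff l o : measurable_fun setT (eta_l_diff l o).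
Proof. by apply: continuous_measurable_rV; exact/smooth_continuous/eta_l_diff_smooth. Qed.

(** The strict inequality describes an open set on which the kernel vanishes, so its derivatives
    vanish there as well. *)
Lemma eta_l_diff_out l o x : 0 < l -> l < `|x| -> eta_l_diff l o x = 0.
Proof.
move=> l0 lx; case: o => [j|] /=; last by apply: eta_l_out => //; exact: ltW.
apply: (@derive_eq0_open _ _ _ [set y : E | l < `|y|]) => //.
  rewrite (_ : [set _ | _] = ~` [set y : E | `|y| <= l]); first exact/closed_openC/closed_norm_le.
  by apply/seteqP; split=> y /=; rewrite ltNge => /negP.
by move=> y /= ly; apply: eta_l_out => //; exact: ltW.
Qed.

Lemma eta_l_diff_bounded l : 0 < l -> exists2 N, 0 <= N & forall o x, `|eta_l_diff l o x| <= N.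
Proof.
move=> l0; have h o : exists N, 0 <= N /\ forall x, `|eta_l_diff l o x| <= N.
  have [|||N N0 hN] := @compact_bounded_fun R E (eta_l_diff l o) [set x | `|x| <= l].
  - exact/smooth_continuous/eta_l_diff_smooth.
  - exact: compact_rV_ball.
  - by move=> x /negP; rewrite -ltNge; exact: eta_l_diff_out.
  - by exists N.
have /choice[N hN] := h; exists (\sum_o N o); first by apply: sumr_ge0 => o _; exact: (hN o).1.
move=> o x; apply: le_trans ((hN o).2 x) _.
by rewrite (bigD1 o)//= lerDl; apply: sumr_ge0 => o' _; exact: (hN o').1.
Qed.

(* Dominates eta_l and its first derivatives, so that one average controls all of them. *)
Definition ball_kernel (N l : R) : E -> R := fun x => N * \1_[set x : E | `|x| <= l] x.

Lemma measurable_ball l : measurable [set x : E | `|x| <= l].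
Proof. rewrite -[X in measurable X]setCK; apply: measurableC; apply: open_measurable_rV; apply: closed_openC.
exact: closed_norm_le. Qed.

Lemma measurable_ball_kernel N l : measurable_fun setT (ball_kernel N l).
Proof.
by apply: measurable_funM => //; apply: measurable_indic; exact: measurable_ball.
Qed.

Lemma ball_kernel_ge0 N l x : 0 <= N -> 0 <= ball_kernel N l x.
Proof. by move=> N0; rewrite mulr_ge0. Qed.

Lemma ball_kernel_le N l x : 0 <= N -> ball_kernel N l x <= N.
Proof. by move=> N0; rewrite -[leRHS]mulr1 ler_wpM2l// indicE; case: (_ \in _). Qed.

Lemma ball_kernelN N l x : ball_kernel N l (- x) = ball_kernel N l x.
Proof.
rewrite /ball_kernel !indicE; congr (_ * _%:R); congr nat_of_bool.
by apply/idP/idP; rewrite !inE/= normrN.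
Qed.

Lemma ball_kernel_integrable N l : 0 <= l -> (lebesgue_rV n).-integrable setT (EFin \o ball_kernel N l).
Proof.
move=> l0; apply: L1Z => //; apply: L1_indic => //; first exact: measurable_ball.
exact: lebesgue_rV_ball_fin.
Qed.

Lemma eta_l_diff_ball_kernel l : 0 < l -> exists2 N, 0 <= N & forall o x, `|eta_l_diff l o x| <= ball_kernel N l x.
Proof.
move=> l0; have [N N0 hN] := eta_l_diff_bounded l0; exists N => // o x.
rewrite /ball_kernel indicE; have [_|xl] := boolP (_ \in _); first by rewrite mulr1.
rewrite mulr0 eta_l_diff_out ?normr0// ltNge; apply/negP => xl'.
by move: xl; rewrite notin_setE.
Qed.

Lemma eta_l_bounded l : 0 < l -> exists2 N, 0 <= N & forall x, eta_l eta l x <= N.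
Proof.
move=> l0; have [N N0 hN] := eta_l_diff_bounded l0; exists N => // x.
by apply: le_trans (hN None x); exact: ler_norm.
Qed.

Lemma eta_l_diff_integrable l o : 0 < l -> (lebesgue_rV n).-integrable setT (EFin \o eta_l_diff l o).
Proof.
move=> l0; have [N N0 hN] := eta_l_diff_ball_kernel l0.
apply: L1_le (ball_kernel_integrable N (ltW l0)) => //; exact: measurable_eta_l_diff.
Qed.

Lemma theta_bounded e : 0 < e -> exists2 N, 0 <= N & forall s, `|theta eta n0 e s| <= N.
Proof.
move=> e0; have [|||N N0 hN] := @compact_bounded_fun R R (theta eta n0 e) `[-e, e].
- by apply/smooth_continuous; exact: theta_smooth.
- exact: segment_compact.
- move=> s es; apply: theta_out => //; rewrite leNgt; apply/negP; rewrite ltr_norml => /andP[h1 h2].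
  by apply: es; rewrite /= in_itv/= !ltW.
- by exists N.
Qed.

(** The kernel gives weight only to shifts smaller than [l], and small shifts move [f] little in
    L1. *)
Lemma mollx_eta_l_cvg (f : X -> R) e : mu.-integrable setT (EFin \o f) -> 0 < e ->
  exists2 r, 0 < r & forall l, 0 < l -> l <= r ->
  (\int[mu]_z `|(mollx (eta_l eta l) f z - f z)%:E| <= e%:E)%E.
Proof.
move=> If e0; have [r r0 hr] := L1_shift_eps If e0; exists r => // l l0 lr.
have [N N0 hN] := eta_l_bounded l0.
apply: (mollx_L1_minkowski If (measurable_eta_l heta l) _ hN).
- by move=> x; exact: eta_l_ge0.
- by move=> x; exact: eta_lN.
- exact: integral_eta_l.
- exact: ltW.
move=> w w0; apply: hr; rewrite (_ : `|((0, w) : X)| = `|w|).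
  rewrite (le_trans _ lr)// leNgt; apply/negP => lw; move/eqP: w0; apply.
  by apply: eta_l_out => //; exact: ltW.
by rewrite prod_normE/= normr0; apply/max_idPr.
Qed.

Lemma mollt_theta_cvg (f : X -> R) e : mu.-integrable setT (EFin \o f) -> 0 < e ->
  exists2 r, 0 < r & forall s, 0 < s -> s <= r ->
  (\int[mu]_z `|(mollt (theta eta n0 s) f z - f z)%:E| <= e%:E)%E.
Proof.
move=> If e0; have [r r0 hr] := L1_shift_eps If e0; exists r => // s s0 sr.
have [N N0 hN] := theta_bounded s0.
apply: (mollt_L1_minkowski If (M := N)).
- exact: measurable_theta.
- by move=> x; exact: theta_ge0.
- by move=> x; apply: le_trans (hN x); exact: ler_norm.
- by move=> x; exact: thetaN.
- exact: integral_theta.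
- exact: ltW.
move=> w w0; apply: hr; rewrite (_ : `|((w, 0) : X)| = `|w|).
  rewrite (le_trans _ sr)// leNgt; apply/negP => lw; move/eqP: w0; apply.
  by apply: theta_out => //; exact: ltW.
by rewrite prod_normE/= normr0; apply/max_idPl.
Qed.

Lemma integral_rV_reflect (k : E -> R) x : measurable_fun setT k -> (forall y, 0 <= k y) ->
  (forall y, k (- y) = k y) ->
  (\int[lebesgue_rV n]_y (k (x - y))%:E = \int[lebesgue_rV n]_y (k y)%:E)%E.
Proof.
move=> mk k0 kN; rewrite -(ge0_integral_rV_shift (- x) (f := EFin \o k)).
- by apply: eq_integral => y _; rewrite /= -kN opprB.
- exact/measurable_EFinP.
- by move=> y; rewrite lee_fin.
Qed.

(** Evenness replaces z - w by w - z, which reduces the claim to translation invariance and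
    Tonelli. *)
Lemma integral_tensor (th : R -> R) (kap : E -> R) z :
  measurable_fun [set: measurableTypeR R] th -> measurable_fun setT kap ->
  (forall s, 0 <= th s) -> (forall y, 0 <= kap y) ->
  (forall s, th (- s) = th s) -> (forall y, kap (- y) = kap y) ->
  (\int[lebesgue_measure]_s (th s)%:E = 1)%E ->
  (\int[mu]_w (tensor th kap (z - w))%:E = \int[lebesgue_rV n]_y (kap y)%:E)%E.
Proof.
move=> mth mk th0 k0 thN kN th1.
have mt : measurable_fun [set: mX] (tensor th kap).
  by apply: measurable_funM; [apply: (measurableT_comp mth); exact: measurable_fst|
    apply: (measurableT_comp mk); exact: measurable_snd].
have t0 w : 0 <= tensor th kap w by rewrite mulr_ge0.
transitivity (\int[mu]_w (tensor th kap w)%:E)%E.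
  rewrite -(ge0_integral_tx_shift (- z) (f := EFin \o tensor th kap)).
  - apply: eq_integral => w _; rewrite /tensor/=; congr (_ * _)%:E.
      by rewrite -thN opprB.
    by rewrite -kN opprB.
  - exact/measurable_EFinP.
  - by move=> w; rewrite lee_fin.
rewrite (tonelli_tx1 (f := EFin \o tensor th kap)).
- transitivity (\int[lebesgue_measure]_s ((th s)%:E * \int[lebesgue_rV n]_y (kap y)%:E))%E.
    apply: eq_integral => s _; rewrite -ge0_integralZl_EFin//.
    + by move=> y _; rewrite lee_fin.
    + exact/measurable_EFinP.
  rewrite ge0_integralZr//; first by rewrite th1 mul1e.
  + exact/measurable_EFinP.
  + by move=> s _; rewrite lee_fin.
  + by apply: integral_ge0 => y _; rewrite lee_fin.
- exact/measurable_EFinP.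
- by move=> w; rewrite lee_fin.
Qed.

Lemma tensor_out (e l : R) (z : X) : 0 < e -> 0 < l -> ~ (`|z.1| <= e /\ `|z.2| <= l) ->
  tensor (theta eta n0 e) (eta_l eta l) z = 0.
Proof.
move=> ep lp nz; have [ze|ze] := lerP `|z.1| e; last by rewrite /tensor theta_out ?mul0r// ltW.
have [zl|zl] := lerP `|z.2| l; first by case: nz.
by rewrite /tensor (eta_l_out heta lp (ltW zl)) mulr0.
Qed.

Lemma tensor_test (e l : R) : 0 < e -> 0 < l ->
  test_function setT (tensor (theta eta n0 e) (eta_l eta l) : X -> R).
Proof.
move=> ep lp; have out z := @tensor_out e l z ep lp.
split => //.
  by apply: smooth_tensor; [exact: theta_smooth|exact: eta_l_smooth].
have sub := supp_subset (@closed_tx_box _ n e l) out.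
apply: (subclosed_compact (@closed_closure _ _)); last exact: sub.
exact: compact_tx_box.
Qed.

End kernels.

(** * Removal of the two regularisations *)

Section data.
Context {R : realType} {d : nat} (p : R -> R).
Hypothesis cp : continuous p.
Local Notation E := 'rV[R]_d.
Local Notation X := (R * E)%type.
Local Notation mX := (measurableTypeR R * E)%type.
Local Notation mu := (lebesgue_tx R d).
Variables (g : component d -> X -> R) (a b H : X -> R) (C0 c : R) (B : set X).
(** [a] plays the speed, [b] the size of the force, [H] the integrable weight |u|^3 + |f|^(3/2). The
    fields [adm_a2a] and [adm_ba] compare two different points, as the averaged Young inequality
    requires. *)
Record admissible : Prop := Admissible {
  adm_C0 : 0 <= C0;
  adm_c0 : 0 < c;
  adm_g : forall i, mu.-integrable setT (EFin \o g i);
  adm_H : mu.-integrable setT (EFin \o H);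
  adm_ma : measurable_fun [set: mX] a;
  adm_mb : measurable_fun [set: mX] b;
  adm_a0 : forall w, 0 <= a w;
  adm_b0 : forall w, 0 <= b w;
  adm_H0 : forall w, 0 <= H w;
  adm_aH : forall w, a w <= 1 + H w;
  adm_a2H : forall w, a w ^+ 2 <= 1 + H w;
  adm_bH : forall w, b w <= 1 + H w;
  adm_a2a : forall w s, a w ^+ 2 * a s <= H w + H s;
  adm_ba : forall w s, b w * a s <= H w + H s;
  adm_gR : forall w, `|g iR w| <= C0;
  adm_gQ : forall w, `|g iQ w| <= C0;
  adm_gM : forall i w, `|g (iM i) w| <= C0 * a w;
  adm_gF : forall i w, `|g (iF i) w| <= C0 * b w;
  adm_gMM : forall i j w, `|g (iMM i j) w| <= C0 * a w ^+ 2;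
  adm_gB : forall w, B w -> c <= g iR w
}.
Hypothesis adm : admissible.
Let C00 := adm_C0 adm.
Let c0 := adm_c0 adm.
Let Ig := adm_g adm.
Let IH := adm_H adm.
Let ma := adm_ma adm.
Let mb := adm_mb adm.
Let a0 := adm_a0 adm.
Let b0 := adm_b0 adm.
Let H0 := adm_H0 adm.
Let a1H := adm_aH adm.
Let aa1H := adm_a2H adm.
Let b1H := adm_bH adm.
Let aaH := adm_a2a adm.
Let baH := adm_ba adm.
Let gR := adm_gR adm.
Let gQ := adm_gQ adm.
Let gM := adm_gM adm.
Let gF := adm_gF adm.
Let gMM := adm_gMM adm.
Let gB := adm_gB adm.

Section pullback.
Context dW (W : measurableType dW) (nu : {measure set W -> \bar R}) (T : Type) (P : T -> Prop).
Variables (pi : T -> W -> X) (kh : T -> W -> R) (k : T -> option 'I_d -> W -> R) (m0 : R).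
Variables (ph pht : T -> R) (phx : T -> 'I_d -> R).
Let Y t i o := \int[nu]_w (g i (pi t w) * k t o w).

(** Used for both kinds of averages: over space at a fixed time, where [pi t y] adjoins the time to
    [y], and over space-time, where [pi t] is the identity. *)
Lemma pullback_bound :
  (forall t, P t -> measurable_fun setT (pi t : W -> mX)) ->
  (forall t w, P t -> 0 <= kh t w) ->
  (forall t, P t -> nu.-integrable setT (EFin \o kh t)) ->
  (forall t, P t -> \int[nu]_w kh t w <= m0) ->
  (forall t, P t -> nu.-integrable setT (EFin \o (fun w => H (pi t w) * kh t w))) ->
  (forall t o, P t -> measurable_fun setT (k t o)) ->
  (forall t o w, P t -> `|k t o w| <= kh t w) ->
  (forall t, P t -> c <= Y t iR None) ->
  dominated P ph (cst 1) -> dominated P pht (cst 1) ->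
  (forall i, dominated P (phx ^~ i) (cst 1)) ->
  dominated P (fun t => fluxY p (Y t) (ph t) (pht t) (phx t))
    (fun t => 1 + \int[nu]_w (H (pi t w) * kh t w)) /\
  dominated P (fun t => workY p (Y t) * ph t)
    (fun t => 1 + \int[nu]_w (H (pi t w) * kh t w)).
Proof.
move=> mpi kh0 Ikh khm IHkh mk kkh cY hph hpht hphx.
have mc (f : X -> R) t : P t -> measurable_fun [set: mX] f -> measurable_fun setT (fun w => f (pi t w)).
  by move=> Pt mf; apply: (measurableT_comp mf); exact: mpi.
split.
- apply: (@fluxY_bound R d p dW W nu T P cp (fun t i w => g i (pi t w)) (fun t w => a (pi t w))
   (fun t w => b (pi t w)) (fun t w => H (pi t w)) kh k C0 m0 c) => //.
  + by move=> t Pt; exact: mc.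
  + by move=> t Pt; exact: mc.
  + by move=> t i Pt; apply: mc => //; apply: L1_measurable; exact: Ig.
- apply: (@workY_bound R d p dW W nu T P cp (fun t i w => g i (pi t w)) (fun t w => a (pi t w))
   (fun t w => b (pi t w)) (fun t w => H (pi t w)) kh k C0 m0 c) => //.
  + by move=> t Pt; exact: mc.
  + by move=> t Pt; exact: mc.
  + by move=> t i Pt; apply: mc => //; apply: L1_measurable; exact: Ig.
Qed.

End pullback.

Lemma weighted_lower_bound dW (W : measurableType dW) (nu : {measure set W -> \bar R})
    (f k : W -> R) : measurable_fun setT f -> (forall w, `|f w| <= C0) ->
  nu.-integrable setT (EFin \o k) -> (forall w, 0 <= k w) -> \int[nu]_w k w = 1 ->
  (forall w, k w != 0 -> c <= f w) -> c <= \int[nu]_w (f w * k w).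
Proof.
move=> mf fC Ik k0 k1 cf; rewrite -[leLHS]mulr1 -k1 -RintegralZl//.
apply: le_RintegralT; first exact: L1Z.
- apply: (@L1_le _ W R nu setT measurableT _ (fun w => C0 * k w)); last exact: L1Z.
    by apply: measurable_funM => //; exact: L1_measurable Ik.
  by move=> w _; rewrite normrM [`|k w|]ger0_norm// ler_wpM2r.
- move=> w; have [->|kw] := eqVneq (k w) 0; first by rewrite !mulr0.
  by rewrite ler_wpM2r// cf.
Qed.

Variables (eta : E -> R) (heta : radial_kernel eta) (n0 : (0 < d)%N).
Variables (Q : set X) (phi : X -> R).
Hypothesis tphi : test_function Q phi.
Local Notation K := (supp phi).

Definition mollx_data l z i o := mollx (eta_l_diff eta l o) (g i) z.
Definition convol_data e l z i o := convol (tensor (theta eta n0 e) (eta_l_diff eta l o)) (g i) z.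
Definition flux_phi (Y : X -> component d -> option 'I_d -> R) z :=
  fluxY p (Y z) (phi z) (dt phi z) (fun j => dx j phi z).
Definition work_phi (Y : X -> component d -> option 'I_d -> R) z := workY p (Y z) * phi z.

Variable l0 : R.
Hypothesis l0B : forall z y, K z -> `|z.2 - y| <= l0 -> B (z.1, y).

Let mgs i t : measurable_fun setT (fun y : E => g i (t, y)).
Proof.
have mi : measurable_fun [set: mX] (g i) by exact: L1_measurable (Ig i).
by apply: (measurableT_comp mi); exact: measurable_pair1.
Qed.

Let cK : compact K. Proof. by case: tphi. Qed.
Let mK : measurable (K : set mX). Proof. exact: compact_measurable_tx. Qed.
Let fK : (mu K < +oo)%E. Proof. exact: compact_fin_tx. Qed.

Let reflect_integrable (k : E -> R) x N : measurable_fun setT k -> (forall y, 0 <= k y) ->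
  (forall y, k y <= N) ->
  (forall y, k (- y) = k y) -> (lebesgue_rV d).-integrable setT (EFin \o k) ->
  (lebesgue_rV d).-integrable setT (EFin \o (fun y => k (x - y))).
Proof.
move=> mk k0 kN kE Ik; apply/integrableP; split.
  apply/measurable_EFinP; apply: (measurableT_comp mk).
  by apply: measurable_rVB => //; exact: measurable_cst.
under eq_integral do rewrite /= ger0_norm//.
rewrite integral_rV_reflect//; case/integrableP : Ik => _.
by under eq_integral do rewrite /= ger0_norm//.
Qed.

Lemma mollx_data_ge l z : 0 < l -> l <= l0 -> K z -> c <= mollx_data l z iR None.
Proof.
move=> lp ll Kz; have [N N0 hN] := eta_l_bounded heta lp.
apply: (weighted_lower_bound (f := fun y => g iR (z.1, y)) (k := fun y => eta_l eta l (z.2 - y))) => //.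
- apply: (reflect_integrable _ _ _ hN) => //.
  + exact: measurable_eta_l.
  + by move=> y; exact: eta_l_ge0.
  + by move=> y; exact: eta_lN.
  + exact: (eta_l_diff_integrable heta None lp).
- by move=> w; exact: eta_l_ge0.
- rewrite /Rintegral integral_rV_reflect ?integral_eta_l//.
  + exact: measurable_eta_l.
  + by move=> y; exact: eta_l_ge0.
  + by move=> y; exact: eta_lN.
- move=> y yl; apply: gB; apply: l0B => //; rewrite (le_trans _ ll)// leNgt; apply/negP => ly.
  by move/eqP: yl; apply; apply: eta_l_out => //; exact: ltW.
Qed.

Let goodH (z : X) := (lebesgue_rV d).-integrable setT (EFin \o (fun y => H (z.1, y))).

Let ae_goodH : {ae mu, forall z, goodH z}.
Proof. exact: (ae_fst _ (ae_section_rV IH)). Qed.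

Let mpair t : measurable_fun setT ((fun y => (t, y)) : E -> mX).
Proof. exact: measurable_pair1. Qed.

Let measurable_mollx_kapl l i o : 0 < l -> measurable_fun [set: mX] (mollx (eta_l_diff eta l o) (g i)).
Proof.
move=> lp; apply: measurable_mollx; [exact: L1_measurable (Ig i)|exact: measurable_eta_l_diff].
Qed.

Let mphi w : measurable_fun [set: mX] ('D_w phi).
Proof.
by apply: continuous_measurable_tx; apply/smooth_continuous/smooth_derive; case: tphi.
Qed.

Let mphi0 : measurable_fun [set: mX] phi.
Proof. by apply: continuous_measurable_tx; apply/smooth_continuous; case: tphi. Qed.

Let measurable_flux_phi Y : (forall i o, measurable_fun [set: mX] (fun z => Y z i o)) ->
  measurable_fun [set: mX] (flux_phi Y).
Proof.
move=> mY; apply: (@measurable_energy_flux R d p cp _ mX setT (fun z => Y z iR None) (fun z => Y z iQ None)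
  (fun z i => Y z (iM i) None) (fun z i => Y z (iF i) None) (fun z i j => Y z (iMM i j) None)) => //.
- exact: mphi.
- by move=> j; exact: mphi.
Qed.

Let measurable_work_phi Y : (forall i o, measurable_fun [set: mX] (fun z => Y z i o)) ->
  measurable_fun [set: mX] (work_phi Y).
Proof.
move=> mY; apply: measurable_funM => //.
by apply: (@measurable_stress_work R d p cp _ mX setT (fun z => Y z iR None) (fun z => Y z iQ None)
  (fun z i => Y z (iM i) None) (fun z j => Y z iR (Some j)) (fun z i j => Y z (iMM i j) None)
  (fun z i j => Y z (iM i) (Some j))).
Qed.

Let cvg_flux_phi T (G : set_system T) {FG : Filter G} (Y : T -> component d -> option 'I_d -> R) Y0 z :
  (forall i o, Y t i o @[t --> G] --> Y0 i o) -> 0 < Y0 iR None ->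
  flux_phi (fun=> Y t) z @[t --> G] --> flux_phi (fun=> Y0) z.
Proof.
move=> YY Y0p; exact: (@energy_flux_cvg R d p cp T G FG (fun t => Y t iR None) (fun t => Y t iQ None)
  (fun t i => Y t (iM i) None) (fun t i => Y t (iF i) None) (fun t i j => Y t (iMM i j) None)).
Qed.

Let cvg_work_phi T (G : set_system T) {FG : Filter G} (Y : T -> component d -> option 'I_d -> R) Y0 z :
  (forall i o, Y t i o @[t --> G] --> Y0 i o) -> 0 < Y0 iR None ->
  work_phi (fun=> Y t) z @[t --> G] --> work_phi (fun=> Y0) z.
Proof.
move=> YY Y0p; apply: cvgMl.
exact: (@stress_work_cvg R d p cp T G FG (fun t => Y t iR None) (fun t => Y t iQ None)
  (fun t i => Y t (iM i) None) (fun t j => Y t iR (Some j)) (fun t i j => Y t (iMM i j) None)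
  (fun t i j => Y t (iM i) (Some j))).
Qed.

Let dominated_pull (T : Type) (P : T -> Prop) (zt : T -> X) (f : X -> R) :
  dominated K f (cst 1) -> (forall t, P t -> K (zt t)) -> dominated P (f \o zt) (cst 1).
Proof. by move=> [C CC hC] PK; exists C => // t /PK; exact: hC. Qed.

Let ae_imply (P P' : X -> Prop) : (forall z, P z -> P' z) -> {ae mu, forall z, P z} ->
  {ae mu, forall z, P' z}.
Proof. by move=> PP [N [mN N0 sub]]; exists N; split => // z /= nP; apply: sub => /= h; exact/nP/PP. Qed.

Let le_integral_K (f : X -> R) e : measurable_fun [set: mX] f ->
  (\int[mu]_z `|(f z)%:E| <= e%:E)%E -> (\int[mu]_(z in K) `|(f z)%:E| <= e%:E)%E.
Proof.
move=> mf; apply: le_trans; apply: ge0_subset_integral => //.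
by apply: measurableT_comp => //; exact/measurable_EFinP.
Qed.

(** The index of the bound is the pair (l, z), so its constant does not depend on [l]. *)
Lemma flux_phi_cvg : 0 < l0 ->
  mu.-integrable K (EFin \o flux_phi (fun z i _ => g i z)) /\
  \int[mu]_(z in K) flux_phi (mollx_data l) z @[l --> 0^'+] -->
  \int[mu]_(z in K) flux_phi (fun z i _ => g i z) z.
Proof.
move=> l0p.
(* The flux reads no derivative of the fields, so the derivative slots are filled with 0. The kernel
   is then its own majorant, of mass 1 for every [l]; derivatives of [eta_l] would spoil this
   uniformity. *)
pose k (t : R * X) (o : option 'I_d) (y : E) : R := if o is None then eta_l eta t.1 (t.2.2 - y) else 0.
pose P (t : R * X) := [/\ 0 < t.1 <= l0, K t.2 & goodH t.2].
have [[C CC hC] _] : dominated P (fun t => fluxY p (fun i o => \int[lebesgue_rV d]_y (g i (t.2.1, y) * k t o y))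
     (phi t.2) (dt phi t.2) (fun j => dx j phi t.2))
    (fun t => 1 + \int[lebesgue_rV d]_w (H (t.2.1, w) * eta_l eta t.1 (t.2.2 - w))) /\
  dominated P (fun t => workY p (fun i o => \int[lebesgue_rV d]_y (g i (t.2.1, y) * k t o y)) * phi t.2)
    (fun t => 1 + \int[lebesgue_rV d]_w (H (t.2.1, w) * eta_l eta t.1 (t.2.2 - w))).
  have Ie (t : R * X) : P t -> (lebesgue_rV d).-integrable setT (EFin \o (fun y => eta_l eta t.1 (t.2.2 - y))).
    move=> [/andP[lp ll] Kz gz]; have [N N0 hN] := eta_l_bounded heta lp.
    apply: (reflect_integrable _ _ _ hN).
    - exact: measurable_eta_l.
    - by move=> y; exact: eta_l_ge0.
    - by move=> y; exact: eta_lN.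
    - exact: (eta_l_diff_integrable heta None lp).
  apply: (@pullback_bound _ E (lebesgue_rV d) (R * X)%type P (fun t y => (t.2.1, y))
    (fun t y => eta_l eta t.1 (t.2.2 - y)) k 1 (fun t => phi t.2) (fun t => dt phi t.2) (fun t j => dx j phi t.2)).
  - by move=> t _; exact: mpair.
  - by move=> t w [/andP[lp _] _ _]; exact: eta_l_ge0.
  - exact: Ie.
  - move=> t [/andP[lp ll] Kz gz]; rewrite /Rintegral integral_rV_reflect ?integral_eta_l//.
    + exact: measurable_eta_l.
    + by move=> y; exact: eta_l_ge0.
    + by move=> y; exact: eta_lN.
  - move=> t Pt; have [/andP[lp ll] Kz gz] := Pt; have [N N0 hN] := eta_l_bounded heta lp.
    apply: (@L1_bounded _ E R (lebesgue_rV d) setT measurableT (fun y => H (t.2.1, y))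
      (fun y => eta_l eta t.1 (t.2.2 - y)) N) => //; first exact: L1_measurable (Ie t Pt).
    by move=> w _; rewrite ger0_norm ?hN// eta_l_ge0.
  - move=> t [j|] Pt; first exact: measurable_cst.
    exact: L1_measurable (Ie t Pt).
  - move=> t [j|] w [/andP[lp ll] Kz gz] /=; first by rewrite normr0 eta_l_ge0.
    by rewrite ger0_norm// eta_l_ge0.
  - by move=> t [/andP[lp ll] Kz gz]; exact: mollx_data_ge.
  - by apply: (dominated_pull (zt := snd) (dominated_test tphi)) => t [].
  - by apply: (dominated_pull (zt := snd) (dominated_test_derive tphi _)) => t [].
  - by move=> i; apply: (dominated_pull (zt := snd) (dominated_test_derive tphi _)) => t [].
(* [None] is the averaged weight: it bounds the integrand, so it must converge together with the
   fields. *)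
pose Y (l : R) (i : option (component d)) z := if i is Some j then mollx (eta_l eta l) (g j) z else mollx (eta_l eta l) H z.
pose Y0 (i : option (component d)) z := if i is Some j then g j z else H z.
have IY0 i : mu.-integrable setT (EFin \o Y0 i) by case: i => [j|] //=; exact: Ig.
have mY l i : measurable_fun [set: mX] (Y l i).
  by case: i => [j|]; apply: measurable_mollx; [exact: L1_measurable (Ig j)|exact: measurable_eta_l|
    exact: L1_measurable IH|exact: measurable_eta_l].
have [] := @dominated_cvg_at0 _ mX R mu K mK (option (component d)) Y Y0 (fun l => flux_phi (mollx_data l))
  (flux_phi (fun z i _ => g i z)) None C l0 fK l0p CC.
- by move=> l i _; apply: measurable_funTS.
- by move=> i; apply: integrableS (IY0 i).
- move=> i e e0; have [r r0 hr] := mollx_eta_l_cvg heta (IY0 i) e0; exists r => // l /andP[lp _] lr.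
  apply: le_integral_K.
    by apply: measurable_funB => //; apply: L1_measurable; exact: IY0.
  by case: i hr => [j|] hr; apply: hr.
- move=> l /andP[lp _]; apply: measurable_funTS; apply: measurable_flux_phi => i o.
  exact: measurable_mollx_kapl.
- apply: measurable_funTS; apply: measurable_flux_phi => i o; exact: L1_measurable (Ig i).
- apply: (aeW mu) => z Kz v hv hY.
  apply: (@cvg_flux_phi nat \oo _ (fun n i (o : option 'I_d) => mollx (eta_l eta (v n)) (g i) z)).
    by move=> i o; exact: (hY (Some i)).
  apply: lt_le_trans c0 (gB _); rewrite [z]surjective_pairing; apply: l0B => //=.
  by rewrite subrr normr0 ltW.
- apply: ae_imply ae_goodH => z gz Kz l hl; apply: (hC (l, z)); split => //.
- by [].
Qed.
Let measurable_tensor_sub (th : R -> R) (kap : E -> R) (z : X) : measurable_fun [set: measurableTypeR R] th ->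
  measurable_fun setT kap -> measurable_fun [set: mX] (fun w : X => tensor th kap (z - w)).
Proof.
move=> mth mk; apply: measurable_funM.
  apply: (measurableT_comp mth); apply: measurable_funB; first exact: measurable_cst.
  exact: measurable_fst.
apply: (measurableT_comp mk); apply: measurable_rVB; first exact: measurable_cst.
exact: measurable_snd.
Qed.

Let tensor_sub_integrable (th : R -> R) (kap : E -> R) (z : X) : measurable_fun [set: measurableTypeR R] th ->
  measurable_fun setT kap -> (forall s, 0 <= th s) -> (forall y, 0 <= kap y) ->
  (forall s, th (- s) = th s) -> (forall y, kap (- y) = kap y) ->
  (\int[lebesgue_measure]_s (th s)%:E = 1)%E ->
  (lebesgue_rV d).-integrable setT (EFin \o kap) ->
  mu.-integrable setT (EFin \o (fun w => tensor th kap (z - w))).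
Proof.
move=> mth mk th0 k0 thN kN th1 Ik; apply/integrableP; split.
  by apply/measurable_EFinP; exact: measurable_tensor_sub.
under eq_integral do rewrite /= ger0_norm ?mulr_ge0//.
rewrite integral_tensor//; case/integrableP : Ik => _.
by under eq_integral do rewrite /= ger0_norm//.
Qed.

Lemma mollx_data_integrable l : 0 < l -> l <= l0 ->
  mu.-integrable K (EFin \o flux_phi (mollx_data l)) /\ mu.-integrable K (EFin \o work_phi (mollx_data l)).
Proof.
move=> lp ll; have [N N0 hN] := eta_l_diff_ball_kernel heta lp.
pose P (z : X) := K z /\ goodH z.
have Ib (z : X) : (lebesgue_rV d).-integrable setT (EFin \o (fun y => ball_kernel N l (z.2 - y))).
  apply: (@reflect_integrable _ _ N).
  - exact: measurable_ball_kernel.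
  - by move=> y; exact: ball_kernel_ge0.
  - by move=> y; exact: ball_kernel_le.
  - by move=> y; exact: ball_kernelN.
  - exact/ball_kernel_integrable/ltW.
have [[C1 C10 hC1] [C2 C20 hC2]] : dominated P (fun z => fluxY p (fun i o => \int[lebesgue_rV d]_y (g i (z.1, y) * eta_l_diff eta l o (z.2 - y)))
     (phi z) (dt phi z) (fun j => dx j phi z))
    (fun z => 1 + \int[lebesgue_rV d]_w (H (z.1, w) * ball_kernel N l (z.2 - w))) /\
  dominated P (fun z => workY p (fun i o => \int[lebesgue_rV d]_y (g i (z.1, y) * eta_l_diff eta l o (z.2 - y))) * phi z)
    (fun z => 1 + \int[lebesgue_rV d]_w (H (z.1, w) * ball_kernel N l (z.2 - w))).
  apply: (@pullback_bound _ E (lebesgue_rV d) X P (fun z y => (z.1, y))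
    (fun z y => ball_kernel N l (z.2 - y)) (fun z o y => eta_l_diff eta l o (z.2 - y))
    (\int[lebesgue_rV d]_y ball_kernel N l y) phi (dt phi) (fun z j => dx j phi z)).
  - by move=> t _; exact: mpair.
  - by move=> t w _; exact: ball_kernel_ge0.
  - by move=> z _; exact: Ib.
  - move=> z _; rewrite /Rintegral integral_rV_reflect//.
    + exact: measurable_ball_kernel.
    + by move=> y; exact: ball_kernel_ge0.
    + by move=> y; exact: ball_kernelN.
  - move=> z [Kz gz].
    apply: (@L1_bounded _ E R (lebesgue_rV d) setT measurableT (fun y => H (z.1, y))
      (fun y => ball_kernel N l (z.2 - y)) N) => //; first exact: L1_measurable (Ib z).
    by move=> w _; rewrite ger0_norm ?ball_kernel_ge0 ?ball_kernel_le.
  - by move=> z o _; apply: measurable_mollx_kernel; exact/smooth_continuous/eta_l_diff_smooth.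
  - by move=> z o w _; exact: hN.
  - by move=> z [Kz gz]; exact: mollx_data_ge.
  - by apply: (dominated_pull (zt := id) (dominated_test tphi)) => z [].
  - by apply: (dominated_pull (zt := id) (dominated_test_derive tphi _)) => t [].
  - by move=> i; apply: (dominated_pull (zt := id) (dominated_test_derive tphi _)) => t [].
have IW C : mu.-integrable K (EFin \o (fun z => C * (1 + mollx (ball_kernel N l) H z))).
  apply: L1Z => //; apply: L1D => //; first exact: L1_cst.
  apply: (@integrableS _ _ _ _ setT) => //.
  by apply: mollx_L1 => //; exact/ball_kernel_integrable/ltW.
have mY i o : measurable_fun [set: mX] (fun z => mollx_data l z i o) by exact: measurable_mollx_kapl.
split.
- apply: (L1_ae_le mK _ _ (IW C1)); first by apply: measurable_funTS; exact: measurable_flux_phi.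
  by apply: ae_imply ae_goodH => z gz Kz; apply: hC1.
- apply: (L1_ae_le mK _ _ (IW C2)); first by apply: measurable_funTS; exact: measurable_work_phi.
  by apply: ae_imply ae_goodH => z gz Kz; apply: hC2.
Qed.

Section balance.
Variables (l e0 : R).
Hypotheses (lp : 0 < l) (ll : l <= l0) (e0p : 0 < e0).
Hypothesis boxB : forall z w, K z -> `|z.1 - w.1| <= e0 -> `|z.2 - w.2| <= l -> B w.
Local Notation kk e := (tensor (theta eta n0 e) (eta_l eta l)).
Hypothesis mass : forall e z, 0 < e -> e <= e0 -> K z ->
  dt (convol (kk e) (g iR)) z + \sum_j dx j (convol (kk e) (g (iM j))) z = 0.
Hypothesis momentum : forall e z i, 0 < e -> e <= e0 -> K z ->
  dt (convol (kk e) (g (iM i))) z + \sum_j dx j (convol (kk e) (g (iMM i j))) z +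
    dx i (convol (kk e) (g iQ)) z = convol (kk e) (g (iF i)) z.

Let convol_eq e o f : 0 < e -> mu.-integrable setT (EFin \o f) ->
  convol (tensor (theta eta n0 e) (eta_l_diff eta l o)) f = mollt (theta eta n0 e) (mollx (eta_l_diff eta l o) f).
Proof.
move=> ep If; have [M1 _ hM1] := theta_bounded heta n0 ep; have [M2 _ hM2] := eta_l_diff_bounded heta lp.
apply/funext => z; apply: (convol_tens _ If _ hM1 _ (hM2 o)).
  exact: measurable_theta.
exact: measurable_eta_l_diff.
Qed.

Let convol_bound k f M z : mu.-integrable setT (EFin \o f) -> continuous k -> (forall w, `|k w| <= M) ->
  `|convol k f z| <= M * \int[mu]_w `|f w|.
Proof.
move=> If ck kM; have mf := L1_measurable If.
rewrite -RintegralZl//; last exact: L1_norm.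
apply: Rintegral_le_dom.
- apply: measurable_funM => //; exact: measurable_convol_kernel.
- by apply: L1Z => //; exact: L1_norm.
- by move=> w; rewrite normrM mulrC ler_wpM2r.
Qed.

Let kk_bounded e (w : X) : 0 < e -> exists2 N, 0 <= N &
  (forall z, `|kk e z| <= N) /\ forall z, `|'D_w (kk e : X -> R) z| <= N.
Proof.
move=> ep; have tk := tensor_test heta n0 ep lp.
have [M M0 hM] := test_function_bounded tk.
have [N N0 hN] := test_function_bounded_derive w tk; exists (M + N); first exact: addr_ge0.
split=> z; first by rewrite (le_trans (hM z))// lerDl.
by rewrite (le_trans (hN z))// lerDr.
Qed.

Let convol_C1b e f : 0 < e -> mu.-integrable setT (EFin \o f) -> C1b (convol (kk e) f).
Proof.
move=> ep If; have D w := kk_bounded w ep; have [sk _ _] := tensor_test heta n0 ep lp; have [M M0 hM] := test_function_bounded (tensor_test heta n0 ep lp).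
split.
- rewrite (convol_eq None ep If); apply: measurable_mollt; last exact: measurable_theta.
  by apply: measurable_mollx; [exact: L1_measurable If|exact: measurable_eta_l].
- by move=> z w; have [N N0 [h1 h2]] := D w; have [] := @convol_derive _ _ (kk e) f z w N If sk h1 h2.
- by exists (M * \int[mu]_w `|f w|) => z; apply: convol_bound => //; exact: smooth_continuous.
- move=> w; have [N N0 [h1 h2]] := D w; exists (N * \int[mu]_w `|f w|) => z.
  have [_ ->] := @convol_derive _ _ (kk e) f z w N If sk h1 h2; apply: convol_bound => //.
  exact/smooth_continuous/smooth_derive.
Qed.

Let convol_dx e f j z : 0 < e -> mu.-integrable setT (EFin \o f) ->
  dx j (convol (kk e) f) z = convol (tensor (theta eta n0 e) (eta_l_diff eta l (Some j))) f z.
Proof.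
move=> ep If; have [sk _ _] := tensor_test heta n0 ep lp.
have [N _ [h1 h2]] := kk_bounded ((0, delta_mx ord0 j) : X) ep.
have [_ dE] := @convol_derive _ _ (kk e) f z (0, delta_mx ord0 j) N If sk h1 h2.
rewrite /dx dE derive_tensor_x//; [exact: theta_smooth|exact: eta_l_smooth].
Qed.

Let convol_ge_c e z : 0 < e -> e <= e0 -> K z -> c <= convol_data e l z iR None.
Proof.
move=> ep ee Kz.
have mth := measurable_theta heta n0 e.
have th0 s := theta_ge0 heta n0 s ep.
have thN s := thetaN heta n0 e s.
have th1 := integral_theta heta n0 ep.
have k0 y : 0 <= eta_l eta l y by exact: eta_l_ge0.
have kN y : eta_l eta l (- y) = eta_l eta l y by exact: eta_lN.
have mk := measurable_eta_l heta l.
apply: (@weighted_lower_bound _ mX mu (g iR) (fun w => kk e (z - w))) => //.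
- exact: L1_measurable (Ig iR).
- by apply: tensor_sub_integrable => //; exact: (eta_l_diff_integrable heta None lp).
- by move=> w; rewrite mulr_ge0.
- by rewrite /Rintegral integral_tensor// integral_eta_l.
- move=> w kw; apply: gB; apply: boxB Kz _ _; rewrite leNgt; apply/negP => h; move/eqP: kw; apply.
    by rewrite /tensor theta_out ?mul0r// (le_trans ee)// ltW.
  by rewrite /tensor (eta_l_out heta lp) ?mulr0// ltW.
Qed.

Let integral_K0 (f : X -> R) : (forall z, ~ K z -> f z = 0) ->
  \int[mu]_(z in K) f z = \int[mu]_z f z.
Proof.
move=> f0; rewrite Rintegral_mkcond; apply: eq_Rintegral => z _.
by rewrite patchE; case: ifPn => //; rewrite notin_setE => /f0.
Qed.

Let flux_phi_out Y z : ~ K z -> flux_phi Y z = 0.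
Proof.
move=> nK; rewrite /flux_phi /fluxY /energy_flux /dt /dx (out_supp nK) !(out_supp_derive _ nK) !mulr0.
rewrite big1; last by move=> j _; rewrite (out_supp_derive _ nK) mulr0.
rewrite big1; last by move=> i _; rewrite big1// => j _; rewrite (out_supp_derive _ nK) mulr0.
by rewrite subr0 !addr0.
Qed.

Let work_phi_out Y z : ~ K z -> work_phi Y z = 0.
Proof. by move=> nK; rewrite /work_phi (out_supp nK) mulr0. Qed.

Let balance_cv e : 0 < e -> e <= e0 ->
  \int[mu]_(z in K) (flux_phi (convol_data e l) z - work_phi (convol_data e l) z) = 0.
Proof.
move=> ep ee; rewrite integral_K0; last first.
  by move=> z nK; rewrite flux_phi_out// work_phi_out// subr0.
rewrite -[RHS](@integral_energy_balance R d p cp Q phi tphi (convol (kk e) (g iR)) (convol (kk e) (g iQ))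
  (fun z i => convol (kk e) (g (iM i)) z) (fun z i => convol (kk e) (g (iF i)) z)
  (fun z i j => convol (kk e) (g (iMM i j)) z) c).
- apply: eq_Rintegral => z _; congr (_ - _ * _).
  congr (stress_work _ _ _ _ _ _ _).
    by apply/funext => j; rewrite convol_dx.
  by apply/funext => i; apply/funext => j; rewrite convol_dx.
- exact: convol_C1b.
- exact: convol_C1b.
- by move=> i; exact: convol_C1b.
- by move=> i j; exact: convol_C1b.
- exact: c0.
- by move=> z; exact: convol_ge_c.
- by move=> z; exact: mass.
- by move=> z i; exact: momentum.
Qed.

(** For each time scale [e] the balance is exact. As [e] tends to 0 with [l] fixed, the spatial
    kernel and its derivatives keep the same ball majorant, and the mass of the space-time majorant
    does not depend on [e]. *)
Lemma integral_flux_work :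
  \int[mu]_(z in K) flux_phi (mollx_data l) z = \int[mu]_(z in K) work_phi (mollx_data l) z.
Proof.
have [N N0 hN] := eta_l_diff_ball_kernel heta lp.
have [If Iw] := mollx_data_integrable lp ll.
suff : \int[mu]_(z in K) (flux_phi (mollx_data l) z - work_phi (mollx_data l) z) = 0.
  by rewrite RintegralB// => /eqP; rewrite subr_eq0 => /eqP.
pose P (t : R * X) := 0 < t.1 <= e0 /\ K t.2.
have mth e := measurable_theta heta n0 e.
have mb' : measurable_fun setT (ball_kernel N l : E -> R) by exact: measurable_ball_kernel.
have Ib (t : R * X) : P t -> mu.-integrable setT
    (EFin \o (fun w => tensor (theta eta n0 t.1) (ball_kernel N l) (t.2 - w))).
  move=> [/andP[ep ee] Kz]; apply: tensor_sub_integrable => //.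
  - by move=> s; exact: theta_ge0.
  - by move=> y; exact: ball_kernel_ge0.
  - by move=> s; exact: thetaN.
  - by move=> y; exact: ball_kernelN.
  - exact: integral_theta.
  - exact/ball_kernel_integrable/ltW.
have b0' (t : R * X) w : P t -> 0 <= tensor (theta eta n0 t.1) (ball_kernel N l) (t.2 - w).
  by move=> [/andP[ep _] _]; rewrite mulr_ge0 ?ball_kernel_ge0 ?theta_ge0.
have [[C1 C10 hC1] [C2 C20 hC2]] :
  dominated P (fun t => fluxY p (fun i o => \int[mu]_w (g i w * tensor (theta eta n0 t.1) (eta_l_diff eta l o) (t.2 - w)))
     (phi t.2) (dt phi t.2) (fun j => dx j phi t.2))
    (fun t => 1 + \int[mu]_w (H w * tensor (theta eta n0 t.1) (ball_kernel N l) (t.2 - w))) /\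
  dominated P (fun t => workY p (fun i o => \int[mu]_w (g i w * tensor (theta eta n0 t.1) (eta_l_diff eta l o) (t.2 - w))) * phi t.2)
    (fun t => 1 + \int[mu]_w (H w * tensor (theta eta n0 t.1) (ball_kernel N l) (t.2 - w))).
  apply: (@pullback_bound _ mX mu (R * X)%type P (fun t w => w)
    (fun t w => tensor (theta eta n0 t.1) (ball_kernel N l) (t.2 - w))
    (fun t o w => tensor (theta eta n0 t.1) (eta_l_diff eta l o) (t.2 - w))
    (\int[lebesgue_rV d]_y ball_kernel N l y) (fun t => phi t.2) (fun t => dt phi t.2) (fun t j => dx j phi t.2)).
  - by move=> t _; exact: measurable_id.
  - by move=> t w; exact: b0'.
  - exact: Ib.
  - move=> t [/andP[ep ee] Kz]; rewrite /Rintegral integral_tensor//.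
    + by move=> s; exact: theta_ge0.
    + by move=> y; exact: ball_kernel_ge0.
    + by move=> s; exact: thetaN.
    + by move=> y; exact: ball_kernelN.
    + exact: integral_theta.
  - move=> t Pt; have [/andP[ep ee] Kz] := Pt; have [M M0 hM] := theta_bounded heta n0 ep.
    apply: (@L1_bounded _ mX R mu setT measurableT H
      (fun w => tensor (theta eta n0 t.1) (ball_kernel N l) (t.2 - w)) (M * N)) => //.
      exact: measurable_tensor_sub.
    by move=> w _; rewrite normrM ler_pM// ger0_norm ?ball_kernel_ge0 ?ball_kernel_le.
  - by move=> t o _; apply: measurable_tensor_sub => //; exact: measurable_eta_l_diff.
  - move=> t o w [/andP[ep ee] Kz]; rewrite normrM [X in X * _]ger0_norm ?theta_ge0//.
    by rewrite ler_wpM2l ?theta_ge0// hN.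
  - by move=> t [/andP[ep ee] Kz]; exact: convol_ge_c.
  - by apply: (dominated_pull (zt := snd) (dominated_test tphi)) => t [].
  - by apply: (dominated_pull (zt := snd) (dominated_test_derive tphi _)) => t [].
  - by move=> i; apply: (dominated_pull (zt := snd) (dominated_test_derive tphi _)) => t [].
(* All fields with their first space derivatives, since the work involves gradients; [None] is again
   the averaged weight. *)
pose I : finType := option (component d * option 'I_d).
pose Y (e : R) (i : I) : X -> R :=
  if i is Some (j, o) then fun z => convol_data e l z j o else convol (tensor (theta eta n0 e) (ball_kernel N l)) H.
pose Y0 (i : I) : X -> R := if i is Some (j, o) then fun z => mollx_data l z j o else mollx (ball_kernel N l) H.
have convol_eqH e : 0 < e -> convol (tensor (theta eta n0 e) (ball_kernel N l)) H = mollt (theta eta n0 e) (mollx (ball_kernel N l) H).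
  move=> ep; have [M1 _ hM1] := theta_bounded heta n0 ep.
  have hb (y : E) : `|ball_kernel N l y| <= N by rewrite ger0_norm ?ball_kernel_ge0 ?ball_kernel_le.
  by apply/funext => z; rewrite (convol_tens z IH (mth e) hM1 mb' hb).
have YE e i : 0 < e -> Y e i = mollt (theta eta n0 e) (Y0 i).
  by move=> ep; case: i => [[j o]|]; [exact: convol_eq|exact: convol_eqH].
have IY0 i : mu.-integrable setT (EFin \o Y0 i).
  case: i => [[j o]|]; apply: mollx_L1 => //; last exact/ball_kernel_integrable/ltW.
  exact: eta_l_diff_integrable.
have mY0 i : measurable_fun [set: mX] (Y0 i) by exact: L1_measurable (IY0 i).
have mY e i : 0 < e -> measurable_fun [set: mX] (Y e i).
  by move=> ep; rewrite YE//; apply: measurable_mollt.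
have [] := @dominated_cvg_at0 _ mX R mu K mK I Y Y0 (fun e z => flux_phi (convol_data e l) z - work_phi (convol_data e l) z)
  (fun z => flux_phi (mollx_data l) z - work_phi (mollx_data l) z) None (C1 + C2) e0 fK e0p (addr_ge0 C10 C20).
- by move=> e i /andP[ep _]; apply: measurable_funTS; exact: mY.
- by move=> i; apply: integrableS (IY0 i).
- move=> i e ep; have [r r0 hr] := mollt_theta_cvg heta n0 (IY0 i) ep; exists r => // s /andP[sp _] sr.
  apply: le_integral_K; first by apply: measurable_funB => //; exact: mY.
  by rewrite YE//; exact: hr.
- move=> e /andP[ep _]; apply: measurable_funTS; apply: measurable_funB.
    by apply: measurable_flux_phi => i o; exact: (mY e (Some (i, o)) ep).
  by apply: measurable_work_phi => i o; exact: (mY e (Some (i, o)) ep).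
- apply: measurable_funTS; apply: measurable_funB.
    by apply: measurable_flux_phi => i o; exact: (mY0 (Some (i, o))).
  by apply: measurable_work_phi => i o; exact: (mY0 (Some (i, o))).
- apply: (aeW mu) => z Kz v hv hY.
  have sm0 : 0 < mollx_data l z iR None by apply: lt_le_trans c0 (mollx_data_ge lp ll Kz).
  apply: cvgB.
    apply: (@cvg_flux_phi nat \oo _ (fun n i (o : option 'I_d) => convol_data (v n) l z i o) _ z _ sm0).
    by move=> i o; exact: (hY (Some (i, o))).
  apply: (@cvg_work_phi nat \oo _ (fun n i (o : option 'I_d) => convol_data (v n) l z i o) _ z _ sm0).
  by move=> i o; exact: (hY (Some (i, o))).
- apply: (aeW mu) => z Kz e he; rewrite mulrDl; apply: le_trans (ler_normB _ _) _.
  by apply: lerD; [exact: (hC1 (e, z))|exact: (hC2 (e, z))].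
move=> _ /cvg_lim <- //.
(* The integrals vanish for every [e] up to [e0], so their limit is 0. *)
apply: cvg_lim => //; apply: cvg_near_cst.
near=> e; apply: balance_cv; near: e; [exact: nbhs_right_gt|exact: nbhs_right_le].
Unshelve. all: by end_near. Qed.

End balance.

(** The slots of the test function and its derivatives are independent, so that setting all but one
    of them to 0 isolates a single term of the defect. *)
Lemma flux_integrable (ph pht : X -> R) (phx : X -> 'I_d -> R) : 0 <= l0 ->
  measurable_fun [set: mX] ph -> measurable_fun [set: mX] pht ->
  (forall j, measurable_fun [set: mX] (phx ^~ j)) ->
  dominated K ph (cst 1) -> dominated K pht (cst 1) ->
  (forall j, dominated K (phx ^~ j) (cst 1)) ->
  mu.-integrable K (EFin \o (fun z => fluxY p (fun i _ => g i z) (ph z) (pht z) (phx z))).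
Proof.
move=> l00 mph mpht mphx bph bpht bphx.
have KB z : K z -> B z.
  by move=> Kz; rewrite [z]surjective_pairing; apply: l0B => //=; rewrite subrr normr0.
have dC (h h' : X -> R) : (forall z, `|h z| <= C0 * h' z) -> dominated K h h'.
  by move=> hh; exists C0.
have dq : dominated K (fun z => g iQ z) (cst 1) by exists C0 => // z _; rewrite mulr1 gQ.
have [C CC hC] := @energy_flux_dominated R d p cp X K (fun z => g iR z) (fun z => g iQ z)
  (fun z i => g (iM i) z) (fun z i => g (iF i) z) (fun z i j => g (iMM i j) z) ph pht phx
  a (fun z => a z ^+ 2) b c C0 (fun z _ => a0 z) (fun z _ => sqr_ge0 (a z)) (fun z _ => b0 z) c0
  (fun z Kz => gB (KB z Kz)) (fun z _ => le_trans (ler_norm _) (gR z))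
  dq
  (fun i => dC _ _ (gM i)) (fun i => dC _ _ (gF i)) (fun i j => dC _ (fun z => a z ^+ 2) (gMM i j)) bph bpht bphx.
(* (1 + a)^3 <= 4 + 4 a^3, so the majorant is at most 4 + 5 a^3 + b a; both a^3 and b a are at most
   2 H, which gives 4 + 12 H. *)
apply: (@L1_le _ mX R mu K mK _ (fun z => C * (12 * (1 + H z)))).
- have mgi i : measurable_fun [set: mX] (g i) by exact: L1_measurable (Ig i).
  apply: measurable_funTS; apply: (@measurable_energy_flux R d p cp _ mX setT (fun z => g iR z) (fun z => g iQ z)
    (fun z i => g (iM i) z) (fun z i => g (iF i) z) (fun z i j => g (iMM i j) z)) => // *; exact: mgi.
- move=> z Kz; apply: le_trans (hC z Kz) _; rewrite ler_wpM2l//.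
  have h0 := H0 z; have h1 := aaH z z; have h2 := baH z z; have h3 := a0 z.
  have : 0 <= (1 + a z) * (a z - 1) ^+ 2 by rewrite mulr_ge0 ?sqr_ge0 ?addr_ge0.
  have -> : (1 + a z) * (a z - 1) ^+ 2 = 1 - a z - a z ^+ 2 + a z ^+ 2 * a z by ring.
  have -> : (1 + a z) ^+ 3 = 1 + 3 * a z + 3 * a z ^+ 2 + a z ^+ 2 * a z by ring.
  lra.
- apply: L1Z => //; apply: L1Z => //; apply: L1D => //; first exact: L1_cst.
  exact: (@integrableS _ _ _ _ setT).
Qed.

End data.

(** * Sets of measure zero *)

Section integral_without_measurability.
Context d (T : measurableType d) (R : realType) (mu : {measure set T -> \bar R}).

(** The integral of a nonnegative function is a supremum over the simple functions below it, which
    is monotone for arbitrary functions. *)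
Lemma le_integral_nonmeasurable (f g : T -> \bar R) : (forall x, 0 <= f x)%E ->
  (forall x, f x <= g x)%E -> (\int[mu]_x f x <= \int[mu]_x g x)%E.
Proof.
move=> f0 fg; rewrite !ge0_integralTE//; last by move=> x; exact: le_trans (fg x).
by apply: le_ereal_sup => _ [h hf <-]; exists h => // x; exact: le_trans (hf x) (fg x).
Qed.

(** On the null set [f] is squeezed between 0 and infinity; the two measurable functions obtained
    have the same integral as [g]. *)
Let ge0_ae_eq_nonmeasurable (f g : T -> \bar R) (N : set T) : measurable N -> mu N = 0%E ->
  (forall x, 0 <= f x)%E -> (forall x, 0 <= g x)%E -> measurable_fun setT g ->
  (forall x, ~ N x -> f x = g x) -> (\int[mu]_x f x = \int[mu]_x g x)%E.
Proof.
move=> mN N0 f0 g0 mg fg.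
pose lo x : \bar R := if x \in N then 0%E else g x.
pose hi x : \bar R := if x \in N then +oo%E else g x.
have mN' : measurable_fun setT (fun x => x \in N).
  apply: (measurable_fun_bool true); rewrite setTI (_ : _ @^-1` _ = N)//.
  by apply/seteqP; split => x /=; [move/set_mem|move=> Nx; exact: mem_set].
have mlo : measurable_fun setT lo.
  by apply: measurable_fun_if => //; exact: measurable_funTS.
have mhi : measurable_fun setT hi.
  by apply: measurable_fun_if => //; exact: measurable_funTS.
have lo0 x : (0 <= lo x)%E by rewrite /lo; case: ifP.
have hi0 x : (0 <= hi x)%E by rewrite /hi; case: ifP => // _; exact: leey.
have E (h : T -> \bar R) : measurable_fun setT h -> (forall x, 0 <= h x)%E ->
    (forall x, ~ N x -> h x = g x) -> (\int[mu]_x h x = \int[mu]_x g x)%E.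
  move=> mh h0 hg; apply: ge0_ae_eq_integral => //.
  by exists N; split => // x /= nh; apply: contrapT => nN; apply: nh => _; exact: hg.
apply/eqP; rewrite eq_le; apply/andP; split.
- rewrite -(E hi)//; last by move=> x nx; rewrite /hi memNset.
  apply: le_integral_nonmeasurable => // x; rewrite /hi; case: ifPn => [_|]; first exact: leey.
  by rewrite notin_setE => /fg ->.
- rewrite -(E lo)//; last by move=> x nx; rewrite /lo memNset.
  apply: le_integral_nonmeasurable => // x; rewrite /lo; case: ifPn => [_|] //.
  by rewrite notin_setE => /fg ->.
Qed.

(* No measurability of f: J1 and J2 contain directional derivatives that exist only for almost
   every time. *)
Lemma ae_eq_Rintegral (D : set T) (f g : T -> R) : measurable D -> measurable_fun D g ->
  {ae mu, forall x, D x -> f x = g x} -> \int[mu]_(x in D) f x = \int[mu]_(x in D) g x.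
Proof.
move=> mD mg [N [mN N0 sub]]; congr fine.
have mG : measurable_fun setT ((EFin \o g) \_ D).
  by apply/measurable_restrict => //; rewrite setIidr//; exact/measurable_EFinP.
have fg x : ~ N x -> ((EFin \o f) \_ D) x = ((EFin \o g) \_ D) x.
  move=> nN; rewrite !patchE; case: ifPn => // /[!inE] Dx /=; congr EFin.
  by apply: contrapT => h; apply: nN; apply: sub => /= /(_ Dx).
rewrite integral_mkcond [RHS]integral_mkcond integralE [RHS]integralE; congr (_ - _)%E.
- apply: (ge0_ae_eq_nonmeasurable mN N0) => //; first exact: measurable_funepos.
  by move=> x /fg; rewrite !funeposE => ->.
- apply: (ge0_ae_eq_nonmeasurable mN N0) => //; first exact: measurable_funeneg.
  by move=> x /fg; rewrite !funenegE => ->.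
Qed.

End integral_without_measurability.

(** The product measure of a null set is the integral of the measures of its sections, so almost
    every section is null. *)
Lemma ae_xsection d1 d2 (T1 : measurableType d1) (T2 : measurableType d2) (R : realType)
    (m1 : {measure set T1 -> \bar R}) (m2 : {sigma_finite_measure set T2 -> \bar R})
    (P : T1 * T2 -> Prop) : {ae (m1 \x m2)%E, forall z, P z} ->
  {ae m1, forall t, {ae m2, forall y, P (t, y)}}.
Proof.
move=> [N [mN N0 sub]].
have [M [mM M0 subM]] : {ae m1, forall t, setT t -> m2 (xsection N t) = cst 0%E t}.
  apply/(ae_eq_integral_abs m1 measurableT); first exact: measurable_fun_xsection.
  by rewrite -[RHS]N0; apply: eq_integral => t _; rewrite gee0_abs.
exists M; split => // t /= nt; apply: subM => /= h; apply: nt.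
exists (xsection N t); split; [exact: measurable_xsection|exact: h|].
by move=> y /= nP; rewrite /xsection/= inE; exact: sub.
Qed.

(** Agreement is needed along one line only. The mollified fields are compared at a single good
    time, never on a full space-time neighbourhood. *)
Lemma derive_eq_line (R : realType) (V : normedModType R) (f g : V -> R) z v :
  (\forall h \near (0 : R), f (h *: v + z) = g (h *: v + z)) ->
  'D_v f z = 'D_v g z.
Proof.
move=> fg; have E0 : (0 : R) *: v + z = z by rewrite scale0r add0r.
have := derive_line z v f 0; have := derive_line z v g 0; rewrite E0 => <- <-.
exact: near_eq_derive.
Qed.

Lemma compact_uniform_nbhs (R : realType) (V : normedModType R) (K U : set V) :
  compact K -> open U -> K `<=` U ->
  exists2 r, 0 < r & forall z w, K z -> `|z - w| <= r -> U w.
Proof.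
move=> /compact_near_coveringP cK oU KU.
have := cK R (0^'+) (fun r z => forall w, `|z - w| <= r -> U w) _.
case/(_ _ _)/wrap; last first.
  move=> h; have : \forall r \near 0^'+, 0 < r /\ (K `<=` (fun z => forall w, `|z - w| <= r -> U w)).
    by near=> r; split; near: r; [exact: nbhs_right_gt|exact: h].
  by move=> /filter_ex[r [r0 rh]]; exists r => // z w Kz; exact: rh.
move=> z Kz; have /nbhs_ballP[e e0 eU] : nbhs z U by apply: open_nbhs_nbhs; split => //; exact: KU.
have e2 : 0 < e / 2 by rewrite divr_gt0.
near=> z' r.
have re : r <= e / 2 by near: r; exact: nbhs_right_le.
have ze : `|z - z'| < e / 2 by near: z'; apply/nbhs_ballP; exists (e / 2) => //= y; rewrite -ball_normE.
move=> w /= zw; apply: eU; rewrite -ball_normE/=.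
rewrite (splitr e) -(subrKA z') (le_lt_trans (ler_normD _ _))// ltr_leD//.
exact: le_trans re.
Unshelve. all: by end_near. Qed.

(** * Truncated data *)

Section clean_data.
Context {R : realType} {d : nat} (p : R -> R).
Hypothesis cp : continuous p.
Local Notation E := 'rV[R]_d.
Local Notation X := (R * E)%type.
Local Notation mX := (measurableTypeR R * E)%type.
Local Notation mu := (lebesgue_tx R d).

Let measurable_sqrt : measurable_fun [set: measurableTypeR R] (@Num.sqrt R).
Proof. by apply: continuous_measurable_fun; exact: sqrt_continuous. Qed.

(** Induction with (x + S)^3 <= 4 x^3 + 4 S^3, where the difference is 3 (x + S) (x - S)^2. *)
Lemma sum_cube_le (I : Type) (s : seq I) : exists2 C : R, 0 <= C & forall x : I -> R,
  (forall i, 0 <= x i) -> (\sum_(i <- s) x i) ^+ 3 <= C * \sum_(i <- s) x i ^+ 3.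
Proof.
elim: s => [|i s [C C0 IH]].
  by exists 0 => // x x0; rewrite !big_nil mul0r expr0n.
exists (4 + 4 * C); first by rewrite addr_ge0// mulr_ge0.
move=> x x0; rewrite !big_cons.
set S := \sum_(j <- s) x j; set S3 := \sum_(j <- s) x j ^+ 3.
have S0 : 0 <= S by exact: sumr_ge0.
have S30 : 0 <= S3 by apply: sumr_ge0 => j _; exact: exprn_ge0.
have xi := x0 i; have hS : S ^+ 3 <= C * S3 by exact: IH.
have x3 : 0 <= x i ^+ 3 by exact: exprn_ge0.
have : 0 <= 3 * (x i + S) * (x i - S) ^+ 2 by apply: mulr_ge0; [rewrite mulr_ge0// addr_ge0|exact: sqr_ge0].
have -> : 3 * (x i + S) * (x i - S) ^+ 2 = 4 * x i ^+ 3 + 4 * S ^+ 3 - (x i + S) ^+ 3 by ring.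
have -> : (4 + 4 * C) * (x i ^+ 3 + S3) = 4 * x i ^+ 3 + 4 * (C * S3) + (4 * S3 + 4 * C * x i ^+ 3) by ring.
have : 0 <= 4 * S3 + 4 * C * x i ^+ 3 by rewrite addr_ge0 ?mulr_ge0.
lra.
Qed.

Variables (Q B : set X) (rho : X -> R) (u f : X -> E) (c C Cp : R).

(** The density is a parameter: [rho] itself gives the fields of the equations, the clamped density
    the truncated ones. *)
Definition conserved (r : X -> R) (i : component d) : X -> R :=
  match i with
  | inl true => r
  | inl false => fun z => p (r z)
  | inr (inl (true, i)) => fun z => r z * u z ord0 i
  | inr (inl (false, i)) => fun z => r z * f z ord0 i
  | inr (inr (i, j)) => fun z => r z * otimes (u z) (u z) i j
  end.

(* Clamping the density makes its bounds hold everywhere, hence for every average. *)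
Definition clamp z := Num.max c (Num.min C (rho z)).
Definition truncated i : X -> R := conserved clamp i \_ B.
Definition speed : X -> R := (fun z => \sum_i `|u z ord0 i|) \_ B.
(** With square roots the power 3/2 of the force becomes a cube, and force times speed has the form
    s^2 t, just like speed squared times speed; one Young inequality then serves both. *)
Definition sqforce : X -> R := (fun z => \sum_i Num.sqrt `|f z ord0 i|) \_ B.
Definition force z := sqforce z ^+ 2.
Definition weight z := speed z ^+ 3 + sqforce z ^+ 3.

Hypotheses (mQ : measurable (Q : set mX)) (mB : measurable (B : set mX)) (BQ : B `<=` Q)
  (fB : (mu B < +oo)%E) (c0 : 0 < c) (cC : c <= C) (Cp0 : 0 <= Cp)
  (pC : forall r, c <= r <= C -> `|p r| <= Cp).
Hypotheses (mrho : measurable_fun (Q : set mX) rho)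
  (mu_ : forall i, measurable_fun (Q : set mX) (fun z => u z ord0 i))
  (mf : forall i, measurable_fun (Q : set mX) (fun z => f z ord0 i)).
Hypotheses (Iu : forall i, mu.-integrable Q (EFin \o (fun z => `|u z ord0 i| ^+ 3)))
  (If : forall i, mu.-integrable Q (EFin \o (fun z => Num.sqrt `|f z ord0 i| ^+ 3))).

Lemma speed_ge0 z : 0 <= speed z.
Proof. by rewrite /speed patchE; case: ifP => // _; exact: sumr_ge0. Qed.

Lemma sqforce_ge0 z : 0 <= sqforce z.
Proof. by rewrite /sqforce patchE; case: ifP => // _; apply: sumr_ge0 => i _; exact: sqrtr_ge0. Qed.

Lemma force_ge0 z : 0 <= force z.
Proof. exact: sqr_ge0. Qed.

Lemma weight_ge0 z : 0 <= weight z.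
Proof. by rewrite addr_ge0// exprn_ge0// ?speed_ge0// sqforce_ge0. Qed.

Let cube1 (x : R) : 0 <= x -> x <= 1 + x ^+ 3 /\ x ^+ 2 <= 1 + x ^+ 3.
Proof.
move=> x0; have h : 0 <= (1 + x) * (x - 1) ^+ 2 by rewrite mulr_ge0 ?sqr_ge0 ?addr_ge0.
have x2 : 0 <= x ^+ 2 by exact: sqr_ge0.
have e : (1 + x) * (x - 1) ^+ 2 = 1 - x - x ^+ 2 + x ^+ 3 by ring.
by rewrite e in h; split; lra.
Qed.

Let young (x y : R) : 0 <= x -> 0 <= y -> x ^+ 2 * y <= x ^+ 3 + y ^+ 3.
Proof.
move=> x0 y0; have x3 : 0 <= x ^+ 3 by exact: exprn_ge0. have y3 : 0 <= y ^+ 3 by exact: exprn_ge0.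
have [xy|yx] := lerP x y.
  have : x ^+ 2 * y <= y ^+ 2 * y by rewrite ler_wpM2r// ler_sqr.
  by rewrite -exprSr; lra.
have : x ^+ 2 * y <= x ^+ 2 * x by rewrite ler_wpM2l ?sqr_ge0// ltW.
by rewrite -exprSr; lra.
Qed.

Let speed3 z : 0 <= speed z ^+ 3. Proof. exact/exprn_ge0/speed_ge0. Qed.
Let sqforce3 z : 0 <= sqforce z ^+ 3. Proof. exact/exprn_ge0/sqforce_ge0. Qed.

Lemma speed_le z : speed z <= 1 + weight z.
Proof. by have [h _] := cube1 (speed_ge0 z); rewrite /weight; have := sqforce3 z; lra. Qed.

Lemma speed2_le z : speed z ^+ 2 <= 1 + weight z.
Proof. by have [_ h] := cube1 (speed_ge0 z); rewrite /weight; have := sqforce3 z; lra. Qed.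

Lemma force_le z : force z <= 1 + weight z.
Proof. by have [_ h] := cube1 (sqforce_ge0 z); rewrite /force /weight; have := speed3 z; lra. Qed.

Lemma speed2M_le w s : speed w ^+ 2 * speed s <= weight w + weight s.
Proof.
apply: le_trans (young (speed_ge0 w) (speed_ge0 s)) _; rewrite /weight.
by have := sqforce3 w; have := sqforce3 s; lra.
Qed.

Lemma forceM_le w s : force w * speed s <= weight w + weight s.
Proof.
apply: le_trans (young (sqforce_ge0 w) (speed_ge0 s)) _; rewrite /weight.
by have := speed3 w; have := sqforce3 s; lra.
Qed.

Let clampP z : c <= clamp z <= C.
Proof. by rewrite /clamp le_max lexx/= ge_max cC ge_min lexx. Qed.

Let clamp_abs z : `|clamp z| <= C.
Proof.
have /andP[h1 h2] := clampP z; rewrite ger0_norm//.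
exact: le_trans (ltW c0) h1.
Qed.

Let C00 : 0 <= C. Proof. exact: le_trans (ltW c0) cC. Qed.

Lemma truncatedR_bound z : `|truncated (inl true) z| <= C + Cp.
Proof.
rewrite /truncated patchE; case: ifP => _; last by rewrite normr0 addr_ge0.
by rewrite (le_trans (clamp_abs z))// lerDl.
Qed.

Lemma truncatedQ_bound z : `|truncated (inl false) z| <= C + Cp.
Proof.
rewrite /truncated patchE; case: ifP => _; last by rewrite normr0 addr_ge0.
by rewrite (le_trans (pC (clampP z)))// lerDr.
Qed.

Let u_le z i : z \in B -> `|u z ord0 i| <= speed z.
Proof. by move=> Bz; rewrite /speed patchE Bz (bigD1 i)//= lerDl sumr_ge0. Qed.

Let CC (x y : R) : 0 <= y -> x <= C * y -> x <= (C + Cp) * y.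
Proof. by move=> y0 /le_trans; apply; rewrite ler_wpM2r// lerDl. Qed.

Lemma truncatedM_bound i z : `|truncated (inr (inl (true, i))) z| <= (C + Cp) * speed z.
Proof.
apply: CC; first exact: speed_ge0.
rewrite /truncated patchE; case: ifPn => Bz; last by rewrite normr0 mulr_ge0// speed_ge0.
by rewrite normrM ler_pM// u_le.
Qed.

Lemma truncatedF_bound i z : `|truncated (inr (inl (false, i))) z| <= (C + Cp) * force z.
Proof.
apply: CC; first exact: force_ge0.
rewrite /truncated patchE; case: ifPn => Bz; last by rewrite normr0 mulr_ge0// force_ge0.
rewrite normrM ler_pM// /force -[leLHS]sqr_sqrtr// ler_sqr ?nnegrE ?sqrtr_ge0 ?sqforce_ge0//.
rewrite /sqforce patchE Bz (bigD1 i)//= lerDl sumr_ge0// => j _; exact: sqrtr_ge0.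
Qed.

Lemma truncatedMM_bound i j z : `|truncated (inr (inr (i, j))) z| <= (C + Cp) * speed z ^+ 2.
Proof.
apply: CC; first exact: sqr_ge0.
rewrite /truncated patchE; case: ifPn => Bz; last by rewrite normr0 mulr_ge0// sqr_ge0.
rewrite normrM ler_pM// /otimes mxE big_ord1 !mxE normrM expr2.
by rewrite ler_pM// u_le.
Qed.

Lemma truncated_lower z : B z -> c <= truncated (inl true) z.
Proof. by move=> Bz; rewrite /truncated patchE mem_set//; have /andP[] := clampP z. Qed.

Lemma truncated_out i z : ~ B z -> truncated i z = 0.
Proof. by move=> nB; rewrite /truncated patchE memNset. Qed.

Let mS (h : X -> R) : measurable_fun (Q : set mX) h -> measurable_fun (B : set mX) h.
Proof. by move=> mh; exact: measurable_funS mh. Qed.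

Let mpatch (h : X -> R) : measurable_fun (B : set mX) h -> measurable_fun [set: mX] (h \_ B).
Proof. by move=> mh; apply/(measurable_restrict _ mB measurableT); rewrite setTI. Qed.

Lemma measurable_conserved (A : set X) r i : measurable (A : set mX) ->
  measurable_fun (A : set mX) r ->
  (forall i, measurable_fun (A : set mX) (fun z => u z ord0 i)) ->
  (forall i, measurable_fun (A : set mX) (fun z => f z ord0 i)) ->
  measurable_fun (A : set mX) (conserved r i).
Proof.
move=> mA mr muA mfA; case: i => [[|]|[[[|] i]|[i j]]] /=.
- exact: mr.
- by apply: measurableT_comp mr => //; exact: continuous_measurable_fun.
- exact: measurable_funM.
- exact: measurable_funM.
- apply: measurable_funM => //; under eq_fun do rewrite /otimes mxE big_ord1 !mxE.
  exact: measurable_funM.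
Qed.

Let mclamp : measurable_fun (B : set mX) clamp.
Proof.
apply: measurable_maxr; first exact: measurable_cst.
by apply: measurable_minr; [exact: measurable_cst|exact: mS].
Qed.

Let measurable_truncated i : measurable_fun [set: mX] (truncated i).
Proof.
by apply: mpatch; apply: measurable_conserved => // j; exact: mS.
Qed.

Lemma measurable_speed : measurable_fun [set: mX] speed.
Proof.
by apply: mpatch; apply: measurable_sum => i; apply: measurableT_comp => //; exact: mS.
Qed.

Let measurable_sqforce : measurable_fun [set: mX] sqforce.
Proof.
apply: mpatch; apply: measurable_sum => i.
apply: (measurableT_comp measurable_sqrt); apply: measurableT_comp => //; exact: mS.
Qed.

Lemma measurable_force : measurable_fun [set: mX] force.
Proof. by apply: measurable_funX. Qed.

Let I3 (h : 'I_d -> X -> R) : (forall i z, 0 <= h i z) ->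
  (forall i, measurable_fun (Q : set mX) (h i)) ->
  (forall i, mu.-integrable Q (EFin \o (fun z => h i z ^+ 3))) ->
  mu.-integrable setT (EFin \o (fun z => ((fun z => \sum_i h i z) \_ B) z ^+ 3)).
Proof.
move=> h0 mh Ih; have [K K0 hK] := sum_cube_le (index_enum 'I_d).
have IB : mu.-integrable B (EFin \o (fun z => (\sum_i h i z) ^+ 3)).
  apply: (@L1_le _ mX R mu B mB _ (fun z => K * \sum_i h i z ^+ 3)).
  - by apply: measurable_funX; apply: measurable_sum => i; exact: mS.
  - by move=> z _; rewrite ger0_norm ?exprn_ge0 ?sumr_ge0// hK.
  - apply: L1Z => //; apply: L1_sum => // i; exact: integrableS (Ih i).
rewrite (_ : (EFin \o _) = (EFin \o (fun z => (\sum_i h i z) ^+ 3)) \_ B).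
  by apply/(integrable_mkcond _ mB).
by apply/funext => z /=; rewrite !patchE; case: ifP => // _; rewrite expr0n.
Qed.

Lemma weight_integrable : mu.-integrable setT (EFin \o weight).
Proof.
apply: L1D => //; apply: I3 => //.
- by move=> i; apply: measurableT_comp => //; exact: mu_.
- by move=> i; apply: (measurableT_comp measurable_sqrt); apply: measurableT_comp => //; exact: mf.
Qed.

Lemma truncated_integrable i : mu.-integrable setT (EFin \o truncated i).
Proof.
have CC0 : 0 <= C + Cp by rewrite addr_ge0.
apply: (@L1_le _ mX R mu setT measurableT _ (fun z => (C + Cp) * (\1_B z + weight z))) => //.
- move=> z _; have [Bz|nB] := pselect (B z); last first.
    by rewrite truncated_out// normr0 mulr_ge0// addr_ge0// weight_ge0.
  rewrite indicE mem_set//=; have w0 := weight_ge0 z.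
  case: i => [[|]|[[[|] i]|[i j]]].
  - by rewrite (le_trans (truncatedR_bound z))// -[leLHS]mulr1 ler_wpM2l// lerDl.
  - by rewrite (le_trans (truncatedQ_bound z))// -[leLHS]mulr1 ler_wpM2l// lerDl.
  - by rewrite (le_trans (truncatedM_bound i z))// ler_wpM2l// speed_le.
  - by rewrite (le_trans (truncatedF_bound i z))// ler_wpM2l// force_le.
  - by rewrite (le_trans (truncatedMM_bound i j z))// ler_wpM2l// speed2_le.
- apply: L1Z => //; apply: L1D => //; last exact: weight_integrable.
  exact: L1_indic.
Qed.

Lemma truncated_admissible : admissible truncated speed force weight (C + Cp) c B.
Proof.
split.
- by rewrite addr_ge0.
- exact: c0.
- exact: truncated_integrable.
- exact: weight_integrable.
- exact: measurable_speed.
- exact: measurable_force.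
- exact: speed_ge0.
- exact: force_ge0.
- exact: weight_ge0.
- exact: speed_le.
- exact: speed2_le.
- exact: force_le.
- exact: speed2M_le.
- exact: forceM_le.
- exact: truncatedR_bound.
- exact: truncatedQ_bound.
- exact: truncatedM_bound.
- exact: truncatedF_bound.
- exact: truncatedMM_bound.
- exact: truncated_lower.
Qed.

Lemma truncated_conserved : {ae mu, forall z, Q z -> c <= rho z <= C} ->
  {ae mu, forall z, B z -> forall i, truncated i z = conserved rho i z}.
Proof.
move=> [N [mN N0 sub]]; exists N; split => // z nz; apply: sub => /= h; apply: nz => Bz i.
have /andP[h1 h2] := h (BQ Bz).
have E1 : clamp z = rho z by rewrite /clamp min_r// max_r.
rewrite /truncated patchE mem_set//; case: i => [[|]|[[[|] i]|[i j]]] /=; by rewrite E1.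
Qed.

End clean_data.

(** * The mollified equations *)

Lemma derive_oppv (R : realType) (V : normedModType R) (f : V -> R) x v :
  derivable f x v -> 'D_(- v) f x = - 'D_v f x.
Proof.
move=> df; pose h (s : R) := f (s *: v + x).
have E0 : (0 : R) *: v + x = x by rewrite scale0r add0r.
have dh : is_derive (- 0 : R) 1 h ('D_v f x).
  by rewrite oppr0; apply: DeriveDef; [rewrite derivable_line E0|rewrite derive_line E0].
have [_ ] := is_derive1_comp dh (is_deriveNid (0 : R) 1).
rewrite mulrN1 => <-.
have := derive_line x (- v) f 0; rewrite scale0r add0r => <-.
rewrite (_ : (fun h0 : R => _) = h \o -%R)//.
by apply/funext => s; rewrite /h /= scalerN scaleNr.
Qed.

Section mollified_equations.
Context {R : realType} {d : nat} (p : R -> R).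
Hypothesis cp : continuous p.
Local Notation E := 'rV[R]_d.
Local Notation X := (R * E)%type.
Local Notation mX := (measurableTypeR R * E)%type.
Local Notation mu := (lebesgue_tx R d).
Variables (eta : E -> R) (heta : radial_kernel eta) (n0 : (0 < d)%N).

Variables (Q B : set X) (rho : X -> R) (u f : X -> E) (g : component d -> X -> R).
Hypotheses (mQ : measurable (Q : set mX)) (BQ : B `<=` Q).
Hypothesis Ig : forall i, mu.-integrable setT (EFin \o g i).
Hypothesis g_out : forall i z, ~ B z -> g i z = 0.
Hypothesis g_raw : {ae mu, forall z, B z -> forall i, g i z = conserved p u f rho i z}.

(** Where [k] is nonzero, the given and the truncated fields agree almost everywhere, so testing on
    [Q] becomes an integral over the whole space. *)
Lemma integral_conserved i (k : X -> R) : measurable_fun [set: mX] k ->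
  (forall w, ~ B w -> k w = 0) ->
  \int[mu]_(w in Q) (conserved p u f rho i w * k w) = \int[mu]_w (g i w * k w).
Proof.
move=> mk k0; transitivity (\int[mu]_(w in Q) (g i w * k w)).
  apply: ae_eq_Rintegral => //.
    apply: measurable_funM; apply: measurable_funTS => //.
    exact: L1_measurable (Ig i).
  move: g_raw => [N [mN N0 sub]]; exists N; split => // w nw; apply: sub => /= h; apply: nw => Qw.
  by have [Bw|nB] := pselect (B w); [rewrite (h Bw)|rewrite k0// !mulr0].
rewrite Rintegral_mkcond; apply: eq_Rintegral => w _.
rewrite patchE; case: ifPn => //; rewrite notin_setE => nQ.
by rewrite k0 ?mulr0// => /BQ.
Qed.

Variables (e l : R) (z : X).
Hypotheses (ep : 0 < e) (lp : 0 < l).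
Hypothesis boxB : forall w, `|z.1 - w.1| <= e -> `|z.2 - w.2| <= l -> B w.
Let kk : X -> R := tensor (theta eta n0 e) (eta_l eta l).
Let psi (w : X) := kk (z - w).

Let tk : test_function setT kk. Proof. exact: tensor_test. Qed.
Let sk : smooth kk. Proof. by case: tk. Qed.

Let LL (w v : X) (h : R) : z - (h *: v + w) = h *: (- v) + (z - w).
Proof. by rewrite scalerN opprD addrCA. Qed.

Let Dpsi v : 'D_v psi = fun w => - 'D_v kk (z - w).
Proof.
apply/funext => w; rewrite -derive_oppv; last exact: smooth_derivable.
exact: (derive_affine LL kk w v).
Qed.

Let psi_out w : ~ B w -> psi w = 0.
Proof. by move=> nB; apply: tensor_out => // -[h1 h2]; apply: nB; exact: boxB. Qed.

Let Dkk_out v w : ~ B w -> 'D_v kk (z - w) = 0.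
Proof.
move=> nB; apply: out_supp_derive => h.
have [] := supp_subset (@closed_tx_box _ d e l) (fun z => @tensor_out R d eta heta n0 e l z ep lp) h.
by move=> h1 h2; apply: nB; exact: boxB.
Qed.

Lemma shifted_test : test_function Q psi.
Proof.
have cbox : compact ((fun w : X => z - w) @` [set w : X | `|w.1| <= e /\ `|w.2| <= l]).
  apply: continuous_compact; last exact: compact_tx_box.
  by apply: continuous_subspaceT; exact: continuous_subl.
have sub : supp psi `<=` (fun w : X => z - w) @` [set w : X | `|w.1| <= e /\ `|w.2| <= l].
  apply: supp_subset; first exact: compact_closed.
  move=> w nw; apply: tensor_out => // h; apply: nw; exists (z - w) => //.
  by rewrite opprB addrC subrK.
split.
- by apply: (smooth_affine LL _ sk); exact: continuous_subl.
- by apply: (subclosed_compact (@closed_closure _ _)); last exact: sub.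
- move=> w /sub[v [v1 v2] <-]; apply: BQ; apply: boxB => /=.
    by rewrite opprB addrC subrK.
  by rewrite opprB addrC subrK.
Qed.

Lemma distr_conserved i : distr Q (conserved p u f rho i) psi = convol kk (g i) z.
Proof.
apply: integral_conserved => //; apply: measurable_convol_kernel; exact: smooth_continuous.
Qed.

(** Two signs cancel: that of the distributional derivative, and that of differentiating the kernel
    at z - w with respect to w. *)
Lemma distr_conserved_derive i v : - distr Q (conserved p u f rho i) ('D_v psi) = 'D_v (convol kk (g i)) z.
Proof.
have [M M0 hM] := test_function_bounded tk.
have [N N0 hN] := test_function_bounded_derive v tk.
have [_ ->] := @convol_derive _ _ kk (g i) z v (M + N) (Ig i) sk
  (fun w => le_trans (hM w) (introT idP (eqbRL (lerDl _ _) N0)))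
  (fun w => le_trans (hN w) (introT idP (eqbRL (lerDr _ _) M0))).
have mD : measurable_fun [set: mX] (fun w => 'D_v kk (z - w)).
  have ck : continuous ('D_v kk) by apply/smooth_continuous/smooth_derive.
  exact: (measurable_convol_kernel z ck).
have -> : distr Q (conserved p u f rho i) ('D_v psi) =
    \int[mu]_(w in Q) (conserved p u f rho i w * - 'D_v kk (z - w)).
  exact: (congr1 (distr Q (conserved p u f rho i)) (Dpsi v)).
rewrite (integral_conserved i (measurable_funN mD)); last first.
  by move=> w /(Dkk_out v) E0; exact: etrans (congr1 -%R E0) (oppr0 _).
transitivity (- \int[mu]_w (-1 * (g i w * 'D_v kk (z - w)))).
  congr (- _); apply: eq_Rintegral => w _.
  by rewrite mulN1r; exact: mulrN.
rewrite RintegralZl ?mulN1r ?opprK//.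
apply: (@L1_bounded _ mX R mu setT measurableT (g i) _ N) => //.
Qed.

Hypothesis hsol : weak_solution Q p rho u f.

(** The weak equation tested with the kernel reflected and centred at [z], which is admissible
    because its support stays in [B]. *)
Lemma mass_cv : dt (convol kk (g (inl true))) z +
  \sum_j dx j (convol kk (g (inr (inl (true, j))))) z = 0.
Proof.
apply: etrans (hsol.2 _ shifted_test); congr (_ + _).
  exact/esym/(distr_conserved_derive (inl true)).
by apply: eq_bigr => j _; exact/esym/(distr_conserved_derive (inr (inl (true, j)))).
Qed.

Lemma momentum_cv i : dt (convol kk (g (inr (inl (true, i))))) z +
  \sum_j dx j (convol kk (g (inr (inr (i, j))))) z + dx i (convol kk (g (inl false))) z =
  convol kk (g (inr (inl (false, i)))) z.
Proof.
rewrite -(distr_conserved (inr (inl (false, i)))); apply: etrans (hsol.1 i _ shifted_test).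
congr (_ + _ + _).
- exact/esym/(distr_conserved_derive (inr (inl (true, i)))).
- by apply: eq_bigr => j _; exact/esym/(distr_conserved_derive (inr (inr (i, j)))).
- exact/esym/(distr_conserved_derive (inl false)).
Qed.

End mollified_equations.

(** * Identification of the two terms and of the defect *)

(** The antisymmetric part of [G] is orthogonal to a symmetric [S]: this passes from the symmetric
    gradient in [J1] to the full gradient in [stress_work]. *)
Lemma sum_symmetrized (R : realFieldType) d (S G : 'I_d -> 'I_d -> R) :
  (forall i j, S i j = S j i) ->
  \sum_i \sum_j S i j * ((G i j + G j i) / 2) = \sum_i \sum_j S i j * G i j.
Proof.
move=> Ssym.
have h : \sum_i \sum_j S i j * G j i = \sum_i \sum_j S i j * G i j.
  rewrite exchange_big/=; apply: eq_bigr => i _; apply: eq_bigr => j _.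
  by rewrite [S j i]Ssym.
transitivity ((\sum_i \sum_j S i j * G i j + \sum_i \sum_j S i j * G j i) / 2).
  rewrite -big_split mulr_suml; apply: eq_bigr => i _.
  rewrite -big_split mulr_suml; apply: eq_bigr => j _ /=; ring.
by rewrite h; field.
Qed.

Section link.
Context {R : realType} {d : nat} (p : R -> R).
Hypothesis cp : continuous p.
Local Notation E := 'rV[R]_d.
Local Notation X := (R * E)%type.
Local Notation mX := (measurableTypeR R * E)%type.
Local Notation mu := (lebesgue_tx R d).
Variables (eta : E -> R) (heta : radial_kernel eta).
Variables (Omega : set E) (rho : X -> R) (u f : X -> E) (g : component d -> X -> R) (B : set X).
Variables (l r0 : R) (t : R) (x : E).
Hypotheses (lp : 0 < l) (lr : l <= r0 / 2).
Hypothesis oOmega : open Omega.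
Hypothesis Ig : forall i, (lebesgue_rV d).-integrable setT (EFin \o (fun y => g i (t, y))).
Hypothesis g_raw : {ae lebesgue_rV d, forall y, B (t, y) -> forall i, g i (t, y) = conserved p u f rho i (t, y)}.
Hypothesis BOmega : forall y, B (t, y) -> Omega y.
Hypothesis nbB : forall y, `|x - y| <= r0 -> B (t, y).
Hypothesis g_sym : forall i j, g (iMM i j) = g (iMM j i).
Let Y i o := mollx_data g eta l (t, x) i o.
Hypothesis Y0 : 0 < Y iR None.

(** Proved in a neighbourhood of [x] because the fields will be differentiated there: one half of
    [r0] is for moving the point, the other for the radius [l] of the kernel. *)
Let moll_sm i x' : `|x - x'| <= r0 / 2 ->
  moll Omega eta l (conserved p u f rho i) (t, x') = mollx (eta_l eta l) (g i) (t, x').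
Proof.
move=> xx'; have near y : eta_l eta l (x' - y) != 0 -> B (t, y).
  move=> ne; apply: nbB; rewrite -(subrKA x') (le_trans (ler_normD _ _))//.
  rewrite [leRHS]splitr lerD// (le_trans _ lr)// leNgt; apply/negP => h; move/eqP: ne; apply.
  by apply: eta_l_out => //; exact: ltW.
have mk : measurable_fun setT (fun y : E => eta_l eta l (x' - y)).
  by apply: measurable_mollx_kernel; exact/smooth_continuous/eta_l_smooth.
have mO : measurable Omega by exact: open_measurable_rV.
rewrite /moll /mollx; transitivity (\int[lebesgue_rV d]_(y in Omega) (g i (t, y) * eta_l eta l (x' - y))).
  apply: ae_eq_Rintegral => //.
    by apply: measurable_funTS; apply: measurable_funM => //; exact: L1_measurable (Ig i).
  move: g_raw => [N [mN N0 sub]]; exists N; split => // y ny; apply: sub => /= h; apply: ny => Oy.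
  by have [->|/near By] := eqVneq (eta_l eta l (x' - y)) 0; [rewrite !mulr0|rewrite (h By)].
rewrite Rintegral_mkcond; apply: eq_Rintegral => y _; rewrite patchE; case: ifPn => //.
rewrite notin_setE => nO; have [->|/near/BOmega//] := eqVneq (eta_l eta l (x' - y)) 0.
by rewrite mulr0.
Qed.

Let r00 : 0 < r0.
Proof. by have := lt_le_trans lp lr; rewrite pmulr_lgt0 ?invr_gt0. Qed.

Let moll_smY i : moll Omega eta l (conserved p u f rho i) (t, x) = Y i None.
Proof. by apply: moll_sm; rewrite subrr normr0 divr_ge0// ltW. Qed.

Let is_derive_smY i j :
  is_derive ((t, x) : X) ((0, delta_mx ord0 j) : X) (mollx (eta_l eta l) (g i)) (Y i (Some j)).
Proof.
have [N N0 hN] := eta_l_diff_bounded heta lp.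
have [d1 d2] := @mollx_derive _ _ (eta_l eta l) (g i) t x (delta_mx ord0 j) N (Ig i)
  (eta_l_smooth heta l) (hN None) (hN (Some j)).
by apply: DeriveDef.
Qed.

(** A space derivative sees only the line through [(t, x)] at time [t], where [moll_sm] replaces the
    given fields by the truncated ones. *)
Let dx_favre i j : dx j (fun w => favre_vec Omega eta l rho u w ord0 i) (t, x) =
  gradv (Y iR None) (fun i => Y (iM i) None) (fun j => Y iR (Some j)) (fun i j => Y (iM i) (Some j)) i j.
Proof.
transitivity ('D_((0, delta_mx ord0 j) : X)
    (fun w : X => mollx (eta_l eta l) (g (iM i)) w / mollx (eta_l eta l) (g iR) w) (t, x)).
  apply: derive_eq_line; near=> h.
  have -> : h *: ((0, delta_mx ord0 j) : X) + (t, x) = (t, h *: delta_mx ord0 j + x).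
    by congr pair; rewrite /= scaler0 add0r.
  have hx : `|x - (h *: delta_mx ord0 j + x)| <= r0 / 2.
    rewrite opprD addrCA subrr addr0 normrN normrZ.
    have dj : `|delta_mx ord0 j : E| <= 1.
      by rewrite (le_trans (norm_le_enorm _))// enorm_delta.
    apply: (@le_trans _ _ `|h|); first by rewrite -[leRHS]mulr1 ler_wpM2l.
    near: h; apply/nbhs_ballP; exists (r0 / 2) => /=; first by rewrite divr_gt0.
    by move=> h; rewrite /ball/= sub0r normrN => /ltW.
  rewrite mxE /favre.
  by rewrite -(moll_sm (iM i) hx) -(moll_sm iR hx).
have [_ ->] := is_derive_vel (z := (t, x) : X) (m := fun w i => mollx (eta_l eta l) (g (iM i)) w) Y0
  (is_derive_smY iR j) (fun i => is_derive_smY (iM i) j) i.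
by [].
Unshelve. all: by end_near. Qed.

(** The prefactor in [J1] turns the Favre stress into m (x) m / r - M, which is symmetric. *)
Lemma J1_J2_workY : J1 Omega eta l rho u (t, x) + J2 Omega eta l p rho u (t, x) = workY p Y.
Proof.
have rn : Y iR None != 0 by rewrite gt_eqF.
rewrite /workY /stress_work; congr (_ + _); last first.
  rewrite /J2 (moll_smY iR) (moll_smY iQ) /divx; congr (_ * _).
  by apply: eq_bigr => j _; rewrite dx_favre.
rewrite /J1 (moll_smY iR).
set gv := gradv _ _ _ _.
have Eg i j : symgradx (favre_vec Omega eta l rho u) (t, x) i j = (gv i j + gv j i) / 2.
  by rewrite /symgradx !mxE !dx_favre mulrC.
pose S i j := Y (iM i) None * Y (iM j) None / Y iR None - Y (iMM i j) None.
have Ssym i j : S i j = S j i by rewrite /S /Y /mollx_data g_sym [Y _ _ * _]mulrC.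
have ES i j : Y iR None * (otimes (favre_vec Omega eta l rho u (t, x)) (favre_vec Omega eta l rho u (t, x)) -
    favre_mx Omega eta l rho (fun w => otimes (u w) (u w)) (t, x)) i j = S i j.
  rewrite /otimes !mxE big_ord1 !mxE /favre.
  rewrite (moll_smY iR) (moll_smY (iM i)) (moll_smY (iM j)) (moll_smY (iMM i j)) /S.
  by field.
transitivity (\sum_i \sum_j S i j * ((gv i j + gv j i) / 2)).
  rewrite /ddot mulr_sumr; apply: eq_bigr => i _; rewrite mulr_sumr; apply: eq_bigr => j _.
  by rewrite mulrA ES Eg.
exact: sum_symmetrized.
Qed.

End link.

Section defect.
Context {R : realType} {d : nat} (p : R -> R).
Hypothesis cp : continuous p.
Local Notation E := 'rV[R]_d.
Local Notation X := (R * E)%type.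
Local Notation mX := (measurableTypeR R * E)%type.
Local Notation mu := (lebesgue_tx R d).
Variables (g : component d -> X -> R) (a b H : X -> R) (C0 c : R) (B Q : set X) (phi : X -> R).
Hypothesis adm : admissible g a b H C0 c B.
Variables (rho : X -> R) (u f : X -> E) (l0 : R).
Hypothesis tphi : test_function Q phi.
Local Notation K := (supp phi).
Hypothesis l0p : 0 <= l0.
Hypothesis l0B : forall z y, K z -> `|z.2 - y| <= l0 -> B (z.1, y).
Hypothesis mQ : measurable (Q : set mX).
Hypothesis g_raw : {ae mu, forall z, B z -> forall i, g i z = conserved p u f rho i z}.

Let KB z : K z -> B z.
Proof. by move=> Kz; rewrite [z]surjective_pairing; apply: l0B => //=; rewrite subrr normr0. Qed.

Let KQ : K `<=` Q. Proof. by case: tphi. Qed.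
Let mK : measurable (K : set mX). Proof. by apply: compact_measurable_tx; case: tphi. Qed.

Lemma integrable_supp (h : X -> R) : mu.-integrable K (EFin \o h) ->
  (forall z, ~ K z -> h z = 0) -> mu.-integrable setT (EFin \o h).
Proof.
move=> Ih h0; rewrite (_ : EFin \o h = (EFin \o h) \_ K); first exact/(integrable_mkcond _ mK).
by apply/funext => z; rewrite patchE; case: ifPn => //; rewrite notin_setE /= => /h0 ->.
Qed.

Lemma Rintegral_supp (A : set X) (h : X -> R) : K `<=` A -> (forall z, ~ K z -> h z = 0) ->
  \int[mu]_(z in A) h z = \int[mu]_(z in K) h z.
Proof.
move=> KA h0; rewrite Rintegral_mkcond [RHS]Rintegral_mkcond; apply: eq_Rintegral => z _.
rewrite !patchE; have [Kz|nK] := pselect (K z).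
  by rewrite !mem_set//; exact: KA.
by rewrite (memNset nK); case: ifP => // _; exact: h0.
Qed.

(** Measurability is asked of [h] alone, through its integrability; [F] may be any function that
    agrees with it almost everywhere after multiplication by [k]. *)
Lemma distr_ae (F k h : X -> R) : mu.-integrable K (EFin \o h) ->
  (forall z, ~ K z -> h z = 0) -> (forall z, ~ K z -> k z = 0) ->
  {ae mu, forall z, K z -> F z * k z = h z} -> distr Q F k = \int[mu]_(z in K) h z.
Proof.
move=> Ih h0 k0 [N [mN N0 sub]]; rewrite -(Rintegral_supp KQ h0); apply: ae_eq_Rintegral => //.
  by apply: measurable_funTS; exact: L1_measurable (integrable_supp Ih h0).
exists N; split => // z nz; apply: sub => /= hz; apply: nz => _.
by have [/hz//|nK] := pselect (K z); rewrite h0// k0// mulr0.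
Qed.

Let phi_out z : ~ K z -> phi z = 0. Proof. exact: out_supp. Qed.
Let Dphi_out w z : ~ K z -> 'D_w phi z = 0. Proof. exact: out_supp_derive. Qed.

Let m z i := g (iM i) z.
Let e z := ener p (g iR z) (m z).
Let T0 z := e z * dt phi z.
Let Tj j z := (m z j / g iR z * (e z + g iQ z) -
  \sum_i (m z i * m z j / g iR z - g (iMM i j) z) * (m z i / g iR z)) * dx j phi z.
Let Tf z := (\sum_i m z i / g iR z * g (iF i) z) * phi z.

Let mphi : measurable_fun [set: mX] phi.
Proof. by apply: continuous_measurable_tx; apply/smooth_continuous; case: tphi. Qed.
Let mDphi w : measurable_fun [set: mX] ('D_w phi).
Proof. by apply: continuous_measurable_tx; apply/smooth_continuous/smooth_derive; case: tphi. Qed.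
Let d0 : dominated K (cst 0 : X -> R) (cst 1).
Proof. by exists 0 => // z _; rewrite normr0 mul0r. Qed.

(** The defect is a combination of separate integrals, so recombining them needs each term to be
    integrable on its own: all other slots of [flux_integrable] are set to 0. *)
Let I0 : mu.-integrable K (EFin \o T0).
Proof.
have := flux_integrable cp adm tphi l0B (ph := cst 0) (phx := fun=> cst 0) l0p (measurable_cst _)
  (mDphi (1, 0)) (fun j => measurable_cst _) d0 (dominated_test_derive tphi _) (fun=> d0).
apply: eq_integrable => // z _ /=; congr EFin; rewrite /fluxY /energy_flux mulr0 addr0.
rewrite big1 ?addr0; last by move=> j _; rewrite mulr0.
by rewrite big1 ?subr0// => i _; rewrite big1// => j _; rewrite mulr0.
Qed.

Let If : mu.-integrable K (EFin \o Tf).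
Proof.
have := flux_integrable cp adm tphi l0B (pht := cst 0) (phx := fun=> cst 0) l0p mphi (measurable_cst _)
  (fun j => measurable_cst _) (dominated_test tphi) d0 (fun=> d0).
apply: eq_integrable => // z _ /=; congr EFin; rewrite /fluxY /energy_flux mulr0 add0r.
rewrite big1 ?add0r; last by move=> j _; rewrite mulr0.
by rewrite big1 ?oppr0 ?add0r// => i _; rewrite big1// => j _; rewrite mulr0.
Qed.

Let Ij j : mu.-integrable K (EFin \o Tj j).
Proof.
have mp k : measurable_fun [set: mX] (fun z => if k == j then dx j phi z else 0).
  by case: eqP => _; [exact: mDphi|exact: measurable_cst].
have dp k : dominated K (fun z => if k == j then dx j phi z else 0) (cst 1).
  by case: eqP => _; [exact: (dominated_test_derive tphi)|exact: d0].
have := flux_integrable cp adm tphi l0B (ph := cst 0) (pht := cst 0)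
  (phx := fun z k => if k == j then dx j phi z else 0) l0p (measurable_cst _) (measurable_cst _)
  mp d0 d0 dp.
apply: eq_integrable => // z _ /=; congr EFin; rewrite /fluxY /energy_flux !mulr0 add0r addr0 /Tj mulrBl.
congr (_ - _).
  by rewrite (bigD1 j)//= eqxx big1 ?addr0// => k /negbTE ->; rewrite mulr0.
rewrite mulr_suml; apply: eq_bigr => i _.
by rewrite (bigD1 j)//= eqxx big1 ?addr0// => k /negbTE ->; rewrite mulr0.
Qed.

(** At the unregularised fields m / r = u and the stress vanishes, which leaves exactly the
    integrands of the defect. *)
Lemma defect_flux :
  defect Q p rho u f phi = \int[mu]_(z in K) flux_phi p phi (fun z i _ => g i z) z.
Proof.
have gc z : K z -> 0 < g iR z by move=> /KB /(adm_gB adm); apply: lt_le_trans (adm_c0 adm).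
have kinE z : K z -> (forall i, g i z = conserved p u f rho i z) ->
    e z = rho z * enorm (u z) ^+ 2 / 2 + internal_energy p (rho z).
  move=> Kz gz; have := gc _ Kz; rewrite /e /ener /m gz /= => r0.
  congr (_ + _); rewrite /enorm sqr_sqrtr; last first.
    by apply: sumr_ge0 => i _; rewrite -expr2 sqr_ge0.
  rewrite (_ : \sum_i g (iM i) z ^+ 2 = rho z ^+ 2 * dotv (u z) (u z)).
    by field; rewrite gt_eqF.
  by rewrite /dotv mulr_sumr; apply: eq_bigr => i _; rewrite gz /= exprMn expr2 -expr2 expr2.
have ae_K (P : X -> Prop) : (forall z, K z -> (forall i, g i z = conserved p u f rho i z) -> P z) ->
    {ae mu, forall z, K z -> P z}.
  move=> hP; move: g_raw => [N [mN N0 sub]]; exists N; split => // z nz; apply: sub => /= h.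
  by apply: nz => Kz; apply: hP => // i; apply: h; exact: KB.
rewrite /defect /distr_dt /distr_dx.
have -> : distr Q (fun z => rho z * enorm (u z) ^+ 2 / 2 + internal_energy p (rho z)) (dt phi) =
    \int[mu]_(z in K) T0 z.
  apply: distr_ae => //.
  - by move=> z nK; rewrite /T0 /dt Dphi_out// mulr0.
  - by move=> z; exact: Dphi_out.
  - by apply: ae_K => z Kz gz; rewrite /T0 kinE.
have -> : distr Q (fun z => rho z * dotv (f z) (u z)) phi = \int[mu]_(z in K) Tf z.
  apply: distr_ae => //.
  - by move=> z nK; rewrite /Tf phi_out// mulr0.
  - apply: ae_K => z Kz gz; have := gc _ Kz; rewrite gz /= => r0; congr (_ * _).
    rewrite /dotv mulr_sumr; apply: eq_bigr => i _; rewrite /m !gz /=; field.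
    by rewrite gt_eqF.
under eq_bigr => j _.
  have -> : distr Q (fun z => u z ord0 j * (rho z * enorm (u z) ^+ 2 / 2 + p (rho z) +
      internal_energy p (rho z))) (dx j phi) = \int[mu]_(z in K) Tj j z.
    apply: distr_ae; first exact: Ij.
    - by move=> z nK; rewrite /Tj /dx Dphi_out// mulr0.
    - by move=> z; exact: Dphi_out.
    - apply: ae_K => z Kz gz; have := gc _ Kz; rewrite gz /= => r0; congr (_ * _).
      have rn : rho z != 0 by rewrite gt_eqF.
      (* The stress: (rho u_i)(rho u_j) / rho = rho u_i u_j. *)
      rewrite big1 ?subr0; last first.
        move=> i _; rewrite /m !gz /= /otimes mxE big_ord1 !mxE.
        rewrite (_ : _ - _ = 0) ?mul0r//; by field.
      rewrite kinE// /m !gz /=; by field.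
  over.
rewrite (_ : \int[mu]_(z in K) flux_phi p phi (fun z i _ => g i z) z =
  \int[mu]_(z in K) (T0 z + (\sum_j Tj j z + Tf z))); last first.
  apply: eq_Rintegral => z _; rewrite /flux_phi /fluxY /energy_flux addrA; congr (_ + _).
  rewrite -addrA; congr (_ + _).
  rewrite [X in _ - X]exchange_big -sumrB; apply: eq_bigr => j _.
  by rewrite /Tj mulrBl mulr_suml.
have IS : mu.-integrable K (EFin \o (fun z => \sum_j Tj j z)) by exact: L1_sum.
rewrite RintegralD//; last exact: L1D.
rewrite RintegralD// Rintegral_sum// !opprD opprK sumrN opprK opprK addrA.
by [].
Qed.

End defect.

(** * Consequences of the Lebesgue class hypotheses on the domain *)

Section lebesgue_classes.
Context d (T : measurableType d) (R : realType) (mu : {measure set T -> \bar R}) (Q : set T).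
Hypothesis mQ : measurable Q.

Lemma Lfun_restrict_measurable (q : \bar R) (F : T -> R) : F \_ Q \in Lfun mu q ->
  measurable_fun Q F.
Proof.
rewrite inE => /andP[/[!inE]/= mF _].
by have := (measurable_restrict F mQ measurableT).2 mF; rewrite setTI.
Qed.

Lemma Lfun_restrict_oo_bounded (F : T -> R) : F \_ Q \in Lfun mu +oo%E ->
  exists M, {ae mu, forall z, Q z -> `|F z| <= M}.
Proof.
rewrite inE => /andP[_]; rewrite inE/= /finite_norm unlock /Lnorm.
(* On a space of measure 0 the norm is a default value, but there any bound holds almost
   everywhere. *)
case: ifPn => [_|]; last first.
  rewrite -leNgt measure_le0 => /eqP mu0 _; exists 0.
  by exists setT; split => //; exact: measurableT.
move=> /ess_sup_inf.ess_supr_bounded[M [N [mN N0 sub]]]; exists M, N; split => // z nz; apply: sub => /= h.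
by apply: nz => Qz; move: h; rewrite patchE mem_set.
Qed.

Let integrable_patch (F G : T -> R) : G = F \_ Q -> mu.-integrable setT (EFin \o G) ->
  mu.-integrable Q (EFin \o F).
Proof.
move=> -> IG; apply/(integrable_mkcond _ mQ); move: IG; congr (mu.-integrable _ _).
by apply/funext => z /=; rewrite !patchE; case: ifP.
Qed.

Lemma Lfun_restrict_cube (F : T -> R) : F \_ Q \in Lfun mu 3%:E ->
  mu.-integrable Q (EFin \o (fun z => `|F z| ^+ 3)).
Proof.
have h3 : 1 <= 3 :> R by rewrite ler1n.
move=> /(Lfun_integrable h3); apply: integrable_patch; apply/funext => z.
rewrite powR_mulrn// !patchE; case: ifP => // _.
by rewrite normr0 expr0n.
Qed.

(** The power 3/2 written as the cube of a square root, the form in which the force enters the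
    weight. *)
Lemma Lfun_restrict_sqrt_cube (F : T -> R) : F \_ Q \in Lfun mu (3 / 2)%:E ->
  mu.-integrable Q (EFin \o (fun z => Num.sqrt `|F z| ^+ 3)).
Proof.
have h3 : 1 <= 3 / 2 :> R by lra.
move=> /(Lfun_integrable h3); apply: integrable_patch; apply/funext => z.
rewrite mulrC powRrM powR12_sqrt// powR_mulrn ?sqrtr_ge0// !patchE; case: ifP => // _.
by rewrite normr0 sqrtr0 expr0n.
Qed.

Lemma ae_forall_fin (I : finType) (P : I -> T -> Prop) : (forall i, {ae mu, forall x, P i x}) ->
  {ae mu, forall x, forall i, P i x}.
Proof. by move=> h; exact: filter_forall. Qed.

Lemma ae_and (P P' : T -> Prop) : {ae mu, forall x, P x} -> {ae mu, forall x, P' x} ->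
  {ae mu, forall x, P x /\ P' x}.
Proof. by move=> h h'; exact: filterI. Qed.

Lemma ae_imp (P P' : T -> Prop) : (forall x, P x -> P' x) -> {ae mu, forall x, P x} ->
  {ae mu, forall x, P' x}.
Proof. by move=> h; apply: filterS. Qed.

End lebesgue_classes.

(** Convergence is proved for one test function at a time, and the truncated fields depend on it.
    The two tested terms equal the work, the work equals the flux for each small [l], and the flux
    converges to the defect. *)
Theorem theorem2p4 (R : realType) (d : nat) (hd : (0 < d)%N)
  (Omega : set 'rV[R]_d) (hOmega : open Omega) (T : R) (hT : 0 < T)
  (p : R -> R) (hp : continuous p) (hp0 : p 0 = 0)
  (rho : R * 'rV[R]_d -> R) (u f : R * 'rV[R]_d -> 'rV[R]_d)
  (hsol : weak_solution (cylinder T Omega) p rho u f)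
  (hu : Lp_vector (cylinder T Omega) 3%:E u)
  (hrho : Lp_scalar (cylinder T Omega) +oo%E rho)
  (c : R) (hc : 0 < c)
  (hrhoc : {ae lebesgue_tx R d, forall z, cylinder T Omega z -> c <= rho z})
  (hf : Lp_vector (cylinder T Omega) (3 / 2)%:E f)
  (eta : 'rV[R]_d -> R) (heta : radial_kernel eta) :
  distr_cvg0 (cylinder T Omega)
    (fun l z => J1 Omega eta l rho u z + J2 Omega eta l p rho u z)
    (defect (cylinder T Omega) p rho u f).
Proof.
set Q := cylinder T Omega; set mu := lebesgue_tx R d.
have oQ : open (Q : set (R * 'rV[R]_d)).
  rewrite /Q /cylinder (_ : _ `*` _ = fst @^-1` `]0, T[%classic `&` snd @^-1` Omega)//.
  apply: openI; first by apply: open_comp (@interval_open _ _ _ _ _) => // z _; exact: cvg_fst.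
  by apply: open_comp hOmega => z _; exact: cvg_snd.
have mQ : measurable (Q : set (measurableTypeR R * 'rV[R]_d)) by exact: open_measurable_tx.
have mrho := Lfun_restrict_measurable mQ hrho.
have mu_ i := Lfun_restrict_measurable mQ (hu i).
have mf i := Lfun_restrict_measurable mQ (hf i).
have Iu i := Lfun_restrict_cube mQ (hu i).
have If i := Lfun_restrict_sqrt_cube mQ (hf i).
have [M hM] := Lfun_restrict_oo_bounded hrho.
(* The maximum guarantees c <= C whatever essential bound [M] was obtained. *)
pose C := Num.max c M.
have cC : c <= C by rewrite le_max lexx.
have rhoC : {ae mu, forall z, Q z -> c <= rho z <= C}.
  apply: ae_imp (ae_and hrhoc hM) => z [h1 h2] Qz.
  by rewrite h1//= le_max (le_trans (ler_norm _) (h2 Qz)) orbT.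
have [Cp [Cp0 hCp]] : exists Cp, 0 <= Cp /\ forall r, c <= r <= C -> `|p r| <= Cp.
  have /compact_bounded[N [_ hN]] : compact (p @` `[c, C]%classic).
    by apply: continuous_compact; [exact: continuous_subspaceT|exact: segment_compact].
  exists (`|N| + 1); split; first by rewrite addr_ge0.
  move=> r rc; apply: hN; first by rewrite (le_lt_trans (ler_norm _))// ltrDl.
  by exists r => //=; rewrite in_itv/=.
move=> phi tphi; have [_ cK KQ] := tphi.
have [r0 r00 hr0] := compact_uniform_nbhs cK oQ KQ.
have [M0 [_ hM0]] := compact_bounded cK.
pose R1 := `|M0| + 1 + r0.
(* Contains every point within [r0] of the support of phi, and has finite measure, so that the
   clamped density is integrable on it. *)
pose B := Q `&` [set z | `|z.1| <= R1 /\ `|z.2| <= R1].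
have boxB z w : supp phi z -> `|z.1 - w.1| <= r0 -> `|z.2 - w.2| <= r0 -> B w.
  move=> Kz h1 h2.
  have zM : `|z| <= `|M0| + 1.
    by apply: hM0 => //; rewrite (le_lt_trans (ler_norm _))// ltrDl.
  split; first by apply: (hr0 z) => //; rewrite prod_normE ge_max h1 h2.
  have tri (V : normedModType R) (x y : V) : `|x| <= `|M0| + 1 -> `|x - y| <= r0 -> `|y| <= R1.
    move=> hx hxy; rewrite -(subKr x y) (le_trans (ler_normB _ _))// lerD//.
  split; [apply: tri h1|apply: tri h2]; apply: le_trans zM; rewrite prod_normE le_max lexx ?orbT//.
have BQ : B `<=` Q by move=> z [].
have mB : measurable (B : set (measurableTypeR R * 'rV[R]_d)).
  by apply: measurableI => //; apply: closed_measurable_tx; exact: closed_tx_box.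
have R10 : 0 <= R1 by rewrite !addr_ge0// ltW.
have fB : (mu B < +oo)%E.
  apply: le_lt_trans (lebesgue_tx_box_fin d R1 R10); apply: le_measure.
  - by rewrite inE.
  - by rewrite inE; apply: closed_measurable_tx; exact: closed_tx_box.
  - by move=> z [].
pose g := truncated p B rho u f c C.
have adm : admissible g (speed B u) (force B f) (weight B u f) (C + Cp) c B.
  exact: (truncated_admissible hp mQ mB BQ fB hc cC Cp0 hCp mrho mu_ mf Iu If).
have g_raw : {ae mu, forall z, B z -> forall i, g i z = conserved p u f rho i z}.
  exact: (truncated_conserved p u f BQ rhoC).
have g_out i z : ~ B z -> g i z = 0 by exact: truncated_out.
(* The other half of [r0] is left for moving the point when the Favre velocity is differentiated. *)
pose l0 := r0 / 2.
have l00 : 0 < l0 by rewrite divr_gt0.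
have l0r : l0 <= r0 by rewrite ler_pdivrMr// ler_peMr ?ler1n// ltW.
have l0B z y : supp phi z -> `|z.2 - y| <= l0 -> B (z.1, y).
  by move=> Kz h; apply: (boxB z) => //=; [rewrite subrr normr0 ltW|exact: le_trans h l0r].
have [_ Flux] := flux_phi_cvg hp adm heta tphi l0B l00.
have mK : measurable (supp phi : set (measurableTypeR R * 'rV[R]_d)) by exact: compact_measurable_tx.
have work0 l z : ~ supp phi z -> work_phi p phi (mollx_data g eta l) z = 0.
  by move=> nK; rewrite /work_phi (out_supp nK) mulr0.
have Iwork l : 0 < l -> l <= l0 -> mu.-integrable setT (EFin \o work_phi p phi (mollx_data g eta l)).
  move=> lp ll; apply: (integrable_supp tphi) => //; last exact: work0.
  exact: (mollx_data_integrable hp adm heta tphi l0B lp ll).2.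
(* Times at which all sections are integrable and the truncated fields equal the given ones almost
   everywhere in space; the pointwise identification of [J1] and [J2] works at these times. *)
have good : {ae mu, forall z, (forall i, (lebesgue_rV d).-integrable setT (EFin \o (fun y => g i (z.1, y)))) /\
    {ae lebesgue_rV d, forall y, B (z.1, y) -> forall i, g i (z.1, y) = conserved p u f rho i (z.1, y)}}.
  apply: ae_and; last exact: (ae_fst _ (ae_xsection g_raw)).
  apply: ae_forall_fin => i; exact: (ae_fst _ (ae_section_rV (adm_g adm i))).
have JE l : 0 < l -> l <= l0 -> {ae mu, forall z, Q z ->
    (J1 Omega eta l rho u z + J2 Omega eta l p rho u z) * phi z = work_phi p phi (mollx_data g eta l) z}.
  move=> lp ll; apply: ae_imp good => -[t x] [/= Igz gz] Qz.
  have [Kz|nK] := pselect (supp phi (t, x)); last by rewrite work0// (out_supp nK) mulr0.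
  congr (_ * _); apply: (J1_J2_workY heta (B := B) (f := f) lp ll hOmega Igz gz).
  - by move=> y /BQ[].
  - by move=> y h; apply: (boxB (t, x)) => //=; rewrite subrr normr0 ltW.
  - move=> i j; rewrite /g /truncated /= /otimes; congr (_ \_ _); apply/funext => z.
    by rewrite !mxE !big_ord1 !mxE [u z ord0 i * _]mulrC.
  - exact: lt_le_trans hc (mollx_data_ge adm heta l0B lp ll Kz).
split.
  near=> l.
  have lp : 0 < l by near: l; exact: nbhs_right_gt.
  have ll : l <= l0 by near: l; exact: nbhs_right_le.
  exists (work_phi p phi (mollx_data g eta l)); last exact: JE.
  by apply: integrableS (Iwork l lp ll).
rewrite (defect_flux hp adm tphi (ltW l00) l0B mQ g_raw).
(* For small [l] the tested terms and the flux integral are equal, so they have the same limit. *)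
apply: cvg_trans Flux; apply: near_eq_cvg; near=> l.
have lp : 0 < l by near: l; exact: nbhs_right_gt.
have ll : l <= l0 by near: l; exact: nbhs_right_le.
have boxBl z w : supp phi z -> `|z.1 - w.1| <= r0 -> `|z.2 - w.2| <= l -> B w.
  by move=> Kz h1 h2; apply: (boxB z) => //; apply: le_trans h2 (le_trans ll l0r).
rewrite (integral_flux_work hp adm heta (n0 := hd) tphi l0B lp ll r00 boxBl); last 2 first.
- move=> e z ep er Kz; apply: (mass_cv heta hd mQ BQ (adm_g adm) g_raw ep lp _ hsol) => w h1 h2.
  by apply: (boxBl z) => //; exact: le_trans h1 er.
- move=> e z i ep er Kz; apply: (momentum_cv heta hd mQ BQ (adm_g adm) g_raw ep lp _ hsol) => w h1 h2.
  by apply: (boxBl z) => //; exact: le_trans h1 er.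
rewrite -(Rintegral_supp KQ (@work0 l)) /distr; apply/esym; apply: ae_eq_Rintegral => //.
  by apply: measurable_funTS; exact: L1_measurable (Iwork l lp ll).
exact: JE.
Unshelve. all: by end_near. Qed.
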